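(* Fix a unit vector $e_1\in\mathfrak{su}(2)$, and for $q\geq0$ let $M_q=M(0,qe_1,0)$ be Kronheimer's space of solutions of Nahm's equations with its hyperkähler structure $(\tilde g,\tilde I,\tilde J,\tilde K)$. For $q>0$ let $\overline N_{q,0}$ be the extended type-1 leaf with its hyperkähler structure $(g,I,J,K)$, and let $$h_q:M_q\to\overline N_{q,0},\qquad (B_1,B_2,B_3)\mapsto(B_2(0),B_3(0),B_1(0));$$ for $q=0$ let $h_0:M_0\to N_{0,0}$ be given by the same formula, with the type-0 leaf $N_{0,0}$ as target. Then for any $q\ge0$ the diffeomorphism $h_q$ is an isomorphism of hyperkähler structures.
   Context: Inner product: $\langle\cdot,\cdot\rangle$ is the positive definite Ad-invariant inner product on $\mathfrak{su}(2)$ normalized so that $(\mathfrak{su}(2),[\cdot,\cdot],\langle\cdot,\cdot\rangle)\cong(\mathbb{R}^3,\times,\cdot)$, i.e. $\langle x,y\rangle=-2\operatorname{tr}(xy)$. Let $\Phi(a_1,a_2,a_3)=\langle a_1,[a_2,a_3]\rangle$. Leaves: for $q,r\ge0$, $N_{q,r}\subset\mathfrak{su}(2)^3$ is the set of all $(a_1,a_2,a_3)$ with $\langle a_i,a_j\rangle=0$ for $i\ne j$, $\langle a_1,a_1\rangle-\langle a_2,a_2\rangle=q$, $\langle a_2,a_2\rangle-\langle a_3,a_3\rangle=r$, $\Phi<0$. It is a symplectic leaf of Xu's hyper-Lie Poisson structure on $\{\Phi\neq0\}\subset\mathfrak{su}(2)^3$, and its induced hyperkähler structure $(g,I,J,K)$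 is given in the global frame $V_0=([a_2,a_3],[a_3,a_1],[a_1,a_2])$, $V_1=(0,[a_2,a_1],[a_3,a_1])$, $V_2=([a_1,a_2],0,[a_3,a_2])$, $V_3=([a_1,a_3],[a_2,a_3],0)$ by $g(V_i,V_j)=-\delta_{ij}\Phi$, $I(V_0,V_1,V_2,V_3)=(V_1,-V_0,V_3,-V_2)$, $J(V_0,V_1,V_2,V_3)=(V_2,-V_3,-V_0,V_1)$, $K(V_0,V_1,V_2,V_3)=(V_3,V_2,-V_1,-V_0)$. The leaf $N_{0,0}$ is of type 0; the leaves $N_{q,0}$ with $q>0$ are of type 1. For $q>0$, the hyperkähler structure on $N_{q,0}$ extends to its closure $\overline N_{q,0}$ in $\mathfrak{su}(2)^3$ (Xu); this is the extended type-1 leaf. Nahm's equations: $\dot B_1=-[B_2,B_3]$, $\dot B_2=-[B_3,B_1]$, $\dot B_3=-[B_1,B_2]$ for $(B_1,B_2,B_3):(-\infty,0]\to\mathfrak{su}(2)^3$. A triple $(\tau_1,\tau_2,\tau_3)\in\mathfrak{su}(2)^3$ is regular if its span is $1$-dimensional. For a regular triple, $M(\tau_1,\tau_2,\tau_3)$ is the space of solutions such that for some $g\in\mathrm{SU}(2)$, $\lim_{t\to-\infty}B_i(t)=\mathrm{Ad}_g\tau_i$ for $i=1,2,3$. $M(0,0,0)$ is the space of solutions with $\lim_{t\to-\infty}B_i(t)=0$ for $i=1,2,3$. These are hyperkähler manifolds by results of Kronheimer. For a regular triple, the tangent space at $(B_1,B_2,B_3)$ is identified with the solutions $b=(b_0,b_1,b_2,b_3):(-\infty,0]\to\mathfrak{su}(2)^4$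 of $\dot b_0+[B_1,b_1]+[B_2,b_2]+[B_3,b_3]=0$, $\dot b_1-[B_1,b_0]+[B_2,b_3]-[B_3,b_2]=0$, $\dot b_2-[B_1,b_3]-[B_2,b_0]+[B_3,b_1]=0$, $\dot b_3+[B_1,b_2]-[B_2,b_1]-[B_3,b_0]=0$, satisfying $\sup_{t,j}e^{\eta|t|}|b_j|+\sup_{t,j}e^{\eta|t|}|\dot b_j|<\infty$ for some $\eta>0$. For $M(0,0,0)$ the same description holds with a different norm in place of this one (see A. G. Kovalev, Nahm's equations and complex adjoint orbits, Quart. J. Math. Oxford 47 (1996)). Under this identification the differential of $B\mapsto(B_1(0),B_2(0),B_3(0))$ sends $b$ to $(b_1(0),b_2(0),b_3(0))$. The hyperkähler structure is $\tilde g(b,c)=\sum_{j=0}^3\int_{-\infty}^0\langle b_j(s),c_j(s)\rangle\,ds$, $\tilde I b=(-b_1,b_0,-b_3,b_2)$, $\tilde Jb=(-b_2,b_3,b_0,-b_1)$, $\tilde Kb=(-b_3,-b_2,b_1,b_0)$. An isomorphism of hyperkähler structures $(\tilde M,\tilde g,\tilde I,\tilde J,\tilde K)\to(M,g,I,J,K)$ is a diffeomorphism $F$ that is an isometry and satisfies $(IF_*,JF_*,KF_* )=(F_*\tilde I,F_*\tilde J,F_*\tilde K)O$ (row vector times matrix) for some $O\in\mathrm{SO}(3)$.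
   Formalization: For q>0 the target is the closure of N_{q²,0} instead of N_{q,0}, since |B_2|²−|B_1|² is conserved with limit q² (the printed index fails unless q=1); for q=0 the zero solution is removed from M_0, since h_0 sends it to 0, which is not in N_{0,0}. *)

(* Defs.v *)
From HB Require Import structures.
From mathcomp Require Import all_boot all_order all_algebra.
From mathcomp Require Import spectral.
From mathcomp Require Import complex.
From mathcomp Require Import all_classical all_reals all_analysis.
From mathcomp Require Import ring lra.

Set Implicit Arguments.
Unset Strict Implicit.
Unset Printing Implicit Defensive.

Import Order.TTheory GRing.Theory Num.Theory.
Import numFieldNormedType.Exports.

Local Open Scope classical_set_scope.
Local Open Scope complex_scope.
Local Open Scope sesquilinear_scope.
Local Open Scope ring_scope.

(** * The Lie algebra su(2) *)

(* su(2) is given by its coordinates in the basis -i/2 sigma_k of half Pauli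
   matrices: x : 'rV[R]_3 stands for the matrix su2_mx x.  The lemmas below
   show that su2_mx is a linear bijection onto the traceless skew-Hermitian
   matrices which turns [bracket] into the commutator and [inner] into
   -2 tr(XY). *)
Notation su2 R := 'rV[R]_3.

Definition su2_mx {R : realType} (x : su2 R) : 'M[R[i]]_2 :=
  \matrix_(i < 2, j < 2)
    if i == 0 then
      if j == 0 then 0 +i* (- x 0 2 / 2) else (- x 0 1 / 2) +i* (- x 0 0 / 2)
    else
      if j == 0 then (x 0 1 / 2) +i* (- x 0 0 / 2) else 0 +i* (x 0 2 / 2).

Definition su2_coord {R : realType} (X : 'M[R[i]]_2) : su2 R :=
  \row_(k < 3) nth 0 [:: - 2 * complex.Im (X 0 1);
                         - 2 * complex.Re (X 0 1);
                         - 2 * complex.Im (X 0 0)] k.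

(* The cross product: column indices are computed modulo 3. *)
Definition bracket {R : realType} (x y : su2 R) : su2 R :=
  \row_(k < 3) (x 0 (k + 1) * y 0 (k + 2) - x 0 (k + 2) * y 0 (k + 1)).

Definition inner {R : realType} (x y : su2 R) : R := \sum_(k < 3) x 0 k * y 0 k.

Definition su2_norm {R : realType} (x : su2 R) : R := Num.sqrt (inner x x).

Definition SU2 {R : realType} (g : 'M[R[i]]_2) : Prop :=
  g \is unitarymx /\ \det g = 1.

Definition Ad {R : realType} (g : 'M[R[i]]_2) (x : su2 R) : su2 R :=
  su2_coord (g *m su2_mx x *m invmx g).

Fact su2_mxK {R : realType} : cancel (@su2_mx R) su2_coord.
Proof.
move=> x; apply/rowP => k; rewrite !mxE /=.
have h (z : R) : - (1 + 1) * (- z / (1 + 1)) = z by field.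
by case: k => -[|[|[|//]]] i /=; rewrite h; congr (x 0 _); apply/val_inj.
Qed.

Fact su2_mxP {R : realType} (X : 'M[R[i]]_2) :
  (exists x, X = su2_mx x) <-> X ^t* = - X /\ \tr X = 0.
Proof.
split=> [[x ->]|[/matrixP herm]].
  split.
    apply/matrixP => i j; rewrite !mxE.
    case: i => -[|[|//]] i; case: j => -[|[|//]] j; rewrite /=;
      apply/eqP; rewrite eq_complex /=; apply/andP; split; apply/eqP; ring.
  rewrite /mxtrace !big_ord_recl big_ord0 !mxE /=.
  by apply/eqP; rewrite eq_complex /=; apply/andP; split; apply/eqP; ring.
rewrite /mxtrace !big_ord_recl big_ord0 addr0 => tr0.
exists (su2_coord X).
have := herm 0 0; have := herm 0 1.
rewrite !mxE.
have e1 : lift ord0 (ord0 : 'I_1) = 1 :> 'I_2 by apply/val_inj.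
have e0 : ord0 = 0 :> 'I_2 by apply/val_inj.
move: tr0; rewrite e1 e0.
case E00: (X 0 0) => [a b]; case E01: (X 0 1) => [c d].
case E10: (X 1 0) => [e f]; case E11: (X 1 1) => [k l].
move=> /eqP; rewrite eq_complex /= => /andP[/eqP h1 /eqP h2].
move=> /eqP; rewrite eq_complex /= => /andP[/eqP h3 /eqP h4].
move=> /eqP; rewrite eq_complex /= => /andP[/eqP h5 /eqP h6].
have -> : su2_coord X = \row_(m < 3) nth 0 [:: - 2 * d; - 2 * c; - 2 * b] m.
  by apply/rowP => m; rewrite !mxE E01 E00.
have XE (i j : 'I_2) : X i j = if i == 0 then (if j == 0 then a +i* b else c +i* d)
    else (if j == 0 then e +i* f else k +i* l).
  rewrite -E00 -E01 -E10 -E11.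
  by case: i => -[|[|//]] i; case: j => -[|[|//]] j /=; congr (X _ _);
    apply/val_inj.
apply/matrixP => i j; rewrite XE !mxE /=.
by case: (i == 0); case: (j == 0); apply/eqP; rewrite eq_complex /=;
  apply/andP; split; apply/eqP; lra.
Qed.

Fact su2_mx_linear {R : realType} (a : R) (x y : su2 R) :
  su2_mx (a *: x + y) = a%:C *: su2_mx x + su2_mx y.
Proof.
apply/matrixP => i j; rewrite !mxE.
by case: i => -[|[|//]] i; case: j => -[|[|//]] j; rewrite /=;
  apply/eqP; rewrite eq_complex /=; apply/andP; split; apply/eqP; field.
Qed.

Fact su2_mx_bracket {R : realType} (x y : su2 R) :
  su2_mx (bracket x y) = su2_mx x *m su2_mx y - su2_mx y *m su2_mx x.
Proof.
apply/matrixP => i j; rewrite !mxE !big_ord_recl !big_ord0 !mxE.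
have e1 : (1 : 'I_3) + 1 = 2 by apply/val_inj.
have e2 : (1 : 'I_3) + 2 = 0 by apply/val_inj.
have e3 : (2 : 'I_3) + 1 = 0 by apply/val_inj.
have e4 : (2 : 'I_3) + 2 = 1 by apply/val_inj.
rewrite e1 e2 e3 e4 !add0r.
by case: i => -[|[|//]] i; case: j => -[|[|//]] j; rewrite /=;
  apply/eqP; rewrite eq_complex /=; apply/andP; split; apply/eqP; field.
Qed.

Fact su2_mx_inner {R : realType} (x y : su2 R) :
  (inner x y)%:C = - 2 * \tr (su2_mx x *m su2_mx y).
Proof.
rewrite /inner /mxtrace !big_ord_recl !big_ord0 !mxE !big_ord_recl !big_ord0.
rewrite !mxE /=.
have -> : lift ord0 (ord0 : 'I_2) = 1 :> 'I_3 by apply/val_inj.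
have -> : lift ord0 (lift ord0 (ord0 : 'I_1)) = 2 :> 'I_3 by apply/val_inj.
have -> : ord0 = 0 :> 'I_3 by apply/val_inj.
have -> : (2 : R[i]) = 2%:C by rewrite rmorph_nat.
by apply/eqP; rewrite eq_complex /=; apply/andP; split; apply/eqP; field.
Qed.

Fact su2_mx_Ad {R : realType} (g : 'M[R[i]]_2) (x : su2 R) :
  SU2 g -> su2_mx (Ad g x) = g *m su2_mx x *m invmx g.
Proof.
move=> [gU _]; have gu : g \in unitmx by exact: unitarymx_unit.
rewrite /Ad; set X := su2_mx x; set Y := _ *m _ *m _.
have [y Yy] : exists y, Y = su2_mx y.
  have [hX tX] : X ^t* = - X /\ \tr X = 0 by apply/su2_mxP; exists x.
  apply/su2_mxP; split; last by rewrite /Y mxtrace_mulC mulmxA mulVmx// mul1mx.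
  rewrite /Y invmx_unitary// !trmx_mul !map_mxM/= trmxCK hX.
  by rewrite mulNmx mulmxN mulmxA.
by rewrite Yy su2_mxK.
Qed.

(* Elements of su(2)^n are n x 3 matrices, one row per component. *)
Definition tup {R : realType} {n : nat} (s : seq (su2 R)) : 'M[R]_(n, 3) :=
  \matrix_(i < n) nth 0 s i.
Arguments tup {R n} s%_SEQ.

(** * Smooth maps and hyperkähler structures *)

Fixpoint Ck {R : realType} {V W : normedModType R} (k : nat) (U : set V)
    (f : V -> W) : Prop :=
  match k with
  | 0 => forall x, U x -> {for x, continuous f}
  | k'.+1 => (forall x, U x -> differentiable f x) /\
             forall v, Ck k' U (fun x => 'd f x v)
  end.

Definition smooth_on {R : realType} {V W : normedModType R} (U : set V)
  (f : V -> W) : Prop := forall k, Ck k U f.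

(* A manifold with points in P and tangent vectors in E, together with a
   metric and three complex structures.  The smooth structure is recorded by
   telling which maps from an open subset of a normed space into the manifold
   are smooth; [velocity gamma b] says that the tangent vector at time 0 of
   the curve gamma is b. *)
Record hk_manifold (R : realType) (P : Type) (E : lmodType R) := HKManifold {
  carrier : set P;
  smooth_into : forall V : normedModType R, set V -> (V -> P) -> Prop;
  tangent : P -> set E;
  velocity : (R -> P) -> E -> Prop;
  metric : P -> E -> E -> R;
  cplx : 'I_3 -> P -> E -> E (* I, J, K *)
}.

Section Isomorphism.
Context {R : realType} {P P' : Type} {E E' : lmodType R}.
Context (X : hk_manifold P E) (Y : hk_manifold P' E').

Definition diffeomorphism (F : P -> P') : Prop :=
  set_bij (carrier X) (carrier Y) F /\
  forall (n : nat) (U : set 'rV[R]_n) (f : 'rV[R]_n -> P),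
    open U -> (forall x, U x -> carrier X (f x)) ->
    (smooth_into X U f <-> smooth_into Y U (F \o f)).

(* F_* b = u: F maps some smooth curve through p with velocity b to a curve
   with velocity u. *)
Definition pushes (F : P -> P') (p : P) (b : E) (u : E') : Prop :=
  exists (U : set R^o) (gamma : R -> P),
    [/\ open U, U 0, (forall s, U s -> carrier X (gamma s)) &
        smooth_into X U gamma] /\
    [/\ gamma 0 = p, velocity X gamma b & velocity Y (F \o gamma) u].

Definition hk_isomorphism (F : P -> P') : Prop :=
  diffeomorphism F /\
  exists dF : P -> E -> E',
    [/\ (forall p b, carrier X p -> tangent X p b -> pushes F p b (dF p b)),
        (forall p b c, carrier X p -> tangent X p b -> tangent X p c ->
           metric Y (F p) (dF p b) (dF p c) = metric X p b c) &
        exists O : 'M[R]_3, [/\ O^T *m O = 1%:M, \det O = 1 &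
          forall p b j, carrier X p -> tangent X p b ->
            cplx Y j (F p) (dF p b) =
            \sum_(i < 3) O i j *: dF p (cplx X i p b)]].

End Isomorphism.

(** * The leaves of the hyper-Lie Poisson structure *)

Section Leaf.
Context {R : realType}.
Implicit Types (a u v : 'M[R]_3).

Definition Phi a : R := inner (row 0 a) (bracket (row 1 a) (row 2 a)).

Definition leaf (q r : R) : set 'M[R]_3 := [set a |
  [/\ forall i j, i != j -> inner (row i a) (row j a) = 0,
      inner (row 0 a) (row 0 a) - inner (row 1 a) (row 1 a) = q,
      inner (row 1 a) (row 1 a) - inner (row 2 a) (row 2 a) = r &
      Phi a < 0]].

Definition frame a : 4.-tuple 'M[R]_3 :=
  let a1 := row 0 a in let a2 := row 1 a in let a3 := row 2 a in
  [tuple tup [:: bracket a2 a3; bracket a3 a1; bracket a1 a2];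
         tup [:: 0; bracket a2 a1; bracket a3 a1];
         tup [:: bracket a1 a2; 0; bracket a3 a2];
         tup [:: bracket a1 a3; bracket a2 a3; 0]].

Definition frame_image (k : 'I_3) a : seq 'M[R]_3 :=
  let V0 := tnth (frame a) 0 in let V1 := tnth (frame a) 1 in
  let V2 := tnth (frame a) 2 in let V3 := tnth (frame a) 3 in
  nth [::] [:: [:: V1; - V0; V3; - V2];
               [:: V2; - V3; - V0; V1];
               [:: V3; V2; - V1; - V0]] k.

(* coord (frame a) i u is the i-th coordinate of u in the frame. *)
Definition leaf_metric a u v : R :=
  \sum_(i < 4) \sum_(j < 4)
    coord (frame a) i u * coord (frame a) j v * (- (i == j)%:R * Phi a).

Definition leaf_cplx (k : 'I_3) a u : 'M[R]_3 :=
  \sum_(i < 4) coord (frame a) i u *: (frame_image k a)`_i.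

(* Submanifolds S of su(2)^3: a map into S is smooth if it is smooth as a map
   into su(2)^3, and tangent vectors are velocities of smooth curves. *)
Definition smooth_into_sub (S : set 'M[R]_3) (V : normedModType R)
    (U : set V) (f : V -> 'M[R]_3) : Prop :=
  (forall x, U x -> S (f x)) /\ smooth_on U f.

Definition velocity_sub (gamma : R -> 'M[R]_3) (u : 'M[R]_3) : Prop :=
  is_derive (0 : R^o) 1 (gamma : R^o -> 'M[R]_3) u.

Definition tangent_sub (S : set 'M[R]_3) (a : 'M[R]_3) : set 'M[R]_3 :=
  [set u | exists (U : set R^o) (gamma : R -> 'M[R]_3),
    [/\ open U, U 0, smooth_into_sub S U (gamma : R^o -> 'M[R]_3),
        gamma 0 = a & velocity_sub gamma u]].

Definition leaf_hk (q r : R) : hk_manifold 'M[R]_3 'M[R]_3 := {|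
  carrier := leaf q r;
  smooth_into := smooth_into_sub (leaf q r);
  tangent := tangent_sub (leaf q r);
  velocity := velocity_sub;
  metric := leaf_metric;
  cplx := leaf_cplx |}.

(* The tensors of N_{q,0} extend by continuity to the tangent bundle of its
   closure: their values there are limits along the tangent bundle of
   N_{q,0}. *)
Definition ext_leaf_metric (q : R) a u v : R :=
  lim (leaf_metric z.1.1 z.1.2 z.2 @[z -->
    within [set z : 'M[R]_3 * 'M[R]_3 * 'M[R]_3 |
              [/\ leaf q 0 z.1.1, tangent_sub (leaf q 0) z.1.1 z.1.2 &
                  tangent_sub (leaf q 0) z.1.1 z.2]]
           (nbhs (a, u, v))]).

Definition ext_leaf_cplx (q : R) (k : 'I_3) a u : 'M[R]_3 :=
  lim (leaf_cplx k z.1 z.2 @[z -->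
    within [set z : 'M[R]_3 * 'M[R]_3 |
              leaf q 0 z.1 /\ tangent_sub (leaf q 0) z.1 z.2]
           (nbhs (a, u))]).

Definition ext_leaf_hk (q : R) : hk_manifold 'M[R]_3 'M[R]_3 := {|
  carrier := closure (leaf q 0);
  smooth_into := smooth_into_sub (closure (leaf q 0));
  tangent := tangent_sub (closure (leaf q 0));
  velocity := velocity_sub;
  metric := ext_leaf_metric q;
  cplx := ext_leaf_cplx q |}.

End Leaf.

(** * Spaces of solutions of Nahm's equations *)

(* A function on (-oo, 0] is encoded as a function on R which is constant on
   [0, +oo), so that equality is equality on (-oo, 0]. *)
Section Nahm.
Context {R : realType}.

Definition on_half_line {T : Type} (f : R -> T) : Prop :=
  forall t, 0 <= t -> f t = f 0.

(* The derivative at t <= 0 of a function on (-oo, 0]; one-sided at 0. *)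
Definition half_derive {W : normedModType R} (f : R -> W) (t : R) (l : W) :
    Prop :=
  h^-1 *: (f (t + h) - f t) @[h --> within [set h | t + h <= 0] 0^'] --> l.

Definition nahm_solution (B : R -> 'M[R]_3) : Prop :=
  on_half_line B /\
  forall t, t <= 0 ->
    let B1 := row 0 (B t) in let B2 := row 1 (B t) in
    let B3 := row 2 (B t) in
    half_derive B t
      (tup [:: - bracket B2 B3; - bracket B3 B1; - bracket B1 B2]).

(* M(tau), for tau regular (its span is 1-dimensional) or tau = 0.  When
   tau = 0 the zero solution is excluded: the space of all solutions
   converging to 0 is a cone with vertex the zero solution, and only the
   complement of the vertex is a hyperkähler manifold. *)
Definition kronheimer_space (tau : 'M[R]_3) : set (R -> 'M[R]_3) := [set B |
  [/\ nahm_solution B,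
      exists g, SU2 g /\
        forall i : 'I_3, row i (B t) @[t --> -oo] --> Ad g (row i tau) &
      tau = 0 -> B <> (fun=> 0)]].

Definition linearized_nahm (B : R -> 'M[R]_3) (b db : R -> 'M[R]_(4, 3)) :
    Prop :=
  forall t, t <= 0 ->
    let B1 := row 0 (B t) in let B2 := row 1 (B t) in
    let B3 := row 2 (B t) in
    let b0 := row 0 (b t) in let b1 := row 1 (b t) in
    let b2 := row 2 (b t) in let b3 := row 3 (b t) in
    half_derive b t (db t) /\
    [/\ row 0 (db t) + bracket B1 b1 + bracket B2 b2 + bracket B3 b3 = 0,
        row 1 (db t) - bracket B1 b0 + bracket B2 b3 - bracket B3 b2 = 0,
        row 2 (db t) - bracket B1 b3 - bracket B2 b0 + bracket B3 b1 = 0 &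
        row 3 (db t) + bracket B1 b2 - bracket B2 b1 - bracket B3 b0 = 0].

(* The decay conditions: exponential weights for regular tau; for tau = 0,
   where solutions only decay like 1/t, the weights are powers of 1 + |t|. *)
Definition exp_decay (b db : R -> 'M[R]_(4, 3)) : Prop :=
  exists2 eta : R, 0 < eta & exists C : R, forall t (j : 'I_4), t <= 0 ->
    expR (eta * `|t|) * su2_norm (row j (b t)) <= C /\
    expR (eta * `|t|) * su2_norm (row j (db t)) <= C.

Definition pow_decay (b db : R -> 'M[R]_(4, 3)) : Prop :=
  exists2 eta : R, 0 < eta & exists C : R, forall t (j : 'I_4), t <= 0 ->
    (1 + `|t|) `^ (1 + eta) * su2_norm (row j (b t)) <= C /\
    (1 + `|t|) `^ (2 + eta) * su2_norm (row j (db t)) <= C.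

Definition kronheimer_tangent (tau : 'M[R]_3) (B : R -> 'M[R]_3) :
    set (R -> 'M[R]_(4, 3)) := [set b | on_half_line b /\
  exists2 db, linearized_nahm B b db &
    if tau == 0 then pow_decay b db else exp_decay b db].

(* The smooth structure of M(tau) is the one for which a family B_x of
   solutions is smooth when B_x(t) depends smoothly on x for every t. *)
Definition smooth_into_kronheimer (tau : 'M[R]_3) (V : normedModType R)
    (U : set V) (f : V -> R -> 'M[R]_3) : Prop :=
  (forall x, U x -> kronheimer_space tau (f x)) /\
  forall t, t <= 0 -> smooth_on U (fun x => f x t).

(* A solution b of the linearized equations is identified with the tangent
   vector that the differential of B |-> B(0) sends to
   (b_1(0), b_2(0), b_3(0)). *)
Definition kronheimer_velocity (gamma : R -> R -> 'M[R]_3)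
    (b : R -> 'M[R]_(4, 3)) : Prop :=
  is_derive (0 : R^o) 1 ((fun s => gamma s 0) : R^o -> 'M[R]_3)
    (tup [:: row 1 (b 0); row 2 (b 0); row 3 (b 0)]).

Definition kronheimer_metric (b c : R -> 'M[R]_(4, 3)) : R :=
  \sum_(j < 4) \int[lebesgue_measure]_(s in `]-oo, 0%R])
    inner (row j (b s)) (row j (c s)).

Definition kronheimer_cplx (k : 'I_3) (b : R -> 'M[R]_(4, 3)) :
    R -> 'M[R]_(4, 3) := fun t =>
  let b0 := row 0 (b t) in let b1 := row 1 (b t) in
  let b2 := row 2 (b t) in let b3 := row 3 (b t) in
  tup (nth [::] [:: [:: - b1; b0; - b3; b2];
                    [:: - b2; b3; b0; - b1];
                    [:: - b3; - b2; b1; b0]] k).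

Definition kronheimer_hk (tau : 'M[R]_3) :
    hk_manifold (R -> 'M[R]_3) (R -> 'M[R]_(4, 3)) := {|
  carrier := kronheimer_space tau;
  smooth_into := smooth_into_kronheimer tau;
  tangent := kronheimer_tangent tau;
  velocity := kronheimer_velocity;
  metric := fun=> kronheimer_metric;
  cplx := fun k _ => kronheimer_cplx k |}.

(* Nahm's equations preserve |B_2|^2 - |B_1|^2, whose limit at -oo is |tau_2|^2
   - |tau_1|^2.  Hence h_map sends M(0, q e, 0), with e a unit vector, to the
   closure of N_{q^2,0} when q > 0. *)
Definition h_map (B : R -> 'M[R]_3) : 'M[R]_3 :=
  tup [:: row 1 (B 0); row 2 (B 0); row 0 (B 0)].

End Nahm.

(* Main.v *)
Require Import Defs.
From mathcomp Require Import all_boot all_order all_algebra.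
From mathcomp Require Import spectral complex.
From mathcomp Require Import all_classical all_reals all_analysis.
From mathcomp Require Import measurable_realfun.
From mathcomp Require Import ring lra.

Set Implicit Arguments.
Unset Strict Implicit.
Unset Printing Implicit Defensive.

Import Order.TTheory GRing.Theory Num.Theory.
Import numFieldNormedType.Exports.

Local Open Scope classical_set_scope.
Local Open Scope ring_scope.

(** Write a = (a1, a2, a3) = (B2, B3, B1)(0) for the image of a solution B.

Bijectivity.  The Nahm equations preserve <B_i, B_j> for i <> j and the
differences of the |B_i|^2, and the limits at -oo fix these constants: the
B_i are orthogonal, |B1| = |B3| and |B2|^2 - |B1|^2 = q^2.  Moreover Phi(B)
is nonincreasing and tends to 0 at -oo, so Phi(B) <= 0.  Thus a lies in the set
[closed_leaf q] of the triples (A p0, f p1, f p2) with A > 0,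
A^2 = q^2 + f^2 and (p0, p1, p2) an orthonormal basis of negative
orientation; this set is the leaf N_{0,0} when q = 0 ([leaf0E]) and the closure
of N_{q^2,0} when q > 0 ([closure_leaf]).  Conversely, on such triples the
Nahm equations keep p0, p1, p2 fixed and reduce to f' = A f, A' = f^2, which
hyperbolic functions solve.  The resulting solution [nahm_flow q a] depends
smoothly on a, and it is the only element of the space with initial value a
([kronheimer_flow]), so it is a smooth inverse of the map B |-> a.

Tangent vectors.  Expanded in the basis p, the twelve linearized equations
split into four copies of one system of three equations, whose solutions
decaying at -oo form a line ([decaying_system]).  A tangent vector b at B is
therefore given by four constants x, and b is explicit: [linearized_solution]
and [qtuple].  With s = f(t) / f(0), or its limit when f(0) = 0, the integrand
of the metric is (2 A(t)^2 + f(t)^2) s^2 times the sum of the x_i y_i, and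
(2 A(t)^2 + f(t)^2) s^2 is the derivative of A(t) s^2; so the metric is A
times the sum of the x_i y_i ([kronheimer_metricE]).

Comparison.  Where f <> 0 the frame V_0, ..., V_3 is f times the coordinate
frame of x, up to order and a sign.  Since - Phi(a) = A f^2, the metric of the
leaf is also A times the sum of the x_i y_i.  The complex structures I, J, K
of the leaf act on the coordinates x as J~, K~, I~ do, so the matrix O is that
of a cyclic permutation.

The zero section f = 0 belongs to the closed leaf when q > 0, and the frame
V_i vanishes there.  The component b_0 of a tangent vector, which the
differential of B |-> a forgets, is a function of a and of (b1, b2, b3) which
is smooth as long as a1 <> 0 ([lift4]).  This gives formulas for the metric and
the complex structures ([lift_metric], [lift_cplx]) that are continuous up to
the zero section, and that must then be the values of the extended tensors.
Finally, each value of x is the velocity of a smooth curve in the closed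
leaf, obtained from an explicit retraction ([tangent_curve]). *)

(** * The vector algebra of su(2) and the closed leaf *)

Lemma addmxE (V : nmodType) m n (A B : 'M[V]_(m, n)) i j :
  (A + B) i j = A i j + B i j.
Proof. by rewrite mxE. Qed.
Lemma oppmxE (V : zmodType) m n (A : 'M[V]_(m, n)) i j : (- A) i j = - A i j.
Proof. by rewrite mxE. Qed.
Lemma scalemxE (T : pzRingType) m n (c : T) (A : 'M[T]_(m, n)) i j :
  (c *: A) i j = c * A i j.
Proof. by rewrite mxE. Qed.
Lemma zeromxE (V : nmodType) m n i j : (0 : 'M[V]_(m, n)) i j = 0.
Proof. by rewrite mxE. Qed.

Definition mxopE := (addmxE, oppmxE, scalemxE, zeromxE).

Section vector_algebra.
Context {R : realType}.
Implicit Types (x y z p : su2 R) (c : R).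

Let i01 : (0 : 'I_3) + 1 = 1. Proof. exact/val_inj. Qed.
Let i02 : (0 : 'I_3) + 2 = 2. Proof. exact/val_inj. Qed.
Let i11 : (1 : 'I_3) + 1 = 2. Proof. exact/val_inj. Qed.
Let i12 : (1 : 'I_3) + 2 = 0. Proof. exact/val_inj. Qed.
Let i21 : (2 : 'I_3) + 1 = 0. Proof. exact/val_inj. Qed.
Let i22 : (2 : 'I_3) + 2 = 1. Proof. exact/val_inj. Qed.

Lemma ord3P (P : 'I_3 -> Prop) : P 0 -> P 1 -> P 2 -> forall i, P i.
Proof.
move=> P0 P1 P2 [[|[|[|//]]] i]; [move: P0|move: P1|move: P2];
  by congr P; apply/val_inj.
Qed.

Lemma ord4P (P : 'I_4 -> Prop) : P 0 -> P 1 -> P 2 -> P 3 -> forall i, P i.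
Proof.
move=> P0 P1 P2 P3 [[|[|[|[|//]]]] i]; [move: P0|move: P1|move: P2|move: P3];
  by congr P; apply/val_inj.
Qed.

Lemma sum3E (V : nmodType) (F : 'I_3 -> V) : \sum_(k < 3) F k = F 0 + F 1 + F 2.
Proof.
rewrite !big_ord_recl big_ord0 addr0 addrA.
by congr (F _ + F _ + F _); apply/val_inj.
Qed.

Lemma sum4E (V : nmodType) (F : 'I_4 -> V) :
  \sum_(k < 4) F k = F 0 + F 1 + F 2 + F 3.
Proof.
rewrite !big_ord_recl big_ord0 addr0 !addrA.
by congr (F _ + F _ + F _ + F _); apply/val_inj.
Qed.

Lemma innerE x y : inner x y = x 0 0 * y 0 0 + x 0 1 * y 0 1 + x 0 2 * y 0 2.
Proof. by rewrite /inner sum3E. Qed.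

Lemma bracket0E x y : bracket x y 0 0 = x 0 1 * y 0 2 - x 0 2 * y 0 1.
Proof. by rewrite mxE i01 i02. Qed.
Lemma bracket1E x y : bracket x y 0 1 = x 0 2 * y 0 0 - x 0 0 * y 0 2.
Proof. by rewrite mxE i11 i12. Qed.
Lemma bracket2E x y : bracket x y 0 2 = x 0 0 * y 0 1 - x 0 1 * y 0 0.
Proof. by rewrite mxE i21 i22. Qed.

Definition coordE := (innerE, bracket0E, bracket1E, bracket2E).

Lemma su2P x y : x 0 0 = y 0 0 -> x 0 1 = y 0 1 -> x 0 2 = y 0 2 -> x = y.
Proof. by move=> h0 h1 h2; apply/rowP; exact: ord3P. Qed.

Lemma innerC x y : inner x y = inner y x. Proof. by rewrite !(mxopE, coordE); ring. Qed.
Lemma innerDl x y z : inner (x + y) z = inner x z + inner y z.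
Proof. by rewrite !(mxopE, coordE); ring. Qed.
Lemma innerDr x y z : inner z (x + y) = inner z x + inner z y.
Proof. by rewrite !(mxopE, coordE); ring. Qed.
Lemma innerZl c x y : inner (c *: x) y = c * inner x y.
Proof. by rewrite !(mxopE, coordE); ring. Qed.
Lemma innerZr c x y : inner x (c *: y) = c * inner x y.
Proof. by rewrite !(mxopE, coordE); ring. Qed.
Lemma innerNl x y : inner (- x) y = - inner x y.
Proof. by rewrite !(mxopE, coordE); ring. Qed.
Lemma innerNr x y : inner x (- y) = - inner x y.
Proof. by rewrite !(mxopE, coordE); ring. Qed.
Lemma inner0l x : inner 0 x = 0.
Proof. by rewrite !(mxopE, coordE); ring. Qed.
Lemma inner0r x : inner x 0 = 0.
Proof. by rewrite !(mxopE, coordE); ring. Qed.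

Lemma bracketC x y : bracket x y = - bracket y x.
Proof. by apply: su2P; rewrite !(mxopE, coordE); ring. Qed.
Lemma bracketDl x y z : bracket (x + y) z = bracket x z + bracket y z.
Proof. by apply: su2P; rewrite !(mxopE, coordE); ring. Qed.
Lemma bracketDr x y z : bracket z (x + y) = bracket z x + bracket z y.
Proof. by apply: su2P; rewrite !(mxopE, coordE); ring. Qed.
Lemma bracketZl c x y : bracket (c *: x) y = c *: bracket x y.
Proof. by apply: su2P; rewrite !(mxopE, coordE); ring. Qed.
Lemma bracketZr c x y : bracket x (c *: y) = c *: bracket x y.
Proof. by apply: su2P; rewrite !(mxopE, coordE); ring. Qed.
Lemma bracketNl x y : bracket (- x) y = - bracket x y.
Proof. by apply: su2P; rewrite !(mxopE, coordE); ring. Qed.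
Lemma bracketNr x y : bracket x (- y) = - bracket x y.
Proof. by apply: su2P; rewrite !(mxopE, coordE); ring. Qed.
Lemma bracketxx x : bracket x x = 0.
Proof. by apply: su2P; rewrite !(mxopE, coordE); ring. Qed.

Lemma inner_bracketC x y z : inner x (bracket y z) = inner y (bracket z x).
Proof. by rewrite !(mxopE, coordE); ring. Qed.


Lemma inner_bracketx x y : inner x (bracket x y) = 0.
Proof. by rewrite !(mxopE, coordE); ring. Qed.

Lemma inner_bracketx2 x y : inner y (bracket x y) = 0.
Proof. by rewrite !(mxopE, coordE); ring. Qed.

Lemma bracket_bracket x y z :
  bracket x (bracket y z) = inner x z *: y - inner x y *: z.
Proof. by apply: su2P; rewrite !(mxopE, coordE); ring. Qed.

Lemma inner_bracket x y z t : inner (bracket x y) (bracket z t) =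
  inner x z * inner y t - inner x t * inner y z.
Proof. by rewrite !(mxopE, coordE); ring. Qed.

(** The square of a triple product is the Gram determinant of its factors. *)
Lemma sqr_triple x y z : inner x (bracket y z) ^+ 2 =
  inner x x * inner y y * inner z z + 2 * inner x y * inner y z * inner x z -
  inner x x * inner y z ^+ 2 - inner y y * inner x z ^+ 2 -
  inner z z * inner x y ^+ 2.
Proof. by rewrite !(mxopE, coordE); ring. Qed.

Lemma inner_ge0 x : 0 <= inner x x.
Proof. by rewrite innerE -!expr2; rewrite !addr_ge0 ?sqr_ge0. Qed.

Lemma inner_eq0 x : inner x x = 0 -> x = 0.
Proof.
rewrite innerE -!expr2 => h; have := sqr_ge0 (x 0 0); have := sqr_ge0 (x 0 1).
have := sqr_ge0 (x 0 2) => h2 h1 h0.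
by apply: su2P; rewrite mxE; apply/eqP; rewrite -sqrf_eq0; apply/eqP; lra.
Qed.

Lemma inner_gt0 x : x != 0 -> 0 < inner x x.
Proof.
by move=> x0; rewrite lt0r inner_ge0 andbT; apply: contraNneq x0 => /inner_eq0 ->.
Qed.

Lemma inner_CS x y : inner x y ^+ 2 <= inner x x * inner y y.
Proof.
have := inner_ge0 (bracket x y); rewrite inner_bracket (innerC y x).
by rewrite subr_ge0 expr2.
Qed.

(** Controls the interaction term in the Gronwall estimate of [nahm_unique]: by
Cauchy-Schwarz and the arithmetic-geometric inequality. *)
Lemma triple_bound K x y z : 0 <= K -> inner z z <= K ^+ 2 ->
  2 * `|inner (bracket x y) z| <= K * (inner x x + inner y y).
Proof.
move=> K0 zK; have x0 := inner_ge0 x; have y0 := inner_ge0 y.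
rewrite -(@ler_pXn2r _ 2) ?nnegrE ?mulr_ge0 ?addr_ge0//.
rewrite !exprMn real_normK ?num_real//.
apply: (@le_trans _ _ (2 ^+ 2 * (inner x x * inner y y * K ^+ 2))).
  rewrite ler_pM2l ?exprn_gt0// (le_trans (inner_CS _ _))// ler_pM ?inner_ge0//.
  rewrite inner_bracket (innerC y x) -expr2.
  by have := sqr_ge0 (inner x y); lra.
rewrite [leRHS]mulrC mulrA ler_wpM2r ?exprn_ge0//.
by have := sqr_ge0 (inner x x - inner y y); nra.
Qed.

End vector_algebra.

Section antiframe.
Context {R : realType}.
Implicit Types (x y z p : su2 R) (c : R).

Lemma exists_orthonormal p : exists2 p1, inner p1 p1 = 1 & inner p p1 = 0.
Proof.
have [w w0 pw] : exists2 w : su2 R, w != 0 & inner p w = 0.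
  have [x0|x0] := eqVneq (p 0 0) 0.
    exists (\row_(k < 3) nth 0 [:: 1; 0; 0] k).
      apply/eqP => /rowP /(_ 0); rewrite !mxE /=.
      by move/eqP; rewrite oner_eq0.
    by rewrite coordE !mxE /= x0; ring.
  exists (\row_(k < 3) nth 0 [:: - p 0 1; p 0 0; 0] k).
    apply/eqP => /rowP /(_ 1); rewrite !mxE /=.
    by move/eqP: x0.
  by rewrite coordE !mxE /=; ring.
have w20 := inner_gt0 w0.
have r0 : 0 < Num.sqrt (inner w w) by rewrite sqrtr_gt0.
exists ((Num.sqrt (inner w w))^-1 *: w); last by rewrite innerZr pw mulr0.
rewrite innerZl innerZr -[X in _ * (_ * X)](sqr_sqrtr (ltW w20)).
by rewrite expr2; field; rewrite gt_eqF.
Qed.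

(** The sign is that of the leaves, on which Phi < 0: for orthogonal B1, B2, B3
with Phi(B) < 0, the directions of B2, B3, B1 form such a basis. *)
Record antiframe p0 p1 p2 : Prop := Antiframe {
  af00 : inner p0 p0 = 1; af11 : inner p1 p1 = 1; af22 : inner p2 p2 = 1;
  af01 : inner p0 p1 = 0; af12 : inner p1 p2 = 0; af20 : inner p2 p0 = 0;
  af_b01 : bracket p0 p1 = - p2; af_b12 : bracket p1 p2 = - p0;
  af_b20 : bracket p2 p0 = - p1 }.

Lemma antiframe_complete p0 p1 : inner p0 p0 = 1 -> inner p1 p1 = 1 ->
  inner p0 p1 = 0 -> antiframe p0 p1 (- bracket p0 p1).
Proof.
move=> h0 h1 h01; have h10 : inner p1 p0 = 0 by rewrite innerC.
split=> //.
- by rewrite innerNl innerNr opprK inner_bracket h0 h1 h01 h10; ring.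
- by rewrite innerNr inner_bracketx2 oppr0.
- by rewrite innerNl innerC inner_bracketx oppr0.
- by rewrite opprK.
- by rewrite bracketNr bracket_bracket h1 h10 scale1r scale0r subr0.
- by rewrite bracketNl bracketC opprK bracket_bracket h0 h01 scale1r scale0r sub0r.
Qed.


(** A rewriting rule that evaluates all inner products and brackets of basis
vectors. *)
Lemma antiframe_tables p0 p1 p2 : antiframe p0 p1 p2 ->
  ((inner p0 p0 = 1) * (inner p1 p1 = 1) * (inner p2 p2 = 1) *
  (inner p0 p1 = 0) * (inner p1 p2 = 0) * (inner p2 p0 = 0) *
  (inner p1 p0 = 0) * (inner p2 p1 = 0) * (inner p0 p2 = 0) *
  (bracket p0 p1 = - p2) * (bracket p1 p2 = - p0) * (bracket p2 p0 = - p1) *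
  (bracket p1 p0 = p2) * (bracket p2 p1 = p0) * (bracket p0 p2 = p1))%type.
Proof.
case=> h00 h11 h22 h01 h12 h20 b01 b12 b20.
by do !split; rewrite // ?[inner p1 p0]innerC ?[inner p2 p1]innerC
  ?[inner p0 p2]innerC // bracketC ?b01 ?b12 ?b20 opprK.
Qed.

(** Parseval's identity: the matrix P with rows p0, p1, p2 satisfies P P^T = 1,
hence P^T P = 1. *)
Lemma antiframe_inner p0 p1 p2 x y : antiframe p0 p1 p2 ->
  inner x y = inner x p0 * inner y p0 + inner x p1 * inner y p1 +
              inner x p2 * inner y p2.
Proof.
move=> F; pose P : 'M[R]_3 := \matrix_(i < 3) nth 0 [:: p0; p1; p2] i.
have PP : P *m P^T = 1%:M.
  apply/matrixP => i j; rewrite !mxE.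
  under eq_bigr do rewrite !mxE.
  rewrite (_ : \sum__ _ = inner (nth 0 [:: p0; p1; p2] i)
                                (nth 0 [:: p0; p1; p2] j)); last by [].
  elim/ord3P: i; elim/ord3P: j; by rewrite /= !(antiframe_tables F).
have /mulmx1C PP' := PP.
have e k z : (z *m P^T) 0 k = inner z (nth 0 [:: p0; p1; p2] k).
  by rewrite mxE; apply: eq_bigr => i _; rewrite !mxE.
transitivity ((x *m P^T *m (y *m P^T)^T) 0 0).
  rewrite trmx_mul trmxK mulmxA -(mulmxA x) PP' mulmx1 mxE.
  by apply: eq_bigr => i _; rewrite mxE.
have e' k : (y *m P^T)^T k 0 = inner y (nth 0 [:: p0; p1; p2] k).
  by rewrite mxE e.
by rewrite mxE sum3E !e !e'.
Qed.

Lemma antiframe_ext p0 p1 p2 x y : antiframe p0 p1 p2 ->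
  inner x p0 = inner y p0 -> inner x p1 = inner y p1 ->
  inner x p2 = inner y p2 -> x = y.
Proof.
move=> F h0 h1 h2; apply/eqP; rewrite -subr_eq0; apply/eqP/inner_eq0.
rewrite (antiframe_inner _ _ F) !innerDl !innerNl h0 h1 h2 !subrr.
by rewrite mulr0 !addr0.
Qed.

End antiframe.

Lemma row_tup {R : realType} n (s : seq (su2 R)) (i : 'I_n) :
  row i (tup s : 'M[R]_(n, 3)) = nth 0 s i.
Proof. by apply/rowP => k; rewrite !mxE. Qed.

Lemma tupE {R : realType} n (s : seq (su2 R)) (i : 'I_n) k :
  (tup s : 'M[R]_(n, 3)) i k = nth 0 s i 0 k.
Proof. by rewrite !mxE. Qed.

Lemma mx3P {R : realType} (a b : 'M[R]_3) : row 0 a = row 0 b ->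
  row 1 a = row 1 b -> row 2 a = row 2 b -> a = b.
Proof. by move=> h0 h1 h2; apply/row_matrixP; exact: ord3P. Qed.

Lemma rowDE {R : realType} n (a b : 'M[R]_(n, 3)) i : row i (a + b) = row i a + row i b.
Proof. exact: linearD. Qed.
Lemma rowNE {R : realType} n (a : 'M[R]_(n, 3)) i : row i (- a) = - row i a.
Proof. exact: linearN. Qed.
Lemma rowZE {R : realType} n (a : 'M[R]_(n, 3)) c i : row i (c *: a) = c *: row i a.
Proof. exact: linearZ. Qed.


Section closed_leaf.
Context {R : realType}.
Implicit Types (a : 'M[R]_3) (q : R).

Definition leaf_point (A f : R) (p0 p1 p2 : su2 R) : 'M[R]_3 :=
  tup [:: A *: p0; f *: p1; f *: p2].

(** The sign of f is free: (f, p1, p2) and (-f, -p1, -p2) give the same point.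
No case distinction between points on and off the zero section is needed. *)
Definition closed_leaf q : set 'M[R]_3 := [set a | exists A f p0 p1 p2,
  [/\ antiframe p0 p1 p2, 0 < A, A ^+ 2 = q ^+ 2 + f ^+ 2 &
      a = leaf_point A f p0 p1 p2]].

Lemma Phi_leaf_point A f p0 p1 p2 : antiframe p0 p1 p2 ->
  Phi (leaf_point A f p0 p1 p2) = - (A * f ^+ 2).
Proof.
move=> F; rewrite /Phi !row_tup /= !(bracketZl, bracketZr, innerZl, innerZr).
by rewrite !(antiframe_tables F) innerNr !(antiframe_tables F); ring.
Qed.

(** The equations of the leaf, together with Phi <= 0, force
a3 = - [a1, a2] / |a1|; this determines p2 once p0 and p1 are chosen along a1
and a2 (p1 is any unit vector orthogonal to p0 when a2 = 0). *)
Lemma closed_leafP q a : closed_leaf q a <->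
  [/\ forall i j, i != j -> inner (row i a) (row j a) = 0,
     inner (row 0 a) (row 0 a) - inner (row 1 a) (row 1 a) = q ^+ 2,
     inner (row 1 a) (row 1 a) - inner (row 2 a) (row 2 a) = 0,
     Phi a <= 0 & row 0 a != 0].
Proof.
split.
  move=> [A [f [p0 [p1 [p2 [F A0 Aq ->]]]]]].
  rewrite (Phi_leaf_point _ _ F) !row_tup /=.
  rewrite !(innerZl, innerZr) !(antiframe_tables F) !mulr1 -!expr2; split.
  - elim/ord3P; elim/ord3P => //= _;
      rewrite !row_tup /= !(innerZl, innerZr) !(antiframe_tables F); ring.
  - by rewrite Aq; ring.
  - by rewrite subrr.
  - by rewrite oppr_le0 mulr_ge0 ?sqr_ge0// ltW.
  - apply/negP => /eqP h; have := congr1 (inner p0) h.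
    by rewrite inner0r innerZr (antiframe_tables F); nra.
move=> [orth]; rewrite /Phi.
move: (orth 0 1 isT) (orth 0 2 isT) (orth 1 2 isT).
set a1 := row 0 a; set a2 := row 1 a; set a3 := row 2 a.
move=> o12 o13 o23 n12 n23 Ph a10.
have A20 : 0 < inner a1 a1 by exact: inner_gt0.
pose A := Num.sqrt (inner a1 a1); pose f := Num.sqrt (inner a2 a2).
have A0 : 0 < A by rewrite sqrtr_gt0.
have A2 : A ^+ 2 = inner a1 a1 by rewrite sqr_sqrtr// ltW.
have f2 : f ^+ 2 = inner a2 a2 by rewrite sqr_sqrtr// inner_ge0.
have f0 : 0 <= f by exact: sqrtr_ge0.
have An0 : A != 0 by rewrite gt_eqF.
have [p0 p00 a1E] : exists2 p0, inner p0 p0 = 1 & a1 = A *: p0.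
  exists (A^-1 *: a1); first by rewrite innerZl innerZr -A2; field.
  by rewrite scalerA divff// scale1r.
have p0a2 : inner p0 a2 = 0.
  by apply: (mulfI An0); rewrite -innerZl -a1E o12 mulr0.
have [p1 [p11 p01 a2E]] : exists p1, [/\ inner p1 p1 = 1, inner p0 p1 = 0 &
    a2 = f *: p1].
  have [fe0|fn0] := eqVneq f 0.
    have -> : a2 = 0 by apply: inner_eq0; rewrite -f2 fe0 expr0n.
    have [p1 p11 p01] := exists_orthonormal p0.
    by exists p1; split=> //; rewrite fe0 scale0r.
  exists (f^-1 *: a2); split.
  + by rewrite innerZl innerZr -f2; field.
  + by rewrite innerZr p0a2 mulr0.
  + by rewrite scalerA divff// scale1r.
have F := antiframe_complete p00 p11 p01.
exists A, f, p0, p1, (- bracket p0 p1); split => //.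
  by rewrite A2 f2; lra.
have f3 : inner a3 a3 = f ^+ 2 by rewrite f2; lra.
have Af0 : 0 <= A * f ^+ 2 by rewrite mulr_ge0 ?sqr_ge0// ltW.
have AP : inner a1 (bracket a2 a3) = - (A * f ^+ 2).
  have : inner a1 (bracket a2 a3) ^+ 2 == (A * f ^+ 2) ^+ 2.
    by rewrite sqr_triple o12 o13 o23 f3 -A2 -f2; apply/eqP; ring.
  rewrite eqf_sqr => /orP[/eqP h|/eqP//].
  by move: Ph; rewrite h => ?; lra.
(* The square norm of A a3 + [a1, a2] is 2 A (A f^2 + Phi a) = 0. *)
have a3E : A *: a3 + bracket a1 a2 = 0.
  apply: inner_eq0; rewrite !(innerDl, innerDr, innerZl, innerZr).
  rewrite inner_bracket o12 (innerC a2 a1) o12 (innerC (bracket a1 a2)).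
  by rewrite (inner_bracketC a3) AP f3 -A2 -f2; ring.
rewrite -[LHS]/a; apply: mx3P; rewrite row_tup //=.
apply: (scalerI An0); rewrite !scalerN -bracketZr -a2E -bracketZl -a1E -[RHS]add0r -a3E.
by rewrite addrK.
Qed.
End closed_leaf.

(** * Calculus of C^k maps *)

Section Ck.
Context {R : realType}.

(** The differential at x only depends on the germ of the map at x. *)
Lemma near_eq_is_diff (V W : normedModType R) (f g df : V -> W) x :
  (\near x, f x = g x) -> is_diff x f df -> is_diff x g df.
Proof.
move=> fg [dfx dfE]; have fgx : f x = g x by exact: nbhs_singleton fg.
have [dfc /eqaddoP h] := (diff_locallyP x f).1 dfx.
have dg : g \o shift x = cst (g x) + 'd f x +o_ 0 id.
  apply/eqaddoP => e e0; have {}h := h e e0.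
  move: fg; rewrite (near_shift 0) subr0 => fg.
  near=> y; have fgy : f (y + x) = g (y + x) by near: y; exact: fg.
  have : `|(f \o shift x - (cst (f x) + 'd f x)) y| <= e * `|y| by near: y; exact: h.
  by rewrite !fctE /= fgy fgx.
have dgE : 'd g x = 'd f x :> (V -> W) by exact: diff_unique.
by split; [apply/diff_locallyP; rewrite dgE|rewrite dgE].
Unshelve. all: by end_near. Qed.

Lemma Ck_ext (V W : normedModType R) (U : set V) (f g : V -> W) k :
  open U -> (forall x, U x -> f x = g x) -> Ck k U f -> Ck k U g.
Proof.
move=> oU; have near_fg f' g' x : (forall x, U x -> f' x = g' x :> W) -> U x ->
    \near x, f' x = g' x.
  by move=> fg Ux; near=> y; apply: fg; near: y; exact: open_nbhs_nbhs.
elim: k f g => [|k IH] f g fg /=.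
  move=> cf x Ux; have {}cf : f y @[y --> x] --> f x by exact: cf.
  change (g y @[y --> x] --> g x); rewrite -(fg x Ux); move: cf.
  by apply: cvg_trans; apply: near_eq_cvg; exact: near_fg.
case=> df Cf; have dg x : U x -> is_diff x g ('d f x).
  move=> Ux; apply: (near_eq_is_diff (near_fg f g x fg Ux)).
  exact/differentiableP/df.
split=> [x /dg []//|v]; apply: (IH _ _ _ (Cf v)) => x Ux.
by have [_ ->] := dg x Ux.
Unshelve. all: by end_near. Qed.

(** Reduces C^k.+1 to a formula for the differential, valid on U only. *)
Lemma CkS (V W : normedModType R) (U : set V) (f : V -> W)
    (df : V -> V -> W) k : open U ->
  (forall x, U x -> is_diff x f (df x)) ->
  (forall v, Ck k U (fun x => df x v)) -> Ck k.+1 U f.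
Proof.
move=> oU fdf Cdf; split=> [x /fdf[]//|v].
by apply: (Ck_ext oU _ (Cdf v)) => x /fdf[_ ->].
Qed.

Lemma CkW (V W : normedModType R) (U : set V) (f : V -> W) k :
  Ck k.+1 U f -> Ck k U f.
Proof.
elim: k f => [|k IH] f [df Cdf].
  by move=> x /df; exact: differentiable_continuous.
by split=> // v; apply: IH; exact: Cdf.
Qed.

Lemma Ck_cst (V W : normedModType R) (U : set V) (c : W) k :
  open U -> Ck k U (fun=> c).
Proof.
move=> oU; elim: k c => [|k IH] c; first by move=> x _; exact: cvg_cst.
by apply: (CkS (df := fun _ _ => 0)).
Qed.

Lemma Ck_id (V : normedModType R) (U : set V) k : open U -> Ck k U (@id V).
Proof.
move=> oU; case: k => [|k]; first by move=> x _; exact: cvg_id.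
by apply: (CkS (df := fun _ v => v)) => // v; exact: Ck_cst.
Qed.

Lemma Ck_linear (V W W' : normedModType R) (U : set V) (L : {linear W -> W'})
    (f : V -> W) k :
  open U -> continuous L -> Ck k U f -> Ck k U (fun x => L (f x)).
Proof.
move=> oU cL; elim: k f => [|k IH] f.
  by move=> cf x Ux; apply: (@continuous_comp _ _ _ f L); [exact: cf|exact: cL].
case=> df Cf; apply: (CkS (df := fun x v => L ('d f x v))) => // [x Ux|v].
  have := df x Ux => /differentiableP dfx.
  have dL : is_diff (f x) L L.
    by split; [exact: linear_differentiable|exact: diff_lin].
  exact: is_diff_comp.
exact: (IH _ (Cf v)).
Qed.

Lemma Ck_add (V W : normedModType R) (U : set V) (f g : V -> W) k :
  open U -> Ck k U f -> Ck k U g -> Ck k U (fun x => f x + g x).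
Proof.
move=> oU; elim: k f g => [|k IH] f g.
  by move=> cf cg x Ux; apply: cvgD; [exact: cf|exact: cg].
move=> [df Cf] [dg Cg].
apply: (CkS (df := fun x v => 'd f x v + 'd g x v)) => // [x Ux|v].
  have /differentiableP dfx := df x Ux; have /differentiableP dgx := dg x Ux.
  exact: is_diffD.
exact: (IH _ _ (Cf v) (Cg v)).
Qed.

Lemma Ck_mul (V : normedModType R) (U : set V) (f g : V -> R^o) k :
  open U -> Ck k U f -> Ck k U g -> Ck k U (fun x => f x * g x : R^o).
Proof.
move=> oU; elim: k f g => [|k IH] f g.
  by move=> cf cg x Ux; apply: cvgM; [exact: cf|exact: cg].
move=> Ckf Ckg; have [df Cf] := Ckf; have [dg Cg] := Ckg.
apply: (CkS (df := fun x v => f x * 'd g x v + g x * 'd f x v : R^o)) => // [x Ux|v].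
  have /differentiableP dfx := df x Ux; have /differentiableP dgx := dg x Ux.
  exact: is_diffM.
by apply: Ck_add => //; [apply: IH (CkW Ckf) (Cg v)|apply: IH (CkW Ckg) (Cf v)].
Qed.

Lemma Ck_opp (V : normedModType R) (U : set V) (f : V -> R^o) k :
  open U -> Ck k U f -> Ck k U (fun x => - f x : R^o).
Proof.
move=> oU Cf; apply: (Ck_ext (f := fun x => (-1 : R^o) * f x : R^o)) => //.
  by move=> x _; rewrite mulN1r.
by apply: Ck_mul => //; exact: Ck_cst.
Qed.

(** By induction on k: the differential of 1/f is - f^-2 df, and f^-1 is C^k by
the induction hypothesis. *)
Lemma Ck_inv (V : normedModType R) (U : set V) (f : V -> R^o) k :
  open U -> (forall x, U x -> f x != 0) -> Ck k U f ->
  Ck k U (fun x => (f x)^-1 : R^o).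
Proof.
move=> oU f0; elim: k => [|k IH].
  by move=> cf x Ux; apply: cvgV; [exact: f0|exact: cf].
move=> Ckf; have [df Cf] := Ckf; have Ci := IH (CkW Ckf).
apply: (CkS (df := fun x v => - ((f x)^-1 * (f x)^-1) * 'd f x v : R^o)) => // [x Ux|v].
  split; first exact: differentiableV (df x Ux) (f0 x Ux).
  rewrite (diffV (df x Ux) (f0 x Ux)); apply/funext => v /=.
  by rewrite -invfM -expr2.
apply: Ck_mul (Cf v) => //; apply: Ck_opp => //; exact: Ck_mul.
Qed.

(** By induction on k, as for the inverse: the differential of the square root of
f is df divided by twice this square root. *)
Lemma Ck_sqrt (V : normedModType R) (U : set V) (f : V -> R^o) k :
  open U -> (forall x, U x -> 0 < f x) -> Ck k U f ->
  Ck k U (fun x => Num.sqrt (f x) : R^o).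
Proof.
move=> oU f0; elim: k => [|k IH].
  move=> cf x Ux; apply: (@continuous_comp _ _ _ f (@Num.sqrt R)).
    exact: cf.
  exact: sqrt_continuous.
move=> Ckf; have [df Cf] := Ckf; have Ci := IH (CkW Ckf).
apply: (CkS (df := fun x v => 'd f x v * (2 * Num.sqrt (f x))^-1 : R^o)) => // [x Ux|v].
  have /differentiableP dfx := df x Ux.
  have [/derivable1_diffP ds Ds] := is_derive1_sqrt (f0 x Ux).
  have dsx : is_diff (f x) (Num.sqrt : R^o -> R^o)
      (fun h => h * (2 * Num.sqrt (f x))^-1 : R^o).
    split=> //; rewrite deriv1E ?derive1E ?Ds //.
    by apply/derivable1_diffP.
  exact: is_diff_comp.
apply: Ck_mul (Cf v) _ => //; apply: Ck_inv => //.
  by move=> x Ux; rewrite gt_eqF// mulr_gt0// sqrtr_gt0 f0.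
by apply: Ck_mul => //; exact: Ck_cst.
Qed.

Lemma Ck_entry (V : normedModType R) (U : set V) m n (f : V -> 'M[R]_(m, n)) i j k :
  open U -> Ck k U f -> Ck k U (fun x => f x i j : R^o).
Proof.
move=> oU Cf.
have @L : {linear 'M[R]_(m, n) -> R^o}.
  by exists (fun N : 'M[R]_(_, _) => N i j); do 2![eexists]; do ?[constructor];
     rewrite ?mxE// => ? *; rewrite ?mxE//; move=> ?; rewrite !mxE.
apply: (Ck_linear (L := L)) => //; exact: coord_continuous.
Qed.

Lemma Ck_sum (V W : normedModType R) (U : set V) (I : Type) (s : seq I)
    (F : I -> V -> W) k :
  open U -> (forall i, Ck k U (F i)) -> Ck k U (fun x => \sum_(i <- s) F i x).
Proof.
move=> oU CF; elim: s => [|i s IH].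
  by apply: (Ck_ext oU _ (Ck_cst 0 k oU)) => x _; rewrite big_nil.
by apply: (Ck_ext oU _ (Ck_add oU (CF i) IH)) => x _; rewrite big_cons.
Qed.

(** A matrix is the sum of its entries times the elementary matrices, so that
the smoothness of a matrix-valued map is a question about its entries. *)
Lemma Ck_mx (V : normedModType R) (U : set V) m n (f : V -> 'M[R]_(m, n)) k :
  open U -> (forall i j, Ck k U (fun x => f x i j : R^o)) -> Ck k U f.
Proof.
move=> oU Cf.
have L i j : {L : {linear R^o -> 'M[R]_(m, n)} | forall c, L c = c *: delta_mx i j}.
  have @L : {linear R^o -> 'M[R]_(m, n)}.
    exists (fun c : R^o => c *: delta_mx i j); do 2![eexists]; do ?[constructor].
    - by rewrite scale0r.
    - by move=> c d; rewrite scalerDl.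
    - by move=> c d; rewrite -scalerA.
  by exists L.
apply: (Ck_ext (f := fun x => \sum_i \sum_j f x i j *: delta_mx i j)) => //.
  by move=> x _; rewrite -matrix_sum_delta.
apply: Ck_sum => // i; apply: Ck_sum => // j.
have [l lE] := L i j.
apply: (Ck_ext (f := fun x => l (f x i j))) => //.
apply: Ck_linear => //; have -> : (l : R^o -> _) = *:%R^~ (delta_mx i j).
  exact/funext/lE.
exact: scalel_continuous.
Qed.

End Ck.

(** * Derivatives on the half-line *)

Section half_derive.
Context {R : realType}.

Lemma cvg_mxP (T : Type) (F : set_system T) (FF : Filter F) m n
    (f : T -> 'M[R]_(m, n)) (M : 'M[R]_(m, n)) :
  f x @[x --> F] --> M <-> forall i j, f x i j @[x --> F] --> M i j.
Proof.
split=> [fM i j|fM].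
  apply: (cvg_comp (G := nbhs M) f (fun N : 'M[R]_(m, n) => N i j)) => //.
  exact: coord_continuous.
apply/cvgrPdist_le => /= e e0; near=> x.
rewrite /Num.Def.normr/= mx_normrE (bigmax_le _ (ltW e0))//= => i _.
rewrite !mxE/=; move: i; near: x; apply: filter_forall => /= i.
by have /cvgrPdist_le/(_ _ e0) := fM i.1 i.2.
Unshelve. all: by end_near. Qed.

(** Scalar case of [half_derive]; it is one-sided at 0. *)
Definition has_deriv (f : R -> R) (t l : R) : Prop := half_derive (f : R -> R^o) t l.

Lemma half_derive_mxP m n (f : R -> 'M[R]_(m, n)) t l :
  half_derive f t l <-> forall i j, has_deriv (fun s => f s i j) t (l i j).
Proof.
rewrite /has_deriv /half_derive; split => [/cvg_mxP h i j|h].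
  by have := h i j; under eq_fun do rewrite !mxE.
by apply/cvg_mxP => i j; under eq_fun do rewrite !mxE; exact: h.
Qed.

(** The difference quotient may be replaced by any function equal to it for
increments h <> 0 that stay in the half-line. *)
Lemma has_deriv_quotient f t l (d : R -> R) :
  (forall h, h != 0 -> t + h <= 0 -> d h = h^-1 * (f (t + h) - f t)) ->
  d h @[h --> within [set h | t + h <= 0] 0^'] --> l -> has_deriv f t l.
Proof.
move=> dE; apply: cvg_trans; apply: near_eq_cvg.
rewrite near_withinE; near=> h => /= th; rewrite dE//.
by near: h; exact: nbhs_dnbhs_neq.
Unshelve. all: by end_near. Qed.

Lemma has_deriv_continuous f t l : has_deriv f t l ->
  f (t + h) @[h --> within [set h | t + h <= 0] 0^'] --> f t.
Proof.
move=> fl; have id0 : (fun h : R => h) @ within [set h | t + h <= 0] 0^' --> (0 : R).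
  apply: (cvg_trans (G := 0^')); first exact: cvg_within.
  exact: cvg_within.
have : f t + h * (h^-1 *: (f (t + h) - f t : R^o))
    @[h --> within [set h | t + h <= 0] 0^'] --> f t + 0 * l.
  by apply: cvgD; [exact: cvg_cst|exact: cvgM].
rewrite mul0r addr0; apply: cvg_trans; apply: near_eq_cvg.
rewrite near_withinE; near=> h => _ /=.
have h0 : h != 0 by near: h; exact: nbhs_dnbhs_neq.
by rewrite /GRing.scale /= mulVKf// subrKC.
Unshelve. all: by end_near. Qed.

Lemma has_deriv_cst c t : has_deriv (fun=> c) t 0.
Proof.
rewrite /has_deriv /half_derive; under eq_fun do rewrite subrr scaler0.
exact: cvg_cst.
Qed.

Lemma has_derivD f g t df dg : has_deriv f t df -> has_deriv g t dg ->
  has_deriv (fun s => f s + g s) t (df + dg).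
Proof.
move=> hf hg; apply: has_deriv_quotient (cvgD hf hg) => h _ _.
by rewrite /GRing.scale /=; ring.
Qed.

Lemma has_derivM f g t df dg : has_deriv f t df -> has_deriv g t dg ->
  has_deriv (fun s => f s * g s) t (df * g t + f t * dg).
Proof.
move=> hf hg.
apply: has_deriv_quotient (cvgD (cvgM hf (has_deriv_continuous hg)) (cvgM (cvg_cst (f t)) hg)).
by move=> h _ _; rewrite /GRing.scale /=; ring.
Qed.

Lemma has_deriv_ext f g t l : (forall s, s <= 0 -> f s = g s) -> t <= 0 ->
  has_deriv f t l -> has_deriv g t l.
Proof.
by move=> fg t0; apply: has_deriv_quotient => h _ th; rewrite -!fg.
Qed.

Lemma has_deriv_eq f t l l' : has_deriv f t l -> l = l' -> has_deriv f t l'.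
Proof. by move=> h <-. Qed.

Lemma has_deriv_congr f g t l l' : f =1 g -> l = l' -> has_deriv f t l -> has_deriv g t l'.
Proof. by move=> /funext -> ->. Qed.

Lemma has_derivZ f t df c : has_deriv f t df -> has_deriv (fun s => c * f s) t (c * df).
Proof.
by move=> hf; apply: has_deriv_eq (has_derivM (has_deriv_cst c t) hf) _; rewrite mul0r add0r.
Qed.

Lemma has_derivN f t df : has_deriv f t df -> has_deriv (fun s => - f s) t (- df).
Proof.
move=> hf; have := has_derivZ (c := -1) hf; rewrite mulN1r.
by congr (has_deriv _ _ _); apply/funext => s; rewrite mulN1r.
Qed.

Lemma has_derivV f t df : (forall s, s <= 0 -> f s != 0) -> t <= 0 -> has_deriv f t df ->
  has_deriv (fun s => (f s)^-1) t (- (df / (f t) ^+ 2)).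
Proof.
move=> f0 t0 hf; have fV : (f (t + h))^-1 @[h --> within [set h | t + h <= 0] 0^'] --> (f t)^-1.
  by apply: cvgV (f0 t t0) _; exact: has_deriv_continuous hf.
have h : - (h^-1 *: (f (t + h) - f t : R^o) * ((f (t + h))^-1 * (f t)^-1))
    @[h --> within [set h | t + h <= 0] 0^'] --> - (df * ((f t)^-1 * (f t)^-1)).
  by apply: cvgN; apply: cvgM => //; apply: cvgM => //; exact: cvg_cst.
rewrite expr2 invfM; apply: has_deriv_quotient h => h h0 th.
by rewrite /GRing.scale /=; field; rewrite h0 !f0.
Qed.

Lemma is_derive_has_deriv f t l : is_derive t (1 : R^o) (f : R^o -> R^o) l -> has_deriv f t l.
Proof.
move=> [fd <-].
apply: (@has_deriv_quotient _ _ _ (fun h => h^-1 *: (f (h *: (1 : R^o) + t) - f t : R^o))).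
  by move=> h _ _; rewrite /GRing.scale /= mulr1 (addrC h).
exact: cvg_within_filter fd.
Qed.

(** Inside the half-line the constraint on the increment is void near 0. *)
Lemma has_deriv_is_derive f t l : t < 0 -> has_deriv f t l ->
  is_derive t (1 : R^o) (f : R^o -> R^o) l.
Proof.
move=> t0 hf.
have fl : (h^-1 *: (f (h *: (1 : R^o) + t) - f t) : R^o) @[h --> 0^'] --> l.
  move=> P /hf hP.
  have {}hP : \forall h \near 0^', t + h <= 0 -> P (h^-1 *: (f (t + h) - f t : R^o)) by exact: hP.
  suff : \forall h \near 0^', P (h^-1 *: (f (h *: (1 : R^o) + t) - f t : R^o)) by [].
  near=> h; rewrite [h *: (1 : R^o)]mulr1 (addrC h).
  have th : t + h <= 0.
    have hle : `|h| <= - t by near: h; apply: dnbhs0_le; rewrite oppr_gt0.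
    by have := ler_norm h; lra.
  by move: th; near: h.
by split; [apply/cvg_ex; exists l|exact: cvg_lim].
Unshelve. all: by end_near. Qed.

Lemma has_deriv_within_continuous f df : (forall t, t <= 0 -> has_deriv f t (df t)) ->
  {within `]-oo, 0], continuous f}.
Proof.
move=> hf; apply/subspace_continuousP => t /=; rewrite in_itv /= => t0.
have /cvgrPdist_lt fc := has_deriv_continuous (hf t t0).
apply/cvgrPdist_lt => e e0.
have h : \forall x \near (0 : R)^', t + x <= 0 -> `|f t - f (t + x)| < e := fc e e0.
suff : \forall x \near (0 : R), t + x <= 0 -> `|f t - f (t + x)| < e.
  move=> /((@nbhs0P R R^o (fun y : R => y <= 0 -> `|f t - f y| < e) t).2) k.
  by rewrite near_withinE; apply: filterS k => y /=; rewrite in_itv.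
near=> x => tx.
have [->|x0] := eqVneq x 0; first by rewrite addr0 subrr normr0.
by move: x0 tx; near: x; exact: h.
Unshelve. all: by end_near. Qed.

(** The mean value theorem only needs the derivative in the open half-line and
continuity, one-sided at 0, on the closed one. *)
Lemma has_deriv_nondecreasing f df : (forall t, t <= 0 -> has_deriv f t (df t)) ->
  (forall t, t <= 0 -> 0 <= df t) -> forall s t, s <= t -> t <= 0 -> f s <= f t.
Proof.
move=> hf df0; apply: ger0_derive1_ndecrNy.
- by move=> x; rewrite in_itv /= => x0; have [] := has_deriv_is_derive x0 (hf x (ltW x0)).
- move=> x; rewrite in_itv /= => x0; rewrite derive1E.
  by have [_ ->] := has_deriv_is_derive x0 (hf x (ltW x0)); exact/df0/ltW.
- exact: has_deriv_within_continuous hf.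
Qed.

Lemma has_deriv_constant f : (forall t, t <= 0 -> has_deriv f t 0) ->
  forall t, t <= 0 -> f t = f 0.
Proof.
move=> hf t t0; apply/le_anti/andP; split.
  exact: (@has_deriv_nondecreasing f (fun=> 0)).
rewrite -lerN2; apply: (@has_deriv_nondecreasing (fun s => - f s) (fun=> 0)) => //.
by move=> s s0; rewrite -oppr0; exact/has_derivN/hf.
Qed.

End half_derive.

(** * Conservation laws and uniqueness for the Nahm equations *)

Section nahm_calculus.
Context {R : realType}.
Implicit Types (f g : R -> su2 R).

Lemma half_derive_row n (F : R -> 'M[R]_(n, 3)) t dF i : half_derive F t dF ->
  half_derive (fun s => row i (F s)) t (row i dF).
Proof.
move=> /half_derive_mxP h; apply/half_derive_mxP => k j.
by apply: has_deriv_congr (h i j) => [s|]; rewrite mxE.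
Qed.

Lemma has_deriv_inner f g t df dg : half_derive f t df -> half_derive g t dg ->
  has_deriv (fun s => inner (f s) (g s)) t (inner df (g t) + inner (f t) dg).
Proof.
move=> /half_derive_mxP hf /half_derive_mxP hg.
have h i := has_derivM (hf 0 i) (hg 0 i).
apply: has_deriv_congr (has_derivD (has_derivD (h 0) (h 1)) (h 2)) => [s|]; first by rewrite innerE.
by rewrite !innerE; ring.
Qed.

Lemma half_derive_bracket f g t df dg : half_derive f t df -> half_derive g t dg ->
  half_derive (fun s => bracket (f s) (g s)) t
    (bracket df (g t) + bracket (f t) dg).
Proof.
move=> /half_derive_mxP hf /half_derive_mxP hg.
apply/half_derive_mxP => i; rewrite ord1 => k; have h := has_derivD (has_derivM (hf 0 (k + 1)) (hg 0 (k + 2)))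
              (has_derivN (has_derivM (hf 0 (k + 2)) (hg 0 (k + 1)))).
by apply: has_deriv_congr h => [s|]; rewrite ?addmxE !mxE //; ring.
Qed.

Lemma half_derive_cst (x : su2 R) t : half_derive (fun=> x) t 0.
Proof. by apply/half_derive_mxP => i j; apply: has_deriv_congr (has_deriv_cst (x i j) t); rewrite ?mxE. Qed.

Lemma half_deriveD f g t df dg : half_derive f t df -> half_derive g t dg ->
  half_derive (fun s => f s + g s) t (df + dg).
Proof.
move=> /half_derive_mxP hf /half_derive_mxP hg; apply/half_derive_mxP => i j.
by apply: has_deriv_congr (has_derivD (hf i j) (hg i j)) => [s|]; rewrite addmxE.
Qed.

Lemma half_deriveN f t df : half_derive f t df ->
  half_derive (fun s => - f s) t (- df).
Proof.
move=> /half_derive_mxP hf; apply/half_derive_mxP => i j.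
by apply: has_deriv_congr (has_derivN (hf i j)) => [s|]; rewrite oppmxE.
Qed.

Lemma cvg_inner (T : Type) (F : set_system T) (FF : Filter F)
    (f g : T -> su2 R) x y :
  f t @[t --> F] --> x -> g t @[t --> F] --> y ->
  inner (f t) (g t) @[t --> F] --> inner x y.
Proof.
move=> /cvg_mxP fx /cvg_mxP gy; rewrite innerE; under eq_fun do rewrite innerE.
by do 2 (apply: cvgD; last exact: cvgM); exact: cvgM.
Qed.

Lemma cvg_bracket (T : Type) (F : set_system T) (FF : Filter F)
    (f g : T -> su2 R) x y :
  f t @[t --> F] --> x -> g t @[t --> F] --> y ->
  bracket (f t) (g t) @[t --> F] --> bracket x y.
Proof.
move=> /cvg_mxP fx /cvg_mxP gy; apply/cvg_mxP => i; rewrite ord1 => k.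
by rewrite mxE; under eq_fun do rewrite mxE; apply: cvgB; exact: cvgM.
Qed.

Lemma constant_cvgNy (f : R -> R) l : (forall t, t <= 0 -> f t = f 0) ->
  f t @[t --> -oo] --> l -> f 0 = l.
Proof.
move=> fc fl; suff : f t @[t --> -oo] --> f 0 by move=> /cvg_unique; exact.
apply: cvg_near_cst; near=> t; rewrite /= fc//; near: t; exact: nbhs_ninfty_le.
Unshelve. all: by end_near. Qed.

Lemma nonincreasing_cvgNy (f : R -> R) l :
  (forall s t, s <= t -> t <= 0 -> f t <= f s) ->
  f t @[t --> -oo] --> l -> forall t, t <= 0 -> f t <= l.
Proof.
move=> fd fl t t0; apply: (cvgr_to_ge fl).
by near=> s; apply: fd => //; near: s; exact: nbhs_ninfty_le.
Unshelve. all: by end_near. Qed.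

Lemma has_deriv_expR (k t : R) : has_deriv (fun s => expR (k * s)) t (k * expR (k * t)).
Proof.
have hk : is_derive t 1 (k \*: (@id R)) (k *: 1).
  exact: is_deriveZ.
apply: has_deriv_eq (is_derive_has_deriv (@is_derive1_comp _ _ _ _ _ _ (is_derive_expR _) hk)) _.
by rewrite /GRing.scale /= mulr1 mulrC.
Qed.

End nahm_calculus.

Section nahm_conservation.
Context {R : realType}.
Implicit Types (B : R -> 'M[R]_3).

Let nahm_derivatives B t : nahm_solution B -> t <= 0 ->
  [/\ half_derive (fun s => row 0 (B s)) t (- bracket (row 1 (B t)) (row 2 (B t))),
      half_derive (fun s => row 1 (B s)) t (- bracket (row 2 (B t)) (row 0 (B t))) &
      half_derive (fun s => row 2 (B s)) t (- bracket (row 0 (B t)) (row 1 (B t)))].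
Proof.
by move=> [_ nB] t0; have h := nB t t0; split;
  [have := half_derive_row (i := 0) h|have := half_derive_row (i := 1) h|
   have := half_derive_row (i := 2) h]; rewrite row_tup.
Qed.

(** The three squared lengths have the same derivative, and the mixed inner
products are constant. *)
Lemma has_deriv_nahm_inner B t : nahm_solution B -> t <= 0 -> forall i j,
  has_deriv (fun s => inner (row i (B s)) (row j (B s))) t
     (if i == j then - 2 * Phi (B t) else 0).
Proof.
move=> nB t0; have [h0 h1 h2] := nahm_derivatives nB t0.
rewrite /Phi; elim/ord3P; elim/ord3P => /=.
- by apply: has_deriv_eq (has_deriv_inner h0 h0) _; rewrite innerNl innerNr innerC; ring.
- by apply: has_deriv_eq (has_deriv_inner h0 h1) _; rewrite innerNl innerNr !(mxopE, coordE); ring.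
- by apply: has_deriv_eq (has_deriv_inner h0 h2) _; rewrite innerNl innerNr !(mxopE, coordE); ring.
- by apply: has_deriv_eq (has_deriv_inner h1 h0) _; rewrite innerNl innerNr !(mxopE, coordE); ring.
- by apply: has_deriv_eq (has_deriv_inner h1 h1) _; rewrite innerNl innerNr !(mxopE, coordE); ring.
- by apply: has_deriv_eq (has_deriv_inner h1 h2) _; rewrite innerNl innerNr !(mxopE, coordE); ring.
- by apply: has_deriv_eq (has_deriv_inner h2 h0) _; rewrite innerNl innerNr !(mxopE, coordE); ring.
- by apply: has_deriv_eq (has_deriv_inner h2 h1) _; rewrite innerNl innerNr !(mxopE, coordE); ring.
- by apply: has_deriv_eq (has_deriv_inner h2 h2) _; rewrite innerNl innerNr !(mxopE, coordE); ring.
Qed.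

(** The Nahm equations say that B' is minus the gradient of Phi at B, so Phi
decreases along solutions. *)
Lemma has_deriv_nahm_Phi B t : nahm_solution B -> t <= 0 ->
  has_deriv (fun s => Phi (B s)) t
    (- (inner (bracket (row 1 (B t)) (row 2 (B t)))
              (bracket (row 1 (B t)) (row 2 (B t))) +
        inner (bracket (row 2 (B t)) (row 0 (B t)))
              (bracket (row 2 (B t)) (row 0 (B t))) +
        inner (bracket (row 0 (B t)) (row 1 (B t)))
              (bracket (row 0 (B t)) (row 1 (B t))))).
Proof.
move=> nB t0; have [h0 h1 h2] := nahm_derivatives nB t0.
apply: has_deriv_eq (has_deriv_inner h0 (half_derive_bracket h1 h2)) _.
set u := row 0 _; set v := row 1 _; set w := row 2 _.
by rewrite !(mxopE, coordE); ring.
Qed.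

(** Gronwall's argument for u = |B - B'|^2: the vector field is quadratic, so
|u'| <= 4 K u when both solutions have components of length at most K, and
u exp(4 K t) is nondecreasing and vanishes at 0. *)
Lemma nahm_unique B B' K : 0 <= K -> nahm_solution B -> nahm_solution B' ->
  (forall i t, t <= 0 -> inner (row i (B t)) (row i (B t)) <= K ^+ 2) ->
  (forall i t, t <= 0 -> inner (row i (B' t)) (row i (B' t)) <= K ^+ 2) ->
  B 0 = B' 0 -> B = B'.
Proof.
move=> K0 nB nB' bB bB' B0.
pose d i t := row i (B t) - row i (B' t).
pose u t := inner (d 0 t) (d 0 t) + inner (d 1 t) (d 1 t) + inner (d 2 t) (d 2 t).
have u_ge0 t : 0 <= u t by rewrite !addr_ge0 ?inner_ge0.
suff u0 : forall t, t <= 0 -> u t <= 0.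
  apply/funext => t; wlog t0 : t / t <= 0.
    have [t0|/ltW t0] := leP t 0; first exact.
    by move=> /(_ 0 (lexx _)); rewrite (nB.1 t t0) (nB'.1 t t0).
  have ut : u t = 0 by apply/le_anti; rewrite u_ge0 u0.
  have dE i : inner (d i t) (d i t) = 0 -> row i (B t) = row i (B' t).
    by move=> /inner_eq0/eqP; rewrite subr_eq0 => /eqP.
  move: ut; have := inner_ge0 (d 0 t); have := inner_ge0 (d 1 t).
  have := inner_ge0 (d 2 t); rewrite /u => h2 h1 h0 h.
  by apply: mx3P; apply: dE; lra.
pose k := 4 * K.
pose du t := - 2 * (inner (bracket (d 0 t) (d 1 t)) (row 2 (B t) + row 2 (B' t)) +
  inner (bracket (d 1 t) (d 2 t)) (row 0 (B t) + row 0 (B' t)) +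
  inner (bracket (d 2 t) (d 0 t)) (row 1 (B t) + row 1 (B' t))).
have hu t : t <= 0 -> has_deriv u t (du t).
  move=> t0; have [h0 h1 h2] := nahm_derivatives nB t0.
  have [h0' h1' h2'] := nahm_derivatives nB' t0.
  have e0 := half_deriveD h0 (half_deriveN h0').
  have e1 := half_deriveD h1 (half_deriveN h1').
  have e2 := half_deriveD h2 (half_deriveN h2').
  apply: has_deriv_eq (has_derivD (has_derivD (has_deriv_inner e0 e0) (has_deriv_inner e1 e1)) (has_deriv_inner e2 e2)) _.
  by rewrite /du /d !(mxopE, coordE); ring.
have triple x y i t : t <= 0 ->
    `|inner (bracket x y) (row i (B t) + row i (B' t))| <= K * (inner x x + inner y y).
  move=> t0; rewrite innerDr (le_trans (ler_normD _ _))//.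
  have := triple_bound x y K0 (bB i t t0).
  by have := triple_bound x y K0 (bB' i t t0); lra.
have du_le t : t <= 0 -> - (k * u t) <= du t.
  move=> t0; have t1 := triple (d 0 t) (d 1 t) 2 t t0.
  have t2 := triple (d 1 t) (d 2 t) 0 t t0.
  have t3 := triple (d 2 t) (d 0 t) 1 t t0.
  move: t1 t2 t3; rewrite !ler_norml /k /u /du.
  by move=> /andP[? ?] /andP[? ?] /andP[? ?]; nra.
move=> t t0.
have mono := @has_deriv_nondecreasing _ (fun s => u s * expR (k * s)) _
  (fun s s0 => has_derivM (hu s s0) (@has_deriv_expR _ k s)).
have := mono _ t 0 t0 (lexx 0).
have -> : u 0 = 0 by rewrite /u /d B0 !subrr inner0l !addr0.
rewrite mul0r pmulr_lle0 ?expR_gt0//; apply => s s0.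
have := du_le s s0; have := expR_gt0 (k * s).
by rewrite mulrCA mulrA -mulrDl => e0 h; apply: mulr_ge0; lra.
Qed.

End nahm_conservation.

(** * The adjoint action of SU(2) *)

Section SU2_action.
Local Open Scope complex_scope.
Local Open Scope sesquilinear_scope.
Local Open Scope ring_scope.
Context {R : realType}.
Implicit Types (x y e v m : su2 R) (g : 'M[R[i]]_2).

Lemma Ad_isometry g x y : SU2 g -> inner (Ad g x) (Ad g y) = inner x y.
Proof.
move=> gS; have gu : g \in unitmx by have [gU _] := gS; exact: unitarymx_unit.
suff /(congr1 (@complex.Re R)) : (inner (Ad g x) (Ad g y))%:C = (inner x y)%:C by [].
rewrite !su2_mx_inner !(su2_mx_Ad _ gS); congr (_ * _).
by rewrite !mulmxA mulmxKV// mxtrace_mulC !mulmxA mulVmx// mul1mx.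
Qed.

Lemma AdZ (g : 'M[R[i]]_2) c (x : su2 R) : SU2 g -> Ad g (c *: x) = c *: Ad g x.
Proof.
move=> gS; have h1 := Ad_isometry (c *: x) (c *: x) gS.
have h2 := Ad_isometry (c *: x) x gS; have h3 := Ad_isometry x x gS.
move: h1 h2 h3; move: (Ad g (c *: x)) (Ad g x) => y z h1 h2 h3.
apply/eqP; rewrite -subr_eq0; apply/eqP/inner_eq0.
rewrite !(innerDl, innerDr, innerNl, innerNr, innerZl, innerZr) (innerC z) h1 h2 h3.
by rewrite !(innerZl, innerZr); ring.
Qed.

Lemma Ad0 (g : 'M[R[i]]_2) : SU2 g -> Ad g 0 = 0.
Proof. by move=> gS; rewrite -{1}(scale0r (0 : su2 R)) AdZ// scale0r. Qed.

Lemma ord2P (P : 'I_2 -> Prop) : P 0 -> P 1 -> forall i, P i.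
Proof.
by move=> P0 P1 [[|[|//]] i]; [move: P0|move: P1]; congr P; apply/val_inj.
Qed.

Lemma sum2E (V : nmodType) (F : 'I_2 -> V) : \sum_(k < 2) F k = F 0 + F 1.
Proof. by rewrite !big_ord_recl big_ord0 addr0; congr (F _ + F _); apply/val_inj. Qed.

Lemma su2_mxE x i j : su2_mx x i j =
    if i == 0 then
      if j == 0 then 0 +i* (- x 0 2 / 2) else (- x 0 1 / 2) +i* (- x 0 0 / 2)
    else
      if j == 0 then (x 0 1 / 2) +i* (- x 0 0 / 2) else 0 +i* (x 0 2 / 2).
Proof. by rewrite mxE. Qed.

Lemma mulmx2E (X Y : 'M[R[i]]_2) i j : (X *m Y) i j = X i 0 * Y 0 j + X i 1 * Y 1 j.
Proof. by rewrite mxE sum2E. Qed.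

(** The quaternion of norm 1 attached to the unit vector m, which is twice
[su2_mx m], acts as the half-turn of axis m. *)
Lemma SU2_half_turn m : inner m m = 1 -> exists g, SU2 g /\
  forall x, Ad g x = (2 * inner m x) *: m - x.
Proof.
move=> m1; have [n nE] : exists n, n = 2 *: m by exists (2 *: m).
pose g := su2_mx n.
have n4 : inner n n = 4 by rewrite nE innerZl innerZr m1; ring.
have gxg x : g *m su2_mx x *m g =
    su2_mx ((- 4^-1) *: ((2 * inner n x) *: n - inner n n *: x)).
  apply/matrixP => i j; move: i j; elim/ord2P; elim/ord2P;
    rewrite !(scalemxE, mulmx2E, su2_mxE, mxopE, innerE) /=;
    apply/eqP; rewrite eq_complex /=; apply/andP; split; apply/eqP; by field.
have gg : g *m g = - 1%:M.
  move: n4; rewrite innerE => n4.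
  apply/matrixP => i j; move: i j; elim/ord2P; elim/ord2P;
    rewrite !(mulmx2E, su2_mxE, mxopE) mxE /=;
    apply/eqP; rewrite eq_complex /=; apply/andP; split; apply/eqP; first [done|lra].
have gN : g *m (- g) = 1%:M by rewrite mulmxN gg opprK.
have [gstar _] : g ^t* = - g /\ \tr g = 0 by apply/su2_mxP; exists n.
have gS : SU2 g.
  split; first by apply/unitarymxP; rewrite gstar gN.
  rewrite (expand_det_row _ 0) sum2E /cofactor !det_mx11 !mxE /=.
  move: n4; rewrite innerE => n4.
  apply/eqP; rewrite eq_complex /=; apply/andP; split; apply/eqP; first [done|lra].
have gV : invmx g = - g.
  have gu : g \in unitmx by have [gU _] := gS; exact: unitarymx_unit.
  by rewrite -[LHS]mulmx1 -gN mulmxA mulVmx// mul1mx.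
exists g; split=> // x; rewrite /Ad gV mulmxN gxg.
have -> (z : su2 R) : - su2_mx z = su2_mx (- z).
  apply/matrixP => i j; move: i j; elim/ord2P; elim/ord2P;
    rewrite !(su2_mxE, mxopE) /=;
    apply/eqP; rewrite eq_complex /=; apply/andP; split; apply/eqP; by field.
rewrite su2_mxK n4 nE innerZl.
by apply: su2P; rewrite !mxopE; field.
Qed.

(** The half-turn around the bisector of e and v exchanges e and v; when v = - e
any axis orthogonal to e will do. *)
Lemma SU2_transitive e v : inner e e = 1 -> inner v v = 1 ->
  exists g, SU2 g /\ Ad g e = v.
Proof.
move=> e1 v1.
suff [m [m1 mE]] : exists m, inner m m = 1 /\ (2 * inner m e) *: m - e = v.
  by have [g [gS gE]] := SU2_half_turn m1; exists g; rewrite gE mE.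
have [ve|ve] := eqVneq (v + e) 0.
  have [m m1 me] := exists_orthonormal e.
  exists m; split=> //; rewrite innerC me mulr0 scale0r sub0r.
  by apply/eqP; rewrite eq_sym -addr_eq0 ve.
have r0 := inner_gt0 ve; set r := inner _ _ in r0.
have rE : r = 2 * inner (v + e) e.
  by rewrite /r !(innerDl, innerDr) v1 e1 (innerC e v); ring.
exists ((Num.sqrt r)^-1 *: (v + e)); split.
  by rewrite innerZl innerZr -/r -[X in _ * (_ * X)](sqr_sqrtr (ltW r0));
    field; rewrite gt_eqF// sqrtr_gt0.
rewrite innerZl scalerA.
have -> : 2 * ((Num.sqrt r)^-1 * inner (v + e) e) / Num.sqrt r = 1.
  by rewrite mulrCA -rE -[X in _ * X / _](sqr_sqrtr (ltW r0)); field;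
    rewrite gt_eqF// sqrtr_gt0.
by rewrite scale1r addrK.
Qed.

End SU2_action.

(** * The scalar profile of a solution *)

Section profile.
Context {R : realType} (q : R) (q0 : 0 <= q).
Implicit Types (A t : R).

Definition qcosh t : R := (expR (q * t) + expR (- q * t)) / 2.
(** This is sinh(q t) / q, extended by continuity to q = 0. *)
Definition qsinh t : R :=
  if q == 0 then t else (expR (q * t) - expR (- q * t)) / (2 * q).

(** For the solution of f' = A f, A' = f^2 with A(0) = A and
f(0)^2 = A^2 - q^2, one has f(t) = f(0) / den(t) and
A(t) = num(t) / den(t): these functions satisfy den' = - num and
num' = - q^2 den. *)
Definition den A t := qcosh t - A * qsinh t.
Definition num A t := A * qcosh t - q ^+ 2 * qsinh t.

Lemma has_deriv_qcosh t : has_deriv qcosh t (q ^+ 2 * qsinh t).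
Proof.
have h := has_derivD (@has_deriv_expR _ q t) (@has_deriv_expR _ (- q) t).
apply: has_deriv_congr (has_derivZ (c := 2^-1) h) => [s|]; first by rewrite mulrC.
rewrite /qsinh; case: eqVneq => [->|qn0]; first by ring.
by field.
Qed.

Lemma has_deriv_id t : has_deriv id t 1.
Proof. by apply: is_derive_has_deriv; exact: is_derive_id. Qed.

Lemma has_deriv_qsinh t : has_deriv qsinh t (qcosh t).
Proof.
rewrite /qsinh /qcosh; case: eqVneq => [->|qn0].
  by apply: has_deriv_congr (has_deriv_id t) => //; rewrite oppr0 !mul0r expR0; field.
have h := has_derivD (@has_deriv_expR _ q t) (has_derivN (@has_deriv_expR _ (- q) t)).
apply: has_deriv_congr (has_derivZ (c := (2 * q)^-1) h) => [s|]; first by rewrite mulrC.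
by field.
Qed.

Lemma qcosh2_qsinh2 t : qcosh t ^+ 2 - q ^+ 2 * qsinh t ^+ 2 = 1.
Proof.
have e : expR (q * t) * expR (- q * t) = 1.
  by rewrite -expRD mulNr subrr expR0.
rewrite /qcosh /qsinh; case: eqVneq => [->|qn0].
  by rewrite oppr0 !mul0r expR0; field.
transitivity (expR (q * t) * expR (- q * t)); last exact: e.
by field.
Qed.

Lemma qcosh0 : qcosh 0 = 1.
Proof. by rewrite /qcosh !mulr0 expR0; field. Qed.

Lemma qsinh0 : qsinh 0 = 0.
Proof. by rewrite /qsinh; case: ifP => // _; rewrite !mulr0 subrr mul0r. Qed.

Lemma qcosh_ge1 t : 1 <= qcosh t.
Proof.
have c0 : 0 < qcosh t by rewrite divr_gt0// addr_gt0// expR_gt0.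
have := qcosh2_qsinh2 t; have := sqr_ge0 (q * qsinh t).
by rewrite exprMn => h1 h2; nra.
Qed.

Lemma qsinh_le t : t <= 0 -> qsinh t <= t.
Proof.
move=> t0; have h s : s <= 0 -> has_deriv (fun s => qsinh s + - s) s (qcosh s + - 1).
  by move=> _; apply: has_derivD; [exact: has_deriv_qsinh|apply: has_derivN; exact: has_deriv_id].
have := @has_deriv_nondecreasing _ _ _ h _ t 0 t0 (lexx 0).
rewrite qsinh0 oppr0 addr0 => /(_ _)/=.
rewrite subr_le0; apply => s _; by rewrite subr_ge0 qcosh_ge1.
Qed.

(** The denominator has no zero on the half-line, and it tends to +oo at -oo even
when q = 0. *)
Lemma den_ge A t : 0 <= A -> t <= 0 -> 1 - A * t <= den A t.
Proof.
move=> A0 t0; rewrite /den; have := qcosh_ge1 t; have := qsinh_le t0; nra.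
Qed.

Lemma den_gt0 A t : 0 <= A -> t <= 0 -> 0 < den A t.
Proof.
by move=> A0 t0; apply: lt_le_trans (den_ge A0 t0); nra.
Qed.

Lemma num_gt0 A t : 0 < A -> t <= 0 -> 0 < num A t.
Proof.
move=> A0 t0; rewrite /num.
have := qcosh_ge1 t; have := qsinh_le t0; have := sqr_ge0 q; nra.
Qed.

Lemma has_deriv_den A t : has_deriv (den A) t (- num A t).
Proof.
apply: has_deriv_congr (has_derivD (@has_deriv_qcosh t) (has_derivN (has_derivZ (c := A) (@has_deriv_qsinh t)))) => //.
by rewrite /num; ring.
Qed.

Lemma has_deriv_num A t : has_deriv (num A) t (- (q ^+ 2 * den A t)).
Proof.
apply: has_deriv_congr (has_derivD (has_derivZ (c := A) (@has_deriv_qcosh t))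
  (has_derivN (has_derivZ (c := q ^+ 2) (@has_deriv_qsinh t)))) => //.
by rewrite /den; ring.
Qed.

Lemma num2_den2 A t :
  num A t ^+ 2 - q ^+ 2 * den A t ^+ 2 = A ^+ 2 - q ^+ 2.
Proof.
transitivity ((A ^+ 2 - q ^+ 2) * (qcosh t ^+ 2 - q ^+ 2 * qsinh t ^+ 2)).
  by rewrite /num /den; ring.
by rewrite qcosh2_qsinh2 mulr1.
Qed.

Definition shrink A t := (den A t)^-1.
Definition axial A t := num A t / den A t.

Lemma shrink0 A : shrink A 0 = 1.
Proof. by rewrite /shrink /den qcosh0 qsinh0 mulr0 subr0 invr1. Qed.

Lemma axial0 A : axial A 0 = A.
Proof. by rewrite /axial /den /num qcosh0 qsinh0 !mulr0 !subr0 mulr1 divr1. Qed.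

Lemma shrink_gt0 A t : 0 <= A -> t <= 0 -> 0 < shrink A t.
Proof. by move=> A0 t0; rewrite invr_gt0 den_gt0. Qed.

Lemma axial_gt0 A t : 0 < A -> t <= 0 -> 0 < axial A t.
Proof. by move=> A0 t0; rewrite divr_gt0// ?num_gt0// den_gt0// ltW. Qed.

Lemma has_deriv_shrink A t : 0 <= A -> t <= 0 -> has_deriv (shrink A) t (axial A t * shrink A t).
Proof.
move=> A0 t0; have dn0 s : s <= 0 -> den A s != 0.
  by move=> s0; rewrite gt_eqF// den_gt0.
apply: has_deriv_congr (has_derivV dn0 t0 (@has_deriv_den A t)) => //.
by rewrite /axial /shrink; field; exact: dn0.
Qed.

Lemma axial2 A t : 0 <= A -> t <= 0 ->
  axial A t ^+ 2 = q ^+ 2 + (A ^+ 2 - q ^+ 2) * shrink A t ^+ 2.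
Proof.
move=> A0 t0; rewrite -(num2_den2 A t) /axial /shrink; field.
by rewrite gt_eqF// den_gt0.
Qed.

Lemma has_deriv_axial A t : 0 <= A -> t <= 0 ->
  has_deriv (axial A) t ((A ^+ 2 - q ^+ 2) * shrink A t ^+ 2).
Proof.
move=> A0 t0; apply: has_deriv_congr (has_derivM (@has_deriv_num A t) (has_deriv_shrink A0 t0)) => //.
rewrite -(num2_den2 A t) /axial /shrink; field.
by rewrite gt_eqF// den_gt0.
Qed.

Lemma shrink_le1 A t : 0 <= A -> t <= 0 -> shrink A t <= 1.
Proof.
by move=> A0 t0; rewrite invf_le1 ?den_gt0//; apply: le_trans (den_ge A0 t0); nra.
Qed.

Lemma cvg_shrink A : 0 < A -> shrink A t @[t --> -oo] --> 0.
Proof.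
move=> A0; apply/cvgrPdist_le => e e0; near=> t.
have t0 : t <= 0 by near: t; exact: nbhs_ninfty_le.
have tA : t <= - (e^-1 / A) by near: t; apply: nbhs_ninfty_le; exact: num_real.
rewrite sub0r normrN gtr0_norm ?shrink_gt0 ?(ltW A0)//.
rewrite -[leRHS]invrK lef_pV2 ?posrE ?invr_gt0 ?den_gt0 ?(ltW A0)//.
apply: le_trans (den_ge (ltW A0) t0).
have : A * t <= A * - (e^-1 / A) by rewrite ler_pM2l.
have -> : A * - (e^-1 / A) = - e^-1 by field; rewrite !gt_eqF.
by move=> h; lra.
Unshelve. all: by end_near. Qed.

(** From (A(t) - q)^2 <= A(t)^2 - q^2, since A(t) >= q >= 0. *)
Lemma cvg_axial A : 0 < A -> q ^+ 2 <= A ^+ 2 -> axial A t @[t --> -oo] --> q.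
Proof.
move=> A0 qA; apply/cvgrPdist_le => e e0.
have /cvgrPdist_le/(_ (e / A) (divr_gt0 e0 A0)) sm := cvg_shrink A0.
near=> t.
have t0 : t <= 0 by near: t; exact: nbhs_ninfty_le.
have b0 := axial_gt0 A0 t0; have b2 := axial2 (ltW A0) t0.
have s0 := shrink_gt0 (ltW A0) t0.
have sme : shrink A t <= e / A.
  have : `|0 - shrink A t| <= e / A by near: t; exact: sm.
  by rewrite sub0r normrN gtr0_norm.
have As : A * shrink A t <= e by rewrite mulrC -ler_pdivlMr.
have s2 := sqr_ge0 (shrink A t).
have qb : q <= axial A t.
  rewrite -(@ler_pXn2r _ 2) ?nnegrE ?(ltW b0)// b2 lerDl.
  by rewrite mulr_ge0// subr_ge0.
apply: le_trans As; rewrite distrC ger0_norm ?subr_ge0//.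
rewrite -(@ler_pXn2r _ 2) ?nnegrE ?subr_ge0// ?mulr_ge0 ?(ltW s0) ?(ltW A0)//.
rewrite exprMn.
have h1 : 0 <= q * (axial A t - q) by rewrite mulr_ge0// subr_ge0.
have h2 : 0 <= q ^+ 2 * shrink A t ^+ 2 by rewrite mulr_ge0// sqr_ge0.
have -> : (axial A t - q) ^+ 2 = axial A t ^+ 2 - q ^+ 2 - 2 * (q * (axial A t - q)).
  by ring.
by rewrite b2; lra.
Unshelve. all: by end_near. Qed.

End profile.

(** * Explicit solutions of the Nahm equations *)

Section flow.
Context {R : realType}.
Implicit Types (a tau : 'M[R]_3) (B : R -> 'M[R]_3).

Lemma half_derive_scale (c : R -> R) t dc (x : su2 R) : has_deriv c t dc ->
  half_derive (fun s => c s *: x) t (dc *: x).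
Proof.
move=> hc; apply/half_derive_mxP => i j.
apply: has_deriv_congr (has_derivM hc (has_deriv_cst (x i j) t)) => [s|]; rewrite scalemxE //.
by rewrite mulr0 addr0.
Qed.

Lemma half_derive_tup3 (f0 f1 f2 : R -> su2 R) t d0 d1 d2 :
  half_derive f0 t d0 -> half_derive f1 t d1 -> half_derive f2 t d2 ->
  half_derive (fun s => tup [:: f0 s; f1 s; f2 s] : 'M[R]_3) t (tup [:: d0; d1; d2]).
Proof.
move=> /half_derive_mxP h0 /half_derive_mxP h1 /half_derive_mxP h2.
apply/half_derive_mxP; elim/ord3P => k;
  [apply: has_deriv_congr (h0 0 k)|apply: has_deriv_congr (h1 0 k)|apply: has_deriv_congr (h2 0 k)];
  by move=> *; rewrite tupE.
Qed.

Lemma half_derive_ext m n (f g : R -> 'M[R]_(m, n)) t l : t <= 0 ->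
  (forall s, s <= 0 -> f s = g s) -> half_derive f t l -> half_derive g t l.
Proof.
move=> t0 fg /half_derive_mxP h; apply/half_derive_mxP => i j.
by apply: has_deriv_ext (h i j) => // s s0; rewrite fg.
Qed.

(** The time is truncated at 0 to comply with the encoding of functions on the
half-line.  As a function of a, this is given by a formula that is smooth as
long as a1 <> 0; the basis p, which is not a function of a, is absent. *)
Definition nahm_flow (q : R) a (t : R) : 'M[R]_3 :=
  let A := su2_norm (row 0 a) in let s := Num.min t 0 in
  tup [:: shrink q A s *: row 2 a; (axial q A s / A) *: row 0 a; shrink q A s *: row 1 a].

Lemma su2_norm_leaf_point (A f : R) p0 p1 p2 : antiframe p0 p1 p2 -> 0 < A ->
  su2_norm (row 0 (leaf_point A f p0 p1 p2)) = A.
Proof.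
move=> F A0; rewrite /su2_norm row_tup /= innerZl innerZr (antiframe_tables F).
by rewrite mulr1 -expr2 sqrtr_sqr gtr0_norm.
Qed.

Lemma nahm_flowE q (A f : R) p0 p1 p2 t : antiframe p0 p1 p2 -> 0 < A -> t <= 0 ->
  nahm_flow q (leaf_point A f p0 p1 p2) t =
  tup [:: (shrink q A t * f) *: p2; axial q A t *: p0; (shrink q A t * f) *: p1].
Proof.
move=> F A0 t0; rewrite /nahm_flow (su2_norm_leaf_point _ F)// min_l//.
by rewrite !row_tup /= !scalerA mulfVK// gt_eqF.
Qed.

Lemma nahm_flow_solution q a : closed_leaf q a -> nahm_solution (nahm_flow q a).
Proof.
move=> [A [f [p0 [p1 [p2 [F A0 Aq ->]]]]]]; split.
  by move=> t t0; rewrite /nahm_flow min_r// min_l.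
move=> t t0 /=; rewrite !nahm_flowE// !row_tup /=.
rewrite !(bracketZl, bracketZr) !(antiframe_tables F) !scalerN !opprK !scalerA.
apply: (half_derive_ext (f := fun s => tup [:: (shrink q A s * f) *: p2;
    axial q A s *: p0; (shrink q A s * f) *: p1])) => //.
  by move=> s s0; rewrite nahm_flowE.
have hs := has_derivM (@has_deriv_shrink _ q A t (ltW A0) t0) (has_deriv_cst f t).
have hb := @has_deriv_axial _ q A t (ltW A0) t0.
apply: half_derive_tup3; apply: half_derive_scale.
- by apply: has_deriv_eq hs _; ring.
- by apply: has_deriv_eq hb _; rewrite Aq; ring.
- by apply: has_deriv_eq hs _; ring.
Qed.

Lemma nahm_flow0 q a : closed_leaf q a -> h_map (nahm_flow q a) = a.
Proof.
move=> [A [f [p0 [p1 [p2 [F A0 Aq ->]]]]]].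
by rewrite /h_map nahm_flowE// !row_tup /= shrink0 axial0 !mul1r.
Qed.

Section boundary_value.
Context (e1 : su2 R) (he1 : inner e1 e1 = 1) (q : R) (q0 : 0 <= q).
Let tau : 'M[R]_3 := tup [:: 0; q *: e1; 0].

Lemma nahm_flow_kronheimer a : closed_leaf q a ->
  kronheimer_space tau (nahm_flow q a).
Proof.
move=> La; split; first exact: nahm_flow_solution.
  move: La => [A [f [p0 [p1 [p2 [F A0 Aq ->]]]]]].
  have [g [gS gE]] := SU2_transitive he1 (af00 F).
  exists g; split=> //.
  have qA : q ^+ 2 <= A ^+ 2 by rewrite Aq lerDl sqr_ge0.
  have ev (f1 f2 : R -> su2 R) (l : su2 R) : (forall t, t <= 0 -> f1 t = f2 t) ->
      f1 t @[t --> -oo] --> l -> f2 t @[t --> -oo] --> l.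
    move=> f12; apply: cvg_trans; apply: near_eq_cvg; near=> t.
    by apply: f12; near: t; exact: nbhs_ninfty_le.
  have cs (p : su2 R) : (shrink q A t * f) *: p @[t --> -oo] --> (0 : su2 R).
    rewrite -(scale0r p) -(mul0r f); apply: cvgZr_tmp; apply: cvgM.
      exact: cvg_shrink.
    exact: cvg_cst.
  elim/ord3P; rewrite row_tup /=.
  - rewrite Ad0//; apply: ev (cs p2) => t t0.
    by rewrite nahm_flowE// row_tup.
  - rewrite AdZ// gE. apply: (ev (fun t => axial q A t *: p0) _ (q *: p0)).
      by move=> t t0; rewrite nahm_flowE// row_tup.
    by apply: cvgZr_tmp; exact: cvg_axial.
  - rewrite Ad0//; apply: ev (cs p1) => t t0.
    by rewrite nahm_flowE// row_tup.
move=> _ /(congr1 h_map); rewrite nahm_flow0// => a0.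
have [_ _ _ _] := (closed_leafP q a).1 La.
by rewrite a0 row_tup /= linear0 eqxx.
Unshelve. all: by end_near. Qed.

Section solution.
Context (B : R -> 'M[R]_3) (KB : kronheimer_space tau B).

Let nB : nahm_solution B. Proof. by case: KB. Qed.

Lemma kronheimer_limits : exists r : 'I_3 -> su2 R, [/\ r 0 = 0,
  forall i, row i (B t) @[t --> -oo] --> r i &
  forall i j, inner (r i) (r j) = if (i == 1) && (j == 1) then q ^+ 2 else 0].
Proof.
have [_ [g [gS gl]] _] := KB; exists (fun i => Ad g (row i tau)); split=> //.
  by rewrite row_tup /= Ad0.
move=> i j; rewrite Ad_isometry//; elim/ord3P: i; elim/ord3P: j;
  rewrite !row_tup /= ?inner0l ?inner0r//.
by rewrite innerZl innerZr he1; ring.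
Qed.

Lemma kronheimer_orthogonal i j t : i != j -> t <= 0 ->
  inner (row i (B t)) (row j (B t)) = 0.
Proof.
move=> ij t0; have [r [_ rl rE]] := kronheimer_limits.
have h s : s <= 0 -> has_deriv (fun s => inner (row i (B s)) (row j (B s))) s 0.
  by move=> s0; have := @has_deriv_nahm_inner _ _ _ nB s0 i j; rewrite (negPf ij).
rewrite (has_deriv_constant h)//.
rewrite (constant_cvgNy (has_deriv_constant h) (cvg_inner _ (rl i) (rl j))) rE.
by case: andP => // -[/eqP i1 /eqP j1]; rewrite i1 j1 eqxx in ij.
Qed.

Lemma kronheimer_norms i j : inner (row i (B 0)) (row i (B 0)) -
    inner (row j (B 0)) (row j (B 0)) = (i == 1)%:R * q ^+ 2 - (j == 1)%:R * q ^+ 2.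
Proof.
have [r [_ rl rE]] := kronheimer_limits.
have h s : s <= 0 -> has_deriv (fun s => inner (row i (B s)) (row i (B s)) +
    - inner (row j (B s)) (row j (B s))) s 0.
  move=> s0; have := has_derivD (@has_deriv_nahm_inner _ _ _ nB s0 i i) (has_derivN (@has_deriv_nahm_inner _ _ _ nB s0 j j)).
  by rewrite !eqxx subrr.
rewrite (constant_cvgNy (has_deriv_constant h)
  (cvgB (cvg_inner _ (rl i) (rl i)) (cvg_inner _ (rl j) (rl j)))) !rE !andbb.
by case: (i == 1); case: (j == 1); rewrite ?mul1r ?mul0r ?subr0 ?sub0r ?subrr.
Qed.

Lemma kronheimer_Phi t : t <= 0 -> Phi (B t) <= 0.
Proof.
have [r [r0 rl rE]] := kronheimer_limits.
have Pl : Phi (B t) @[t --> -oo] --> 0.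
  have := cvg_inner _ (rl 0) (cvg_bracket _ (rl 1) (rl 2)).
  by rewrite r0 inner0l; exact.
move=> t0; apply: (nonincreasing_cvgNy (f := fun s => Phi (B s)) _ Pl t0).
move=> s s' ss' s'0; rewrite -lerN2.
apply: (has_deriv_nondecreasing (fun u u0 => has_derivN (has_deriv_nahm_Phi nB u0))) => // u u0.
by rewrite opprK !addr_ge0 ?inner_ge0.
Qed.

(** The squared lengths have derivative - 2 Phi(B) >= 0.  This bound makes the
components of B bounded on the whole half-line. *)
Lemma kronheimer_norm_le i t : t <= 0 ->
  inner (row i (B t)) (row i (B t)) <= inner (row i (B 0)) (row i (B 0)).
Proof.
move=> t0; apply: (has_deriv_nondecreasing (fun u u0 => @has_deriv_nahm_inner _ _ _ nB u0 i i)) => //.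
by move=> u u0; rewrite eqxx; have := kronheimer_Phi u0; lra.
Qed.

Lemma Phi_h_map : Phi (h_map B) = Phi (B 0).
Proof. by rewrite /Phi !row_tup /= -inner_bracketC. Qed.

(** All conditions are conservation laws, except a1 <> 0.  If a1 = 0 then q = 0
and B(0) = 0, so that B vanishes identically, by the bound on its components:
this is the solution excluded from M(0,0,0). *)
Lemma kronheimer_closed_leaf : closed_leaf q (h_map B).
Proof.
apply/closed_leafP; split.
- have o i j (ij : i != j) := kronheimer_orthogonal ij (lexx 0).
  by elim/ord3P; elim/ord3P => //= _; rewrite !row_tup /= o.
- by rewrite !row_tup /= kronheimer_norms /=; ring.
- by rewrite !row_tup /= kronheimer_norms /=; ring.
- by rewrite Phi_h_map kronheimer_Phi.
- rewrite row_tup /=; apply/eqP => B1.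
  have n01 := kronheimer_norms 0 1; have n21 := kronheimer_norms 2 1.
  move: n01 n21; rewrite /= B1 inner0l => n01 n21.
  have g0 := inner_ge0 (row 0 (B 0)); have q2 := sqr_ge0 q.
  have q00 : q = 0 by apply/eqP; rewrite -sqrf_eq0; apply/eqP; lra.
  move: n01 n21; rewrite q00 expr0n !mulr0 !subr0 => n0 n2.
  have z t i : t <= 0 -> row i (B t) = 0.
    move=> t0; apply: inner_eq0; apply/le_anti; rewrite inner_ge0 andbT.
    rewrite (le_trans (kronheimer_norm_le i t0))//.
    by elim/ord3P: i; rewrite ?n0 ?n2 ?B1 ?inner0l.
  have [[oB _] _] := KB; apply.
    by apply: mx3P; rewrite row_tup linear0 //= q00 scale0r.
  apply/funext => t; have [t0|/ltW t0] := leP t 0.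
    by apply: mx3P; rewrite z// linear0.
  by rewrite oB//; apply: mx3P; rewrite z// linear0.
Qed.

End solution.

(** Both sides have the same initial value and bounded components. *)
Lemma kronheimer_flow B : kronheimer_space tau B -> B = nahm_flow q (h_map B).
Proof.
move=> KB; have L := kronheimer_closed_leaf KB.
have KB' := nahm_flow_kronheimer L.
pose N i := inner (row i (B 0)) (row i (B 0)).
have B0 : B 0 = nahm_flow q (h_map B) 0.
  have E i := congr1 (row i) (nahm_flow0 L).
  by apply: mx3P; [have := E 2|have := E 0|have := E 1];
    rewrite !row_tup => /esym.
pose K := Num.sqrt (N 0 + N 1 + N 2).
have K2 : K ^+ 2 = N 0 + N 1 + N 2 by rewrite sqr_sqrtr// !addr_ge0 ?inner_ge0.
have NK i : N i <= K ^+ 2.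
  rewrite K2; have := inner_ge0 (row 0 (B 0)); have := inner_ge0 (row 1 (B 0)).
  by have := inner_ge0 (row 2 (B 0)); rewrite /N; elim/ord3P: i; lra.
apply: (nahm_unique (K := K)) => //.
- exact: sqrtr_ge0.
- by case: KB.
- by case: KB'.
- by move=> i t t0; rewrite (le_trans (kronheimer_norm_le KB i t0))//; exact: NK.
- by move=> i t t0; rewrite (le_trans (kronheimer_norm_le KB' i t0))// -B0; exact: NK.
Qed.

End boundary_value.
End flow.

(** * Tangent vectors of the space of solutions and their metric *)

Section linearized.
Context {R : realType}.

(** Decay at the rate of 1 / |t|, which both decay conditions ensure, is enough
to make a first integral vanish. *)
Lemma linear_bound_eq0 (c K : R) :
  (forall t, t <= 0 -> (1 - t) * `|c| <= K) -> c = 0.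
Proof.
move=> h; apply/eqP; apply: contraT => c0.
have c_gt0 : 0 < `|c| by rewrite normr_gt0.
have K0 : 0 <= K by apply: le_trans (h 0 (lexx 0)); rewrite subr0 mul1r.
have : (1 - - (K / `|c|)) * `|c| <= K by apply: h; rewrite oppr_le0 divr_ge0.
by rewrite opprK mulrDl mul1r divfK ?gt_eqF// gerDr leNgt c_gt0.
Qed.

(** The difference y0 - y1 satisfies z' = - A(t) z, hence is a constant times
den(t), which does not decay; f(t) y1 + A(t) y2 is a first integral.  Both
vanish, and what is left is a linear equation of order one. *)
Lemma decaying_system (q A f K : R) (y0 y1 y2 : R -> R) :
  0 < A -> A ^+ 2 = q ^+ 2 + f ^+ 2 ->
  (forall t, t <= 0 -> has_deriv y0 t (axial q A t * y1 t - f * shrink q A t * y2 t)) ->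
  (forall t, t <= 0 -> has_deriv y1 t (axial q A t * y0 t - f * shrink q A t * y2 t)) ->
  (forall t, t <= 0 -> has_deriv y2 t (- (f * shrink q A t * (y0 t + y1 t)))) ->
  (forall t, t <= 0 -> (1 - t) * `|y0 t| <= K) ->
  (forall t, t <= 0 -> (1 - t) * `|y1 t| <= K) ->
  (forall t, t <= 0 -> (1 - t) * `|y2 t| <= K) ->
  exists x, forall t, t <= 0 ->
    [/\ y0 t = x * (axial q A t * shrink q A t),
        y1 t = x * (axial q A t * shrink q A t) &
        y2 t = - (x * (f * shrink q A t ^+ 2))].
Proof.
move=> A0 Aq h0 h1 h2 b0 b1 b2; set a := axial q A; set s := shrink q A.
have A0' := ltW A0; have fq : A ^+ 2 - q ^+ 2 = f ^+ 2 by rewrite Aq; ring.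
have s0 t : t <= 0 -> 0 < s t by exact: shrink_gt0.
have s1 t : t <= 0 -> s t <= 1 by exact: shrink_le1.
have a0 t : t <= 0 -> 0 < a t by exact: axial_gt0.
have hs t : t <= 0 -> has_deriv s t (a t * s t) by exact: has_deriv_shrink.
have ha t : t <= 0 -> has_deriv a t (f ^+ 2 * s t ^+ 2) by rewrite -fq; exact: has_deriv_axial.
have a2 t : t <= 0 -> a t ^+ 2 = q ^+ 2 + f ^+ 2 * s t ^+ 2.
  by move=> t0; rewrite -fq; exact: axial2.
have aA t : t <= 0 -> a t <= A.
  move=> t0; rewrite -(@ler_pXn2r _ 2) ?nnegrE ?(ltW (a0 t t0))// a2// Aq lerD2l.
  by rewrite ler_piMr ?sqr_ge0// expr_le1 ?s1// ltW// s0.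
(* the growing mode y0 - y1 is proportional to 1 / s *)
have y01 t : t <= 0 -> y0 t = y1 t.
  pose z t := (y0 t + - y1 t) * s t.
  have hz u : u <= 0 -> has_deriv z u 0.
    move=> u0; apply: has_deriv_eq (has_derivM (has_derivD (h0 u u0) (has_derivN (h1 u u0))) (hs u u0)) _.
    by rewrite -/a -/s; ring.
  have z0 : z 0 = 0.
    apply: (@linear_bound_eq0 _ (K + K)) => u u0; rewrite -(has_deriv_constant hz u0).
    rewrite /z normrM (gtr0_norm (s0 u u0)) mulrA.
    apply: (@le_trans _ _ ((1 - u) * `|y0 u + - y1 u|)).
      by rewrite ler_piMr ?s1// mulr_ge0//; lra.
    apply: le_trans (lerD (b0 u u0) (b1 u u0)); rewrite -mulrDr ler_wpM2l ?ler_normB//.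
    by lra.
  move=> t0; have := has_deriv_constant hz t0; rewrite z0 /z => /eqP.
  by rewrite mulf_eq0 (gt_eqF (s0 t t0)) orbF subr_eq0 => /eqP.
(* the first integral f s y1 + a y2 vanishes at -oo *)
have y12 t : t <= 0 -> f * s t * y1 t + a t * y2 t = 0.
  pose z t := f * s t * y1 t + a t * y2 t.
  have hz u : u <= 0 -> has_deriv z u 0.
    move=> u0; apply: has_deriv_eq (has_derivD (has_derivM (has_derivZ (c := f) (hs u u0)) (h1 u u0))
      (has_derivM (ha u u0) (h2 u u0))) _.
    by rewrite -/a -/s; ring.
  suff z0 : z 0 = 0 by move=> t0; have := has_deriv_constant hz t0; rewrite z0.
  apply: (@linear_bound_eq0 _ (`|f| * K + A * K)) => u u0.
  rewrite -(has_deriv_constant hz u0) /z.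
  have u1 : 0 <= 1 - u by lra.
  apply: (@le_trans _ _ ((1 - u) * (`|f| * `|y1 u| + A * `|y2 u|))).
    rewrite ler_wpM2l// (le_trans (ler_normD _ _))//.
    rewrite (normrM (f * s u)) (normrM f) (normrM (a u)).
    rewrite (gtr0_norm (s0 u u0)) (gtr0_norm (a0 u u0)) lerD//.
      by rewrite ler_wpM2r// ler_piMr// s1.
    by rewrite ler_wpM2r// aA.
  rewrite mulrDr !(mulrCA (1 - u)) lerD// ler_wpM2l// ?b1// ?b2//.
have y2E t : t <= 0 -> y2 t = - (f * s t * y1 t / a t).
  move=> t0; have an0 := gt_eqF (a0 t t0).
  apply: (@mulfI _ (a t)); first by rewrite an0.
  by rewrite mulrN mulrCA divff ?an0// mulr1; have := y12 t t0; lra.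
pose v t := y1 t * (a t * s t)^-1.
(* v is y1 divided by the explicit solution a s of the equation of order one. *)
have as0 t : t <= 0 -> a t * s t != 0.
  by move=> t0; rewrite gt_eqF// mulr_gt0 ?a0 ?s0.
have hv u : u <= 0 -> has_deriv v u 0.
  move=> u0; apply: has_deriv_eq (has_derivM (h1 u u0) (has_derivV as0 u0 (has_derivM (ha u u0) (hs u u0)))) _.
  rewrite -/a -/s y01// y2E//; field.
  by rewrite !gt_eqF ?a0 ?s0.
exists (v 0) => t t0; rewrite -(has_deriv_constant hv t0) /v y2E// y01//.
split; [field|field|field]; by rewrite !gt_eqF ?a0 ?s0.
Qed.


(** The value (b0, b1, b2, b3) of the tangent vector with coordinates x, where
c = A(t) s, d = f(t) s and s = 1 / den(t) = f(t) / f(0).  Each coordinate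
comes from one of the four copies of the system of [decaying_system].  When f(0) <> 0, the
coordinate vector of x_3 is the derivative of the Nahm flow divided by f(0),
and those of x_0, x_1, x_2 are its images, up to signs, by the three complex
structures. *)
Definition qtuple (c d : R) (p0 p1 p2 : su2 R) (x : 'I_4 -> R) : 'M[R]_(4, 3) :=
  tup [:: (x 2 * d) *: p0 + (x 1 * c) *: p1 + (x 0 * c) *: p2;
          (x 1 * d) *: p0 + (- (x 2 * c)) *: p1 + (x 3 * c) *: p2;
          (x 3 * d) *: p0 + (x 0 * c) *: p1 + (- (x 1 * c)) *: p2;
          (- (x 0 * d)) *: p0 + (x 3 * c) *: p1 + (x 2 * c) *: p2].

(** Exponential decay and decay like a power of 1 + |t| greater than 1 are both
weakened to decay like 1 / (1 + |t|). *)
Lemma tangent_decay tau (B : R -> 'M[R]_3) b : kronheimer_tangent tau B b ->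
  exists db K, linearized_nahm B b db /\
    forall t j, t <= 0 -> (1 - t) * su2_norm (row j (b t)) <= K.
Proof.
move=> [_ [db lb]]; have nt (t : R) : t <= 0 -> 1 - t = 1 + `|t|.
  by move=> t0; rewrite ler0_norm.
case: ifP => _ [eta eta0 [C hC]]; exists db.
  exists C; split=> // t j t0; have [h _] := hC t j t0; apply: le_trans h.
  rewrite nt// ler_wpM2r ?sqrtr_ge0// -[leLHS]powRr1 ?addr_ge0//.
  by rewrite ler_powR// ?lerDl// ltW.
exists (C / Num.min 1 eta); split=> // t j t0.
have m0 : 0 < Num.min 1 eta by rewrite lt_min ltr01.
have [h _] := hC t j t0; rewrite ler_pdivlMr// mulrC mulrA.
apply: le_trans h; rewrite nt// ler_wpM2r ?sqrtr_ge0//.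
apply: le_trans (expR_ge1Dx _); rewrite mulrDr mulr1 lerD ?ge_min ?lexx//.
by rewrite ler_wpM2r// ge_min lexx orbT.
Qed.

Lemma norm_inner_le (x p : su2 R) : inner p p = 1 -> `|inner x p| <= su2_norm x.
Proof.
move=> p1; rewrite -(@ler_pXn2r _ 2) ?nnegrE ?sqrtr_ge0//.
by rewrite real_normK ?num_real// sqr_sqrtr ?inner_ge0// (le_trans (inner_CS _ _))// p1 mulr1.
Qed.

Lemma inner_bracket_swap (x y z : su2 R) :
  inner (bracket x y) z = inner y (bracket z x).
Proof. by rewrite !(mxopE, coordE); ring. Qed.

Lemma linearized_solution q A f p0 p1 p2 tau b : antiframe p0 p1 p2 ->
  0 < A -> A ^+ 2 = q ^+ 2 + f ^+ 2 ->
  kronheimer_tangent tau (nahm_flow q (leaf_point A f p0 p1 p2)) b ->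
  exists x, forall t, t <= 0 -> b t = qtuple
    (axial q A t * shrink q A t) (f * shrink q A t ^+ 2) p0 p1 p2 x.
Proof.
move=> F A0 Aq /tangent_decay [db [K [lb bK]]].
pose y j p t := inner (row j (b t)) p.
have yK j p t : inner p p = 1 -> t <= 0 -> (1 - t) * `|y j p t| <= K.
  move=> p1' t0; apply: le_trans (bK t j t0).
  by rewrite ler_wpM2l ?norm_inner_le//; lra.
have hy j p t : t <= 0 -> has_deriv (y j p) t (inner (row j (db t)) p).
  move=> t0; have [hb _] := lb t t0.
  apply: has_deriv_eq (has_deriv_inner (half_derive_row (i := j) hb) (half_derive_cst p t)) _.
  by rewrite inner0r addr0.
pose a := axial q A; pose s := shrink q A.
have dbE t : t <= 0 -> let B1 := (s t * f) *: p2 in let B2 := a t *: p0 in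
    let B3 := (s t * f) *: p1 in
    [/\ row 0 (db t) = - (bracket B1 (row 1 (b t)) + bracket B2 (row 2 (b t)) +
          bracket B3 (row 3 (b t))),
        row 1 (db t) = bracket B1 (row 0 (b t)) - bracket B2 (row 3 (b t)) +
          bracket B3 (row 2 (b t)),
        row 2 (db t) = bracket B1 (row 3 (b t)) + bracket B2 (row 0 (b t)) -
          bracket B3 (row 1 (b t)) &
        row 3 (db t) = - bracket B1 (row 2 (b t)) + bracket B2 (row 1 (b t)) +
          bracket B3 (row 0 (b t))].
  move=> t0; have [_ ] := lb t t0; rewrite nahm_flowE// !row_tup /= -/a -/s.
  move=> [e0 e1 e2 e3]; split; apply/eqP; rewrite -subr_eq0; apply/eqP;
    [rewrite -[RHS]e0|rewrite -[RHS]e1|rewrite -[RHS]e2|rewrite -[RHS]e3];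
    by apply/rowP => k; rewrite !mxopE; ring.
pose sys := (innerDl, innerNl, bracketZl, innerZl, inner_bracket_swap,
  bracketZr, innerZr, bracketNl, bracketNr,
  antiframe_tables F, innerNr, inner0r, bracketxx).
(* The components of b along the basis, with signs, in four triples that
   satisfy the system of [decaying_system]. *)
have solve j0 v0 j1 v1 j2 v2 : inner v0 v0 = 1 -> inner v1 v1 = 1 ->
    inner v2 v2 = 1 -> (forall t, t <= 0 ->
    [/\ inner (row j0 (db t)) v0 = a t * y j1 v1 t - f * s t * y j2 v2 t,
        inner (row j1 (db t)) v1 = a t * y j0 v0 t - f * s t * y j2 v2 t &
        inner (row j2 (db t)) v2 = - (f * s t * (y j0 v0 t + y j1 v1 t))]) ->
    exists x, forall t, t <= 0 -> [/\ y j0 v0 t = x * (a t * s t),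
      y j1 v1 t = x * (a t * s t) & y j2 v2 t = - (x * (f * s t ^+ 2))].
  move=> n0 n1 n2 e; apply: (@decaying_system q A f K) => // t t0.
  - by have [<- _ _] := e t t0; exact: hy.
  - by have [_ <- _] := e t t0; exact: hy.
  - by have [_ _ <-] := e t t0; exact: hy.
  - exact: yK.
  - exact: yK.
  - exact: yK.
have [|||t t0|x0 h0] := solve 0 p2 2 p1 3 p0; 
  rewrite ?(innerNl, innerNr, opprK, af00 F, af11 F, af22 F)//.
  have [-> _ -> ->] := dbE t t0.
  by split; rewrite /y !sys; ring.
have [|||t t0|x1 h1] := solve 0 p1 2 (- p2) 1 (- p0); 
  rewrite ?(innerNl, innerNr, opprK, af00 F, af11 F, af22 F)//.
  have [-> -> -> _] := dbE t t0.
  by split; rewrite /y !sys; ring.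
have [|||t t0|x2 h2] := solve 3 p2 1 (- p1) 0 (- p0); 
  rewrite ?(innerNl, innerNr, opprK, af00 F, af11 F, af22 F)//.
  have [-> -> _ ->] := dbE t t0.
  by split; rewrite /y !sys; ring.
have [|||t t0|x3 h3] := solve 1 p2 3 p1 2 (- p0); 
  rewrite ?(innerNl, innerNr, opprK, af00 F, af11 F, af22 F)//.
  have [_ -> -> ->] := dbE t t0.
  by split; rewrite /y !sys; ring.
exists (fun i => nth 0 [:: x0; x1; x2; x3] i) => t t0.
have [a0 b0 c0] := h0 t t0; have [a1 b1 c1] := h1 t t0.
have [a2 b2 c2] := h2 t t0; have [a3 b3 c3] := h3 t t0.
move: a0 b0 c0 a1 b1 c1 a2 b2 c2 a3 b3 c3; rewrite /y !innerNr.
move=> a0 b0 c0 a1 b1 c1 a2 b2 c2 a3 b3 c3.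
have oppE (u w : R) : - u = w -> u = - w by move=> <-; rewrite opprK.
move: b1 c1 b2 c2 c3 => /oppE b1 /oppE c1 /oppE b2 /oppE c2 /oppE c3.
apply/row_matrixP => i; rewrite row_tup; elim/ord4P: i => /=;
  apply: (antiframe_ext F); rewrite !innerDl !innerZl !(antiframe_tables F) -/a -/s;
  rewrite ?(a0, b0, c0, a1, b1, c1, a2, b2, c2, a3, b3, c3) !(mulr0, mulr1, addr0, add0r)
    ?opprK ?mulNr //.
Qed.

End linearized.

Section kronheimer_metric.
Context {R : realType}.
Local Notation mu := (@lebesgue_measure R).

Lemma inner_qtuple (p0 p1 p2 : su2 R) c d (x y : 'I_4 -> R) j : antiframe p0 p1 p2 ->
  inner (row j (qtuple c d p0 p1 p2 x)) (row j (qtuple c d p0 p1 p2 y)) =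
  nth 0 [:: x 0 * y 0 + x 1 * y 1; x 2 * y 2 + x 3 * y 3;
            x 0 * y 0 + x 1 * y 1; x 2 * y 2 + x 3 * y 3] j * c ^+ 2 +
  nth 0 [:: x 2 * y 2; x 1 * y 1; x 3 * y 3; x 0 * y 0] j * d ^+ 2.
Proof.
move=> F; rewrite row_tup row_tup; elim/ord4P: j => /=;
  by rewrite !(innerDl, innerDr) !(innerZl, innerZr) !(antiframe_tables F); ring.
Qed.

(** The fundamental theorem of calculus on the negative half-line, by reflection
of the one on the positive half-line. *)
Lemma ge0_FTC2Ny (g G : R -> R) (l : R) :
  (forall t, t <= 0 -> 0 <= g t) -> {within `]-oo, 0], continuous g} ->
  (forall t, t <= 0 -> has_deriv G t (g t)) -> G t @[t --> -oo] --> l ->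
  (\int[mu]_(t in `]-oo, 0%R]) (g t)%:E = (G 0 - l)%:E)%E.
Proof.
move=> g0 cg hG Gl.
have [cgi cg0] := (continuous_within_itvNycP 0 g).1 cg.
have [cGi cG0] := (continuous_within_itvNycP 0 G).1 (has_deriv_within_continuous hG).
have reflect0 (f : R -> R) : f x @[x --> 0^'-] --> f 0 ->
    f (- x) @[x --> 0^'+] --> f (- 0).
  move=> f0; apply/cvg_at_rightNP; rewrite !oppr0.
  by rewrite (_ : _ \o _ = f)//; apply/funext => x /=; rewrite opprK.
rewrite -[X in `]-oo, X]]oppr0 ge0_integration_by_substitutionNy ?oppr0//; last first.
  by move=> x; rewrite in_itv /= => /ltW/g0.
have hF (x : R) : 0 < x -> is_derive x (1 : R) (fun x => - G (- x)) (g (- x)).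
  move=> x0; have xN : - x < 0 by rewrite oppr_lt0.
  have dG := has_deriv_is_derive xN (hG _ (ltW xN)).
  have dN : is_derive x (1 : R) (-%R : R -> R) (- 1) by exact: is_deriveNid.
  have := is_deriveN (is_derive1_comp dG dN).
  by rewrite mulrN1 opprK.
rewrite (@ge0_continuous_FTC2y _ _ (fun x => - G (- x)) 0 (- l))//=.
- by rewrite oppr0 -EFinB opprK addrC.
- by move=> x x0; rewrite g0// oppr_le0.
- apply/continuous_within_itvcyP; split.
    move=> x; rewrite in_itv/= andbT => x0.
    apply: (@continuous_comp _ _ _ -%R g); first exact: opp_continuous.
    by apply: cgi; rewrite in_itv/= oppr_lt0.
  exact: reflect0 cg0.
- apply: cvgN; apply: cvg_comp Gl.
  exact: ((@cvgNrNy _ _ _ _ (@id R)).2 cvg_id).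
- by move=> x x0; have [] := hF x x0.
- by apply: cvgN; exact: reflect0 cG0.
- by move=> x; rewrite in_itv/= andbT => x0; rewrite derive1E; have [_ ->] := hF x x0.
Qed.

(** 2 c^2 + d^2 is the derivative of A(t) s(t)^2, which tends to 0 at -oo and
equals A at 0.  Each term is integrable, as it is dominated by the sum. *)
Lemma Rintegral_shrink (q A f : R) : 0 <= q -> 0 < A -> A ^+ 2 = q ^+ 2 + f ^+ 2 ->
  let c t := axial q A t * shrink q A t in let d t := f * shrink q A t ^+ 2 in
  [/\ mu.-integrable `]-oo, 0] (EFin \o (fun t => c t ^+ 2)),
      mu.-integrable `]-oo, 0] (EFin \o (fun t => d t ^+ 2)) &
      2 * (\int[mu]_(t in `]-oo, 0%R]) (c t ^+ 2)) +
      \int[mu]_(t in `]-oo, 0%R]) (d t ^+ 2) = A].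
Proof.
move=> q0 A0 Aq c d; have fq : A ^+ 2 - q ^+ 2 = f ^+ 2 by rewrite Aq; ring.
have hs t : t <= 0 -> has_deriv (shrink q A) t (axial q A t * shrink q A t).
  by apply: has_deriv_shrink; exact: ltW.
have ha t : t <= 0 -> has_deriv (axial q A) t (f ^+ 2 * shrink q A t ^+ 2).
  by rewrite -fq; apply: has_deriv_axial; exact: ltW.
have hc t (t0 : t <= 0) := has_derivM (ha t t0) (hs t t0).
have hds t (t0 : t <= 0) := has_derivZ (c := f) (has_derivM (hs t t0) (hs t t0)).
have cc : {within `]-oo, 0], continuous (fun t => c t ^+ 2)}.
  apply: has_deriv_within_continuous => t t0.
  by apply: has_deriv_congr (has_derivM (hc t t0) (hc t t0)) => // s; rewrite expr2.
have cd : {within `]-oo, 0], continuous (fun t => d t ^+ 2)}.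
  apply: has_deriv_within_continuous => t t0.
  by apply: has_deriv_congr (has_derivM (hds t t0) (hds t t0)) => // s; rewrite /d !expr2.
pose g t := 2 * c t ^+ 2 + d t ^+ 2.
have cg : {within `]-oo, 0], continuous g}.
  move=> t; apply: cvgD; last exact: cd.
  by apply: cvgM; [exact: cvg_cst|exact: cc].
have g0 t : 0 <= g t.
  by rewrite /g; have := sqr_ge0 (c t); have := sqr_ge0 (d t); lra.
have Ig : (\int[mu]_(t in `]-oo, 0%R]) (g t)%:E = A%:E)%E.
  rewrite (@ge0_FTC2Ny g (fun t => axial q A t * (shrink q A t * shrink q A t)) 0)//.
  - by rewrite axial0 shrink0 !mulr1 subr0.
  - move=> t t0; apply: has_deriv_eq (has_derivM (ha t t0) (has_derivM (hs t t0) (hs t t0))) _.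
    by rewrite /g /c /d; ring.
  - rewrite -(mulr0 q) -[X in q * X](mulr0 0); apply: cvgM.
      by apply: cvg_axial => //; rewrite Aq lerDl sqr_ge0.
    by apply: cvgM; exact: cvg_shrink.
have ig : mu.-integrable `]-oo, 0] (EFin \o g).
  apply/integrableP; split; first by apply/measurable_EFinP;
    exact: subspace_continuous_measurable_fun.
  under eq_integral do rewrite /= ger0_norm//.
  by rewrite Ig ltry.
have le_g (h : R -> R) : {within `]-oo, 0], continuous h} ->
    (forall t, 0 <= h t <= g t) -> mu.-integrable `]-oo, 0] (EFin \o h).
  move=> ch hg; apply: le_integrable ig => //; first by apply/measurable_EFinP;
    exact: subspace_continuous_measurable_fun.
  by move=> t _; have /andP[h0 hle] := hg t; rewrite /= lee_fin !ger0_norm.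
have ic : mu.-integrable `]-oo, 0] (EFin \o (fun t => c t ^+ 2)).
  apply: le_g => // t; rewrite sqr_ge0 /g /=.
  by have := sqr_ge0 (c t); have := sqr_ge0 (d t); lra.
have id : mu.-integrable `]-oo, 0] (EFin \o (fun t => d t ^+ 2)).
  apply: le_g => // t; rewrite sqr_ge0 /g /=.
  by have := sqr_ge0 (c t); have := sqr_ge0 (d t); lra.
split=> //; rewrite -RintegralZl// -RintegralD//.
  by rewrite /Rintegral Ig.
by apply: (integrableZl _ 2 ic).
Qed.

Lemma kronheimer_metricE q A f p0 p1 p2 (x y : 'I_4 -> R) b c :
  0 <= q -> antiframe p0 p1 p2 ->
  0 < A -> A ^+ 2 = q ^+ 2 + f ^+ 2 ->
  (forall t, t <= 0 -> b t = qtuple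
    (axial q A t * shrink q A t) (f * shrink q A t ^+ 2) p0 p1 p2 x) ->
  (forall t, t <= 0 -> c t = qtuple
    (axial q A t * shrink q A t) (f * shrink q A t ^+ 2) p0 p1 p2 y) ->
  kronheimer_metric b c = A * (x 0 * y 0 + x 1 * y 1 + x 2 * y 2 + x 3 * y 3).
Proof.
move=> q0 F A0 Aq bE cE.
have [ic id E] := Rintegral_shrink q0 A0 Aq.
have -> : kronheimer_metric b c = \sum_(j < 4)
   (nth 0 [:: x 0 * y 0 + x 1 * y 1; x 2 * y 2 + x 3 * y 3;
            x 0 * y 0 + x 1 * y 1; x 2 * y 2 + x 3 * y 3] j *
    (\int[mu]_(t in `]-oo, 0]) (axial q A t * shrink q A t) ^+ 2) +
  nth 0 [:: x 2 * y 2; x 1 * y 1; x 3 * y 3; x 0 * y 0] j *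
    (\int[mu]_(t in `]-oo, 0]) (f * shrink q A t ^+ 2) ^+ 2)).
  apply: eq_bigr => j _; rewrite -!RintegralZl//.
  rewrite -RintegralD//; last 2 first.
  - exact: (integrableZl _ _ ic).
  - exact: (integrableZl _ _ id).
  apply: eq_Rintegral => t; rewrite inE /= in_itv /= => t0.
  by rewrite bE// cE// inner_qtuple.
by rewrite sum4E /= -[X in _ = X * _]E; ring.
Qed.

End kronheimer_metric.

(** * The tensors of the leaf in the coordinates of the moving frame *)

Section leaf_tensors.
Context {R : realType}.
Implicit Types (a u v : 'M[R]_3) (M : 'M[R]_(4, 3)) (x y : 'I_4 -> R).

(** The differential of B |-> (B2, B3, B1)(0), as a function of b(0). *)
Definition leaf_tangent M : 'M[R]_3 := tup [:: row 2 M; row 3 M; row 1 M].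

(** Recovers b(0) from its image u in the tangent space of the leaf at a:
b_0 = <u2, a3> a1 / |a1|^2 - [a1, u1] / |a1|. *)
Definition lift4 a u : 'M[R]_(4, 3) :=
  let a1 := row 0 a in
  tup [:: (inner (row 1 u) (row 2 a) / inner a1 a1) *: a1 -
            (su2_norm a1)^-1 *: bracket a1 (row 0 u);
          row 2 u; row 0 u; row 1 u].


Lemma leaf_tangentE c d p0 p1 p2 x : leaf_tangent (qtuple c d p0 p1 p2 x) =
  tup [:: (x 3 * d) *: p0 + (x 0 * c) *: p1 + (- (x 1 * c)) *: p2;
          (- (x 0 * d)) *: p0 + (x 3 * c) *: p1 + (x 2 * c) *: p2;
          (x 1 * d) *: p0 + (- (x 2 * c)) *: p1 + (x 3 * c) *: p2].
Proof. by rewrite /leaf_tangent !row_tup. Qed.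

Lemma eq_qtuple c d p0 p1 p2 x y : x =1 y ->
  qtuple c d p0 p1 p2 x = qtuple c d p0 p1 p2 y.
Proof. by move=> /funext ->. Qed.

(** The coefficient |a1| / (2 |a1|^2 + |a2|^2) turns the pointwise inner product
of b(0) and c(0) into the integral over the half-line: the integrand has
the shape of [Rintegral_shrink]. *)
Definition lift_metric a u v : R :=
  su2_norm (row 0 a) *
  (\sum_(j < 4) inner (row j (lift4 a u)) (row j (lift4 a v))) /
  (2 * inner (row 0 a) (row 0 a) + inner (row 1 a) (row 1 a)).

(** The index is shifted because I, J, K on the leaf correspond to J~, K~, I~. *)
Definition lift_cplx (k : 'I_3) a u : 'M[R]_3 :=
  leaf_tangent (kronheimer_cplx (k + 1) (fun=> lift4 a u) 0).

Section at_point.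
Context (A f : R) (p0 p1 p2 : su2 R) (F : antiframe p0 p1 p2) (A0 : 0 < A).
Let a := leaf_point A f p0 p1 p2.
Let tvec x := leaf_tangent (qtuple A f p0 p1 p2 x).

Lemma lift4_leaf_tangent x : lift4 a (tvec x) = qtuple A f p0 p1 p2 x.
Proof.
have n0 := su2_norm_leaf_point f F A0; rewrite row_tup /= in n0.
apply/row_matrixP => i; rewrite /tvec leaf_tangentE /lift4 !row_tup /=.
elim/ord4P: i => //=; rewrite n0.
apply: (antiframe_ext F);
  rewrite !(innerDl, innerDr, innerZl, innerZr, innerNl, innerNr,
    bracketDr, bracketZl, bracketZr, bracketNl, bracketNr)
    !(antiframe_tables F) ?(bracketxx, inner0l, innerNl) ?(antiframe_tables F);
  by field; rewrite gt_eqF.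
Qed.

Lemma lift_metric_leaf_tangent x y : lift_metric a (tvec x) (tvec y) =
  A * (x 0 * y 0 + x 1 * y 1 + x 2 * y 2 + x 3 * y 3).
Proof.
rewrite /lift_metric !lift4_leaf_tangent sum4E !(inner_qtuple _ _ _ _ _ F) /=.
rewrite (su2_norm_leaf_point _ F)// !row_tup /= !(innerZl, innerZr).
rewrite !(antiframe_tables F); field.
by rewrite gt_eqF// -!expr2 ltr_pwDl ?sqr_ge0// mulr_gt0// exprn_gt0.
Qed.

Lemma leaf_tangent_inj x y : tvec x = tvec y -> x =1 y.
Proof.
move=> /(congr1 (lift4 a)); rewrite !lift4_leaf_tangent => e.
have A00 : A != 0 by rewrite gt_eqF.
have h p q0 q1 q2 : q0 *: p0 + q1 *: p1 + q2 *: p2 = p -> q2 = inner p p2.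
  by move=> <-; rewrite !innerDl !innerZl !(antiframe_tables F); ring.
have e0 := congr1 (row 0) e; have e1 := congr1 (row 1) e.
have e2 := congr1 (row 2) e; have e3 := congr1 (row 3) e.
move: e0 e1 e2 e3; rewrite !row_tup /= => /h e0 /h e1 /h e2 /h e3.
move: e0 e1 e2 e3.
rewrite !innerDl !innerZl !(antiframe_tables F) !mulr0 !add0r !mulr1.
move=> /(mulIf A00) e0 /(mulIf A00) e1 /oppr_inj/(mulIf A00) e2 /(mulIf A00) e3.
by elim/ord4P.
Qed.

(** Each V_i is a coordinate vector times f, up to sign; this is why the frame
degenerates exactly where f = 0. *)
Lemma frame_combination (c : 'I_4 -> R) :
  \sum_(i < 4) c i *: (frame a)`_i =
  tvec (fun i => nth 0 [:: f * c 3; f * c 2; f * c 1; - (f * c 0)] i).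
Proof.
rewrite sum4E /tvec leaf_tangentE /= !row_tup /= !(bracketZl, bracketZr).
rewrite !(antiframe_tables F) !(scalerN, scalerA).
by apply: mx3P; rewrite !rowDE !rowZE !row_tup /=;
  apply/rowP => k; rewrite !mxopE; ring.
Qed.

Context (f0 : f != 0).

Lemma frame_free : free (frame a).
Proof.
apply/freeP => k; rewrite frame_combination.
have -> : (0 : 'M[R]_3) = tvec (fun=> 0).
  rewrite /tvec leaf_tangentE; apply: mx3P; rewrite row_tup linear0 /=;
    by rewrite !mul0r ?oppr0 !scale0r !addr0.
move=> /leaf_tangent_inj h; have h0 := h 0; have h1 := h 1; have h2 := h 2; have h3 := h 3.
move: h0 h1 h2 h3 => /= /eqP h0 /eqP h1 /eqP h2 /eqP h3.
move: h0 h1 h2 h3; rewrite oppr_eq0 !mulf_eq0 (negPf f0) /=.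
by move=> /eqP h0 /eqP h1 /eqP h2 /eqP h3; elim/ord4P.
Qed.

Lemma coord_frame x i : coord (frame a) i (tvec x) =
  nth 0 [:: - (x 3 / f); x 2 / f; x 1 / f; x 0 / f] i.
Proof.
pose k (i : 'I_4) := nth 0 [:: - (x 3 / f); x 2 / f; x 1 / f; x 0 / f] i.
have -> : tvec x = \sum_(i < 4) k i *: (frame a)`_i.
  rewrite frame_combination; congr leaf_tangent; apply: eq_qtuple.
  by elim/ord4P; rewrite /k /=; field.
by rewrite coord_sum_free// frame_free.
Qed.

(** The factors f^-1 of the coordinates cancel against - Phi(a) = A f^2. *)
Lemma leaf_metric_leaf_tangent x y : leaf_metric a (tvec x) (tvec y) =
  lift_metric a (tvec x) (tvec y).
Proof.
rewrite lift_metric_leaf_tangent /leaf_metric (Phi_leaf_point _ _ F) sum4E !sum4E.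
by rewrite !coord_frame /=; field.
Qed.

Lemma leaf_cplx_leaf_tangent k x : leaf_cplx k a (tvec x) = lift_cplx k a (tvec x).
Proof.
rewrite /leaf_cplx /lift_cplx lift4_leaf_tangent sum4E !coord_frame.
have k1 : [/\ (0 : 'I_3) + 1 = 1, (1 : 'I_3) + 1 = 2 & (2 : 'I_3) + 1 = 0].
  by split; apply/val_inj.
have [k01 k11 k21] := k1.
elim/ord3P: k; rewrite /kronheimer_cplx ?k01 ?k11 ?k21 !row_tup /=.
all: apply: mx3P; rewrite !(rowDE, rowZE, rowNE, row_tup) /=
  !(bracketZl, bracketZr) !(antiframe_tables F);
  by apply/rowP => j; rewrite !mxopE; field.
Qed.

End at_point.

Lemma leafE q (a : 'M[R]_3) : leaf (q ^+ 2) 0 a <-> closed_leaf q a /\ Phi a < 0.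
Proof.
split=> [[orth n0 n1 Pa]|[La Pa]]; last by have [] := (closed_leafP q a).1 La.
split=> //; apply/closed_leafP; split=> //; first exact: ltW.
by apply: contraTneq Pa => a0; rewrite /Phi a0 inner0l ltxx.
Qed.

Lemma leaf_pointP q (a : 'M[R]_3) : leaf (q ^+ 2) 0 a -> exists A f p0 p1 p2,
  [/\ antiframe p0 p1 p2, 0 < A, A ^+ 2 = q ^+ 2 + f ^+ 2, f != 0 &
      a = leaf_point A f p0 p1 p2].
Proof.
move=> /leafE [[A [f [p0 [p1 [p2 [F A0 Aq ->]]]]]] Pa].
exists A, f, p0, p1, p2; split=> //; apply: contraTneq Pa => ->.
by rewrite (Phi_leaf_point _ _ F) expr0n mulr0 oppr0 ltxx.
Qed.

Lemma leaf_point_leaf q A f (p0 p1 p2 : su2 R) : antiframe p0 p1 p2 -> 0 < A ->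
  A ^+ 2 = q ^+ 2 + f ^+ 2 -> f != 0 -> leaf (q ^+ 2) 0 (leaf_point A f p0 p1 p2).
Proof.
move=> F A0 Aq f0; apply/leafE; split; first by exists A, f, p0, p1, p2.
by rewrite (Phi_leaf_point _ _ F) oppr_lt0 mulr_gt0// lt0r sqrf_eq0 f0 sqr_ge0.
Qed.

Lemma leaf0E : leaf 0 0 = closed_leaf (0 : R).
Proof.
have z : (0 : R) ^+ 2 = 0 by rewrite expr0n.
apply/seteqP; split=> [a La|a [A [f [p0 [p1 [p2 [F A0 Aq ->]]]]]]].
  by have := (leafE 0 a).1; rewrite z => /(_ La)[].
have := leaf_point_leaf F A0 Aq; rewrite z; apply.
apply: contraTneq A0 => f0; have : A ^+ 2 = 0 by rewrite Aq f0 z addr0.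
by move=> /eqP; rewrite sqrf_eq0 => /eqP ->; rewrite ltxx.
Qed.

Lemma is_derive_mxP m n (M : R^o -> 'M[R]_(m, n)) (t : R^o) dM :
  is_derive t (1 : R^o) M dM <->
  forall i j, is_derive t (1 : R^o) (fun s => M s i j : R^o) (dM i j).
Proof.
split=> [[dv <-] i j|h].
  split; first exact: ((derivable_mxP _ _ _).1 dv).
  by rewrite derive_mx// mxE.
have dv : derivable M t (1 : R^o) by apply/derivable_mxP => i j; have [] := h i j.
split=> //; rewrite derive_mx//; apply/matrixP => i j; rewrite mxE.
by have [] := h i j.
Qed.

Lemma is_derive_inner (f g : R^o -> su2 R) (t : R^o) df dg :
  is_derive t (1 : R^o) f df -> is_derive t (1 : R^o) g dg ->
  is_derive t (1 : R^o) (fun s => inner (f s) (g s) : R^o)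
    (inner df (g t) + inner (f t) dg).
Proof.
move=> /is_derive_mxP hf /is_derive_mxP hg.
have h i := is_deriveM (hf 0 i) (hg 0 i).
have k := is_deriveD (is_deriveD (h 0) (h 1)) (h 2).
have -> : (fun s => inner (f s) (g s) : R^o) =
    (fun s => f s 0 0 : R^o) * (fun s => g s 0 0 : R^o) +
    (fun s => f s 0 1 : R^o) * (fun s => g s 0 1 : R^o) +
    (fun s => f s 0 2 : R^o) * (fun s => g s 0 2 : R^o).
  by apply/funext => s; rewrite innerE.
by apply: is_derive_eq; rewrite !innerE /GRing.scale /=; ring.
Qed.

(** Differentiating the five equations of the leaf along a curve gives five
independent linear conditions on u when f <> 0, which leaves the four
coordinates x. *)
Lemma tangent_leaf q A f (p0 p1 p2 : su2 R) u : antiframe p0 p1 p2 -> 0 < A ->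
  A ^+ 2 = q ^+ 2 + f ^+ 2 -> f != 0 ->
  tangent_sub (leaf (q ^+ 2) 0) (leaf_point A f p0 p1 p2) u ->
  exists x, u = leaf_tangent (qtuple A f p0 p1 p2 x).
Proof.
move=> F A0 Aq f0 [U [gamma [oU U0 [gL gS] g0 gu]]].
have dgram i j : is_derive (0 : R^o) (1 : R^o)
    (fun s => inner (row i (gamma s)) (row j (gamma s)) : R^o)
    (inner (row i u) (row j (gamma 0)) + inner (row i (gamma 0)) (row j u)).
  by apply: is_derive_inner; apply/is_derive_mxP => k l; rewrite mxE;
    under [X in is_derive _ _ X]funext do rewrite mxE;
    exact: ((is_derive_mxP _ _ _).1 gu).
have near0 : \forall s \near (0 : R^o), U s by exact: open_nbhs_nbhs.
have orth i j : i != j ->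
    inner (row i u) (row j (gamma 0)) + inner (row i (gamma 0)) (row j u) = 0.
  move=> ij; have [_ <-] := dgram i j.
  rewrite (@near_eq_derive _ _ _ _ (cst 0)) ?derive_cst//.
  near=> s; have Us : U s by near: s.
  by have [orth _ _ _] := gL s Us; exact: orth.
have eqn i j c : (forall s, U s -> inner (row i (gamma s)) (row i (gamma s)) -
      inner (row j (gamma s)) (row j (gamma s)) = c) ->
    inner (row i u) (row i (gamma 0)) = inner (row j u) (row j (gamma 0)).
  move=> ijc; have [_ e] := is_deriveB (dgram i i) (dgram j j).
  have : 2 * (inner (row i u) (row i (gamma 0)) - inner (row j u) (row j (gamma 0))) = 0.
    rewrite (innerC _ (row i u)) (innerC _ (row j u)) in e.
    transitivity ('D_1 (fun s => inner (row i (gamma s)) (row i (gamma s)) -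
      inner (row j (gamma s)) (row j (gamma s)) : R^o) (0 : R^o)).
      by rewrite e; ring.
    rewrite (@near_eq_derive _ _ _ _ (cst c)) ?derive_cst//.
    by near=> s; rewrite ijc//; near: s.
  by lra.
have o01 := orth 0 1 isT; have o02 := orth 0 2 isT; have o12 := orth 1 2 isT.
have e01 : inner (row 0 u) (row 0 (gamma 0)) = inner (row 1 u) (row 1 (gamma 0)).
  by apply: (eqn _ _ (q ^+ 2)) => s Us; have [_ ? _ _] := gL s Us.
have e12 : inner (row 1 u) (row 1 (gamma 0)) = inner (row 2 u) (row 2 (gamma 0)).
  by apply: (eqn _ _ 0) => s Us; have [_ _ ? _] := gL s Us.
move: o01 o02 o12 e01 e12; rewrite g0 !row_tup /= !(innerZl, innerZr).
rewrite !(innerC _ (row _ u)) => o01 o02 o12 e01 e12.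
have An0 : A != 0 by rewrite gt_eqF.
have e12' := mulfI f0 e12.
have o12' : inner (row 1 u) p2 + inner (row 2 u) p1 = 0.
  by apply: (mulfI f0); rewrite mulr0 mulrDr.
(* The coordinates are read on the components of u1 and u2 along p1 and p2. *)
have divA z : exists k, z = A * k by exists (z / A); rewrite mulrC divfK.
have [k0 E0] := divA (inner (row 0 u) p1).
have [k1 E1] := divA (- inner (row 0 u) p2).
have [k2 E2] := divA (inner (row 1 u) p2).
have [k3 E3] := divA (inner (row 1 u) p1).
exists (fun i => nth 0 [:: k0; k1; k2; k3] i).
rewrite leaf_tangentE /= ; apply: mx3P; rewrite row_tup /=; apply: (antiframe_ext F);
  rewrite !(innerDl, innerNl, innerZl) !(antiframe_tables F) ?mulr0 ?mulr1
    ?addr0 ?add0r; apply: (mulfI An0); nra.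
Unshelve. all: by end_near. Qed.

End leaf_tensors.

(** * Smooth dependence and derivatives of curves *)

Section Ck_vectors.
Context {R : realType} (V : normedModType R) (U : set V) (oU : open U) (k : nat).
Implicit Types (f g : V -> su2 R) (c d : V -> R^o).

Lemma Ck_scale c f : Ck k U c -> Ck k U f -> Ck k U (fun x => c x *: f x).
Proof.
move=> hc hf; apply: Ck_mx => // i j.
apply: (Ck_ext (f := fun x => c x * f x i j : R^o)) => //.
  by move=> x _; rewrite mxE.
by apply: Ck_mul => //; exact: Ck_entry.
Qed.

Lemma Ck_inner f g : Ck k U f -> Ck k U g -> Ck k U (fun x => inner (f x) (g x) : R^o).
Proof.
move=> hf hg; apply: (Ck_ext (f := fun x => f x 0 0 * g x 0 0 + f x 0 1 * g x 0 1
  + f x 0 2 * g x 0 2 : R^o)) => //.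
  by move=> x _; rewrite innerE.
by apply: Ck_add => //; [apply: Ck_add => //|]; apply: Ck_mul => //; exact: Ck_entry.
Qed.

Lemma Ck_bracket f g : Ck k U f -> Ck k U g -> Ck k U (fun x => bracket (f x) (g x)).
Proof.
move=> hf hg; apply: Ck_mx => // i j; rewrite (ord1 i).
apply: (Ck_ext (f := fun x => f x 0 (j + 1) * g x 0 (j + 2) +
  - (f x 0 (j + 2) * g x 0 (j + 1)) : R^o)) => //.
  by move=> x _; rewrite mxE.
by apply: Ck_add => //; [|apply: Ck_opp => //]; apply: Ck_mul => //; exact: Ck_entry.
Qed.

Lemma Ck_vopp f : Ck k U f -> Ck k U (fun x => - f x).
Proof.
move=> hf; apply: Ck_mx => // i j.
apply: (Ck_ext (f := fun x => - f x i j : R^o)) => //.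
  by move=> x _; rewrite mxE.
by apply: Ck_opp => //; exact: Ck_entry.
Qed.

Lemma Ck_row m (F : V -> 'M[R]_(m, 3)) i : Ck k U F -> Ck k U (fun x => row i (F x)).
Proof.
move=> hF; apply: Ck_mx => // i' j.
apply: (Ck_ext (f := fun x => F x i j : R^o)) => //.
  by move=> x _; rewrite mxE.
exact: Ck_entry.
Qed.

Lemma Ck_tup3 f0 f1 f2 : Ck k U f0 -> Ck k U f1 -> Ck k U f2 ->
  Ck k U (fun x => tup [:: f0 x; f1 x; f2 x] : 'M[R]_3).
Proof.
move=> h0 h1 h2; apply: Ck_mx => // i j.
apply: (Ck_ext (f := fun x => nth 0 [:: f0 x; f1 x; f2 x] i 0 j : R^o)) => //.
  by move=> x _; rewrite tupE.
by move: i; elim/ord3P => /=; exact: Ck_entry.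
Qed.

(** Smoothness of the inverse of the map B |-> a. *)
Lemma Ck_flow q (F : V -> 'M[R]_3) t : (forall x, U x -> closed_leaf q (F x)) ->
  Ck k U F -> Ck k U (fun x => nahm_flow q (F x) t).
Proof.
move=> FL hF.
have n0 x : U x -> 0 < inner (row 0 (F x)) (row 0 (F x)).
  by move=> /FL/closed_leafP[_ _ _ _]; exact: inner_gt0.
have m0 : Num.min t 0 <= 0 by rewrite ge_min lexx orbT.
have hA : Ck k U (fun x => su2_norm (row 0 (F x)) : R^o).
  by apply: Ck_sqrt => //; apply: Ck_inner; exact: Ck_row.
have CD : Ck k U (fun x => (den q (su2_norm (row 0 (F x))) (Num.min t 0))^-1 : R^o).
  apply: Ck_inv => //; first by move=> x Ux; rewrite gt_eqF// den_gt0// sqrtr_ge0.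
  apply: Ck_add => //; first exact: Ck_cst.
  by apply: Ck_opp => //; apply: Ck_mul => //; exact: Ck_cst.
apply: Ck_tup3; apply: Ck_scale => //; try exact: Ck_row.
apply: Ck_mul => //; last first.
  by apply: Ck_inv => // x Ux; rewrite gt_eqF// sqrtr_gt0 n0.
apply: Ck_mul => //; apply: Ck_add => //; last first.
  by apply: Ck_opp => //; exact: Ck_cst.
by apply: Ck_mul => //; exact: Ck_cst.
Qed.

End Ck_vectors.

Section curve.
Context {R : realType}.

Lemma is_derive_scale (c : R^o -> R^o) (f : R^o -> su2 R) (t dc : R^o) df :
  is_derive t (1 : R^o) c dc -> is_derive t (1 : R^o) f df ->
  is_derive t (1 : R^o) (fun s => c s *: f s) (dc *: f t + c t *: df).
Proof.
move=> hc /is_derive_mxP hf; apply/is_derive_mxP => i j.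
have -> : (fun s => (c s *: f s) i j : R^o) = c * (fun s => f s i j : R^o).
  by apply/funext => s; rewrite mxE.
have k := is_deriveM hc (hf i j).
by apply: is_derive_eq; rewrite !mxopE /GRing.scale /=; ring.
Qed.

Lemma is_derive_bracket (f g : R^o -> su2 R) (t : R^o) df dg :
  is_derive t (1 : R^o) f df -> is_derive t (1 : R^o) g dg ->
  is_derive t (1 : R^o) (fun s => bracket (f s) (g s))
    (bracket df (g t) + bracket (f t) dg).
Proof.
move=> /is_derive_mxP hf /is_derive_mxP hg; apply/is_derive_mxP => i j.
rewrite (ord1 i).
have k := is_deriveB (is_deriveM (hf 0 (j + 1)) (hg 0 (j + 2)))
                     (is_deriveM (hf 0 (j + 2)) (hg 0 (j + 1))).
have -> : (fun s => bracket (f s) (g s) 0 j : R^o) =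
    (fun s => f s 0 (j + 1) : R^o) * (fun s => g s 0 (j + 2) : R^o) -
    (fun s => f s 0 (j + 2) : R^o) * (fun s => g s 0 (j + 1) : R^o).
  by apply/funext => s; rewrite mxE.
by apply: is_derive_eq; rewrite addmxE !mxE /GRing.scale /=; ring.
Qed.

Lemma is_derive_inv (c : R^o -> R^o) (t dc : R^o) : c t != 0 ->
  is_derive t (1 : R^o) c dc ->
  is_derive t (1 : R^o) (fun s => (c s)^-1 : R^o) (- (dc / c t ^+ 2)).
Proof.
move=> c0 [cv <-]; split; first exact: derivableV.
by rewrite deriveV// /GRing.scale /=; ring.
Qed.

Lemma is_derive_sqrt (c : R^o -> R^o) (t dc : R^o) : 0 < c t ->
  is_derive t (1 : R^o) c dc ->
  is_derive t (1 : R^o) (fun s => Num.sqrt (c s) : R^o) (dc / (2 * Num.sqrt (c t))).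
Proof.
move=> c0 hc; have := is_derive1_comp (is_derive1_sqrt c0) hc.
by rewrite mulrC.
Qed.

Lemma is_derive_tup3 (f0 f1 f2 : R^o -> su2 R) (t : R^o) d0 d1 d2 :
  is_derive t (1 : R^o) f0 d0 -> is_derive t (1 : R^o) f1 d1 ->
  is_derive t (1 : R^o) f2 d2 ->
  is_derive t (1 : R^o) (fun s => tup [:: f0 s; f1 s; f2 s] : 'M[R]_3)
    (tup [:: d0; d1; d2]).
Proof.
move=> /is_derive_mxP h0 /is_derive_mxP h1 /is_derive_mxP h2.
apply/is_derive_mxP => i j; rewrite tupE.
have -> : (fun s => (tup [:: f0 s; f1 s; f2 s] : 'M[R]_3) i j : R^o) =
    (fun s => nth 0 [:: f0 s; f1 s; f2 s] i 0 j).
  by apply/funext => s; rewrite tupE.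
by move: i; elim/ord3P.
Qed.

End curve.

(** * Curves in the closed leaf *)

Section retraction.
Context {R : realType}.
Implicit Types (q : R) (y z : su2 R).

Lemma is_derive_congr (W : normedModType R) (g h : R^o -> W) (t : R^o) dg dg' :
  g =1 h -> dg = dg' -> is_derive t (1 : R^o) g dg -> is_derive t (1 : R^o) h dg'.
Proof. by move=> /funext -> ->. Qed.

(** For q = 0 this is the Gram determinant of y and z.  In general
[gram (q ^+ 2) y z] = |y|^2 (q^2 + |w|^2), where w is the component of z
orthogonal to y. *)
Definition gram q y z : R := inner y y * (q + inner z z) - inner z y ^+ 2.

(** The closed leaf is a graph over the pairs (unit vector, vector orthogonal to
it), that is, over the tangent bundle of the sphere (without its zero section when
q = 0); here the unit vector is
y / |y|, and the orthogonal vector is the component w of z.  The length of the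
first component is then imposed, and the third one is - [y, w] / |y|. *)
Definition leaf_retraction q y z : 'M[R]_3 :=
  let w := z - (inner z y / inner y y) *: y in
  tup [:: (Num.sqrt (gram (q ^+ 2) y z) / inner y y) *: y; w;
          - ((Num.sqrt (inner y y))^-1 *: bracket y w)].

Lemma leaf_retraction_closed_leaf q y z : 0 < inner y y -> 0 < gram (q ^+ 2) y z ->
  closed_leaf q (leaf_retraction q y z) /\ (0 < gram 0 y z -> Phi (leaf_retraction q y z) < 0).
Proof.
move=> n0 m0; have nn0 : inner y y != 0 by rewrite gt_eqF.
pose w := z - (inner z y / inner y y) *: y.
have yw : inner y w = 0.
  by rewrite innerDr innerNr innerZr (innerC y z); field.
have wy : inner w y = 0 by rewrite innerC.
have ww : inner w w = gram 0 y z / inner y y.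
  rewrite /gram /w !(innerDl, innerDr, innerNl, innerNr, innerZl, innerZr).
  by rewrite (innerC y z); field.
have r0 : 0 < Num.sqrt (inner y y) by rewrite sqrtr_gt0.
have r2 : Num.sqrt (inner y y) ^+ 2 = inner y y by rewrite sqr_sqrtr// ltW.
have s0 : 0 < Num.sqrt (gram (q ^+ 2) y z) by rewrite sqrtr_gt0.
have s2 : Num.sqrt (gram (q ^+ 2) y z) ^+ 2 = gram (q ^+ 2) y z.
  by rewrite sqr_sqrtr// ltW.
set r := Num.sqrt (inner y y) in r0 r2 *.
set s := Num.sqrt (gram (q ^+ 2) y z) in s0 s2 *.
have rn0 : r != 0 by rewrite gt_eqF.
have PhiE : Phi (leaf_retraction q y z) = - (s / r * inner w w).
  rewrite /Phi /leaf_retraction !row_tup /= -/w -/r -/s.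
  rewrite innerZl bracketNr bracketZr innerNr innerZr bracket_bracket innerDr
    innerNr !innerZr yw mulr0 subr0 -r2.
  by field.
split; last first.
  move=> g0; rewrite PhiE oppr_lt0 mulr_gt0 ?divr_gt0// ww divr_gt0//.
apply/closed_leafP; split.
- elim/ord3P; elim/ord3P => //= _; rewrite !row_tup /= -/w -/r -/s;
  rewrite ?(innerNl, innerNr, innerZl, innerZr) ?yw ?wy
    ?inner_bracketx ?inner_bracketx2 ?(innerC (bracket _ _))
    ?inner_bracketx ?inner_bracketx2 ?mulr0 ?oppr0 //.
- rewrite !row_tup /= -/w -/s innerZl innerZr ww.
  transitivity ((s ^+ 2 - gram 0 y z) / inner y y); first by field.
  by rewrite s2 /gram; field.
- rewrite !row_tup /= -/w -/r !(innerNl, innerNr, innerZl, innerZr) opprK.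
  by rewrite inner_bracket yw wy mulr0 subr0 -r2; field.
- by rewrite PhiE oppr_le0 !mulr_ge0 ?inner_ge0// ?invr_ge0 ltW.
- rewrite row_tup /= -/s; apply: contraTneq s0 => h.
  have /eqP := congr1 (inner y) h; rewrite innerZr inner0r mulf_eq0 (negPf nn0) orbF.
  by rewrite mulf_eq0 invr_eq0 (negPf nn0) orbF => /eqP ->; rewrite ltxx.
Qed.

(** Apply the retraction to the line (a1 + s u1, a2 + s u2).  The conditions that
|y|^2 and [gram] are positive hold near s = 0, and so does
Phi < 0 if it holds at s = 0. *)
Lemma tangent_curve q A f (p0 p1 p2 : su2 R) x : antiframe p0 p1 p2 -> 0 < A ->
  A ^+ 2 = q ^+ 2 + f ^+ 2 -> exists (U : set R^o) (gamma : R -> 'M[R]_3),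
  [/\ open U, U 0, (forall s, U s -> closed_leaf q (gamma s) /\
                      (f != 0 -> Phi (gamma s) < 0)) &
      smooth_on U (gamma : R^o -> 'M[R]_3)] /\
  gamma 0 = leaf_point A f p0 p1 p2 /\
  velocity_sub gamma (leaf_tangent (qtuple A f p0 p1 p2 x)).
Proof.
move=> F A0 Aq; set u := leaf_tangent _.
have An0 : A != 0 by rewrite gt_eqF.
pose y (s : R^o) : su2 R := A *: p0 + (s : R) *: row 0 u.
pose z (s : R^o) : su2 R := f *: p1 + (s : R) *: row 1 u.
pose n (s : R^o) : R^o := inner (y s) (y s).
pose m (s : R^o) : R^o := gram (q ^+ 2) (y s) (z s).
(* m' > 0 keeps the curve off the zero section; it is void when f = 0. *)
pose m' (s : R^o) : R^o := gram 0 (y s) (z s) + (f == 0)%:R.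
have y0 : y 0 = A *: p0 by rewrite /y scale0r addr0.
have z0 : z 0 = f *: p1 by rewrite /z scale0r addr0.
have n0 : n 0 = A ^+ 2.
  by rewrite /n y0 innerZl innerZr !(antiframe_tables F); ring.
have zy0 : inner (z 0) (y 0) = 0.
  by rewrite y0 z0 innerZl innerZr !(antiframe_tables F); ring.
have zz0 : inner (z 0) (z 0) = f ^+ 2.
  by rewrite z0 innerZl innerZr !(antiframe_tables F); ring.
have m0 : m 0 = A ^+ 2 ^+ 2.
  by rewrite /m /gram zy0 zz0 -/(n 0) n0 expr0n subr0 -Aq -expr2.
have sq2 : Num.sqrt (A ^+ 2) = A by rewrite sqrtr_sqr gtr0_norm.
have sq4 : Num.sqrt (A ^+ 2 ^+ 2) = A ^+ 2 by rewrite sqrtr_sqr gtr0_norm// exprn_gt0.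
have Ck_line (U : set R^o) (v v' : su2 R) k : open U ->
    Ck k U (fun s : R^o => v + (s : R) *: v').
  move=> oU; apply: Ck_add => //; first exact: Ck_cst.
  by apply: Ck_scale => //; [exact: Ck_id|exact: Ck_cst].
have Cy U k : open U -> Ck k U y by exact: Ck_line.
have Cz U k : open U -> Ck k U z by exact: Ck_line.
have Cn U k : open U -> Ck k U n.
  by move=> oU; apply: Ck_inner => //; [exact: Cy|exact: Cy].
have Cg U k c : open U -> Ck k U (fun s => gram c (y s) (z s) : R^o).
  move=> oU; apply: Ck_add => //; last apply: Ck_opp => //; apply: Ck_mul => //.
  - exact: Cn.
  - apply: Ck_add => //; first exact: Ck_cst.
    by apply: Ck_inner => //; exact: Cz.
  - by apply: Ck_inner => //; [exact: Cz|exact: Cy].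
  - by apply: Ck_inner => //; [exact: Cz|exact: Cy].
have pos_near (g : R^o -> R^o) : Ck 0 setT g -> 0 < g 0 ->
    \forall s \near (0 : R^o), 0 < g s.
  move=> cg g0; have /cvgr_gt : g s @[s --> (0 : R^o)] --> g 0 by exact: cg.
  by apply.
have nr : \forall s \near (0 : R^o), [/\ 0 < n s, 0 < m s & 0 < m' s].
  near=> s; split; near: s; apply: pos_near.
  - exact: Cn openT.
  - by rewrite n0 exprn_gt0.
  - exact: Cg openT.
  - by rewrite m0 !exprn_gt0.
  - apply: Ck_add (Cg _ _ _ openT) _; [exact: openT|exact: Ck_cst openT].
  - rewrite /m' /gram zy0 zz0 -/(n 0) n0 expr0n subr0 add0r.
    have [->|f0] := eqVneq f 0; first by rewrite expr0n mulr0 add0r.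
    rewrite addr0; apply: mulr_gt0; first exact: exprn_gt0.
    by rewrite lt0r sqrf_eq0 f0 sqr_ge0.
move: nr; rewrite /prop_near1 nbhsE => -[U [oU U0] nU].
exists U, (fun s => leaf_retraction q (y s) (z s)); split; [split=> //|split].
- move=> s /nU[n_gt0 m_gt0 m'_gt0].
  have [L P] := leaf_retraction_closed_leaf n_gt0 m_gt0; split=> // f0; apply: P.
  by move: m'_gt0; rewrite /m' (negPf f0) addr0.
- move=> k; have Cw : Ck k U (fun s => z s - (inner (z s) (y s) / inner (y s) (y s)) *: y s).
    apply: Ck_add => //; first exact: Cz.
    apply: Ck_vopp => //; apply: Ck_scale => //; last exact: Cy.
    apply: Ck_mul => //; first by apply: Ck_inner => //; [exact: Cz|exact: Cy].
    apply: Ck_inv => //; last exact: Cn.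
    by move=> s /nU[n_gt0 _ _]; rewrite gt_eqF.
  apply: Ck_tup3 => //.
    apply: Ck_scale => //; last exact: Cy.
    apply: Ck_mul => //.
      apply: Ck_sqrt => //; last exact: Cg.
      by move=> s /nU[].
    apply: Ck_inv => //; last exact: Cn.
    by move=> s /nU[n_gt0 _ _]; rewrite gt_eqF.
  apply: Ck_vopp => //; apply: Ck_scale => //; last first.
    by apply: Ck_bracket => //; exact: Cy.
  apply: Ck_inv => //.
    by move=> s /nU[n_gt0 _ _]; rewrite gt_eqF// sqrtr_gt0.
  apply: Ck_sqrt => //; last exact: Cn.
  by move=> s /nU[].
- rewrite /leaf_retraction -/(m 0) -/(n 0) n0 m0 sq4 sq2 zy0 mul0r scale0r subr0 divff ?expf_neq0//.
  rewrite scale1r y0 z0 bracketZl bracketZr (antiframe_tables F) !scalerN opprK.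
  by rewrite !scalerA mulKf.
have dline (v v' : su2 R) : is_derive (0 : R^o) (1 : R^o) (fun s : R^o => v + (s : R) *: v') v'.
  have := is_deriveD (is_derive_cst v (0 : R^o) (1 : R^o))
    (is_derive_scale (is_derive_id (0 : R^o) 1) (is_derive_cst v' (0 : R^o) (1 : R^o))).
  by apply: is_derive_congr => //; rewrite scaler0 addr0 scale1r add0r.
have dy : is_derive (0 : R^o) (1 : R^o) y (row 0 u) by exact: dline.
have dz : is_derive (0 : R^o) (1 : R^o) z (row 1 u) by exact: dline.
pose e := x 3 * f * A.
have E1 : inner (row 0 u) (y 0) = e.
  rewrite y0 /u leaf_tangentE row_tup /= innerZr !innerDl !innerZl !(antiframe_tables F).
  by rewrite /e; ring.
have E2 : inner (row 1 u) (z 0) = e.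
  rewrite z0 /u leaf_tangentE row_tup /= innerZr !innerDl !innerZl !(antiframe_tables F).
  by rewrite /e; ring.
have E3 : inner (row 1 u) (y 0) + inner (z 0) (row 0 u) = 0.
  rewrite y0 z0 /u leaf_tangentE !row_tup /= innerZr innerZl !innerDl !innerDr !innerZl !innerZr.
  by rewrite !(antiframe_tables F); ring.
have dn : is_derive (0 : R^o) (1 : R^o) n (2 * e).
  have := is_derive_inner dy dy.
  by apply: is_derive_congr => //; rewrite (innerC (y 0)) E1; ring.
have dk : is_derive (0 : R^o) (1 : R^o) (fun s => inner (z s) (y s) : R^o) 0.
  by have := is_derive_inner dz dy; rewrite E3.
have dnV : is_derive (0 : R^o) (1 : R^o) (fun s => (n s)^-1 : R^o) (- (2 * e / A ^+ 4)).
  have h : n 0 != 0 by rewrite n0 expf_neq0.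
  by have := is_derive_inv h dn; rewrite n0 -exprM.
have dc : is_derive (0 : R^o) (1 : R^o) (fun s => inner (z s) (y s) / inner (y s) (y s) : R^o) 0.
  have := is_deriveM dk dnV; apply: is_derive_congr => //.
  by rewrite zy0 /GRing.scale /=; ring.
have dw : is_derive (0 : R^o) (1 : R^o)
    (fun s => z s - (inner (z s) (y s) / inner (y s) (y s)) *: y s) (row 1 u).
  have := is_deriveB dz (is_derive_scale dc dy); apply: is_derive_congr => //.
  by rewrite zy0 mul0r !scale0r addr0 subr0.
have dm : is_derive (0 : R^o) (1 : R^o) m (4 * A ^+ 2 * e).
  have := is_deriveB (is_deriveM dn (is_deriveD
    (is_derive_cst (q ^+ 2 : R^o) (0 : R^o) (1 : R^o)) (is_derive_inner dz dz)))
    (is_deriveM dk dk).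
  apply: is_derive_congr => [s|]; first by rewrite /m /gram expr2.
  rewrite zy0 (innerC (z 0)) E2 n0 /GRing.scale /= !fctE zz0 -Aq.
  by ring.
(* The length factor, equal to 1 at s = 0, is stationary since
   <u1, a1> = <u2, a2>. *)
have dl : is_derive (0 : R^o) (1 : R^o)
    (fun s => Num.sqrt (gram (q ^+ 2) (y s) (z s)) / inner (y s) (y s) : R^o) 0.
  have h : 0 < m 0 by rewrite m0 !exprn_gt0.
  have := is_deriveM (is_derive_sqrt h dm) dnV; apply: is_derive_congr => //.
  by rewrite m0 n0 sq4 /GRing.scale /=; field.
have dr : is_derive (0 : R^o) (1 : R^o)
    (fun s => (Num.sqrt (inner (y s) (y s)))^-1 : R^o) (- (e / A ^+ 3)).
  have h : 0 < n 0 by rewrite n0 exprn_gt0.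
  have h' : Num.sqrt (n 0) != 0 by rewrite n0 sq2.
  have := @is_derive_inv _ (fun s => Num.sqrt (n s) : R^o) _ _ h' (is_derive_sqrt h dn); apply: is_derive_congr => //.
  by rewrite n0 sq2; field.
have := is_derive_tup3 (is_derive_scale dl dy) dw
  (is_deriveN (is_derive_scale dr (is_derive_bracket dy dw))).
apply: is_derive_congr => //.
rewrite -/(m 0) -/(n 0) m0 n0 zy0 sq4 sq2 mul0r !scale0r subr0 add0r.
rewrite divff ?expf_neq0// scale1r.
apply: mx3P; rewrite row_tup //=.
rewrite y0 z0 /u leaf_tangentE !row_tup /=.
apply: (antiframe_ext F);
  rewrite !(innerDl, innerDr, innerZl, innerZr, innerNl, innerNr, bracketDl,
    bracketDr, bracketZl, bracketZr, bracketNl, bracketNr)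
    !(antiframe_tables F) ?(bracketxx, inner0l, innerNl) ?(antiframe_tables F) /e;
  by field.
Unshelve. all: by end_near. Qed.

End retraction.

(** * The isomorphism onto a closed leaf *)

Section isomorphism.
Context {R : realType} (e1 : su2 R) (he1 : inner e1 e1 = 1) (q : R) (q0 : 0 <= q).
Let tau : 'M[R]_3 := tup [:: 0; q *: e1; 0].

Lemma nahm_flow_at0 (a : 'M[R]_3) : closed_leaf q a ->
  nahm_flow q a 0 = tup [:: row 2 a; row 0 a; row 1 a].
Proof.
move=> [A [f [p0 [p1 [p2 [F A0 Aq ->]]]]]].
by rewrite nahm_flowE// !row_tup /= shrink0 axial0 !mul1r.
Qed.

(** The matrix O relating (I, J, K) on the leaf to (I~, J~, K~). *)
Definition cycle_mx : 'M[R]_3 := \matrix_(i, j) (i == j + 1)%:R.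

Lemma cycle_mxP : cycle_mx^T *m cycle_mx = 1%:M /\ \det cycle_mx = 1.
Proof.
have k1 : [/\ (0 : 'I_3) + 1 = 1, (1 : 'I_3) + 1 = 2 & (2 : 'I_3) + 1 = 0].
  by split; apply/val_inj.
have [k01 k11 k21] := k1; split.
  apply/matrixP => i j; rewrite !mxE sum3E !mxE.
  by elim/ord3P: i; elim/ord3P: j; rewrite ?k01 ?k11 ?k21 /= ?mulr1n ?mulr0n; ring.
rewrite (expand_det_row _ ord0) sum3E /cofactor.
rewrite !(expand_det_row _ ord0) !big_ord_recl !big_ord0 /cofactor !det_mx11 !mxE /=.
by rewrite !(mul0r, mulr0, add0r, addr0); ring.
Qed.

Lemma tangent_data (B : R -> 'M[R]_3) : kronheimer_space tau B ->
  exists A f p0 p1 p2, [/\ antiframe p0 p1 p2, 0 < A, A ^+ 2 = q ^+ 2 + f ^+ 2,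
    h_map B = leaf_point A f p0 p1 p2 &
    forall b, kronheimer_tangent tau B b -> exists x,
      b 0 = qtuple A f p0 p1 p2 x /\ forall t, t <= 0 -> b t = qtuple
        (axial q A t * shrink q A t) (f * shrink q A t ^+ 2) p0 p1 p2 x].
Proof.
move=> KB; have [A [f [p0 [p1 [p2 [F A0 Aq aE]]]]]] := kronheimer_closed_leaf he1 KB.
exists A, f, p0, p1, p2; split=> // b.
rewrite (kronheimer_flow he1 q0 KB) aE => /(linearized_solution F A0 Aq)[x xE].
exists x; split=> //; rewrite xE// axial0 shrink0 expr1n !mulr1 //.
Qed.

(** Independent of the way in which the tensors of the target are defined: it
suffices that they are given by [lift_metric] and [lift_cplx] on velocities of
curves. *)
Lemma kronheimer_iso (Y : hk_manifold 'M[R]_3 'M[R]_3) :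
  carrier Y = closed_leaf q ->
  (forall (V : normedModType R) (U : set V) f,
     smooth_into Y U f <-> smooth_into_sub (closed_leaf q) U f) ->
  velocity Y = velocity_sub ->
  (forall A f p0 p1 p2 x y, antiframe p0 p1 p2 -> 0 < A ->
     A ^+ 2 = q ^+ 2 + f ^+ 2 -> let a := leaf_point A f p0 p1 p2 in
     let u := leaf_tangent (qtuple A f p0 p1 p2 x) in let v := leaf_tangent (qtuple A f p0 p1 p2 y) in
     metric Y a u v = lift_metric a u v /\
     forall k, cplx Y k a u = lift_cplx k a u) ->
  hk_isomorphism (kronheimer_hk tau) Y h_map.
Proof.
move=> cY sY vY tY; split.
  split.
    rewrite cY /=; split.
    - by move=> B; exact: kronheimer_closed_leaf.
    - move=> B B'; rewrite !inE => KB KB' BB'.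
      by rewrite (kronheimer_flow he1 q0 KB) BB' -(kronheimer_flow he1 q0 KB').
    - move=> a La; exists (nahm_flow q a); first exact: nahm_flow_kronheimer.
      exact: nahm_flow0.
  move=> n U f oU fK; rewrite sY; split=> [[_ fS]|[_ hS]].
    split=> [x Ux|k]; first exact: (kronheimer_closed_leaf he1 (fK x Ux)).
    have Ck0 := fS 0 (lexx 0) k.
    by apply: Ck_tup3 => //; exact: Ck_row.
  split=> // t t0 k.
  apply: (Ck_ext oU (f := fun x => nahm_flow q (h_map (f x)) t)).
    by move=> x Ux; rewrite -(kronheimer_flow he1 q0 (fK x Ux)).
  apply: Ck_flow => //.
  by move=> x Ux; exact: kronheimer_closed_leaf (fK x Ux).
exists (fun _ b => leaf_tangent (b 0)); split.
- move=> B b KB Tb; have [A [f [p0 [p1 [p2 [F A0 Aq aE bE]]]]]] := tangent_data KB.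
  have [x [b0 _]] := bE b Tb.
  have [U [g [[oU U0 gL gS] [g0 gv]]]] := tangent_curve x F A0 Aq.
  have nearU : \forall s \near (0 : R^o), U s by exact: open_nbhs_nbhs.
  exists U, (fun s => nahm_flow q (g s)); split; split=> //.
  + by move=> s Us; apply: nahm_flow_kronheimer => //; have [] := gL s Us.
  + split; first by move=> s Us; apply: nahm_flow_kronheimer => //; have [] := gL s Us.
    move=> t t0 k; apply: Ck_flow => //.
    by move=> s Us; have [] := gL s Us.
  + by rewrite g0 -aE -(kronheimer_flow he1 q0 KB).
  + have gr i : is_derive (0 : R^o) (1 : R^o) (fun s => row i (g s)) (row i (leaf_tangent (b 0))).
      apply/is_derive_mxP => k l; rewrite b0.
      have := (is_derive_mxP _ _ _).1 gv i l; apply: is_derive_congr => [s|];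
        by rewrite [RHS]mxE.
    have := is_derive_tup3 (gr 2) (gr 0) (gr 1).
    rewrite !row_tup /=; apply: near_eq_is_derive.
    near=> s; rewrite nahm_flow_at0//.
    by have [] := gL s _; [near: s|].
  + rewrite vY /velocity_sub b0; apply: near_eq_is_derive gv.
    near=> s; rewrite /= nahm_flow0//.
    by have [] := gL s _; [near: s|].
- move=> B b c KB Tb Tc; have [A [f [p0 [p1 [p2 [F A0 Aq aE bE]]]]]] := tangent_data KB.
  have [x [b0 bx]] := bE b Tb; have [y [c0 cy]] := bE c Tc.
  rewrite b0 c0 aE; have [-> _] := tY A f p0 p1 p2 x y F A0 Aq.
  rewrite lift_metric_leaf_tangent//; apply: esym; exact: (kronheimer_metricE q0 F A0 Aq bx cy).
- exists cycle_mx; have [OO detO] := cycle_mxP; split=> // B b j KB Tb.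
  have [A [f [p0 [p1 [p2 [F A0 Aq aE bE]]]]]] := tangent_data KB.
  have [x [b0 bx]] := bE b Tb.
  rewrite b0 aE; have [_ ->] := tY A f p0 p1 p2 x x F A0 Aq.
  rewrite /lift_cplx lift4_leaf_tangent// (bigD1 (j + 1))//= big1 => [|i ij]; last first.
    by rewrite mxE (negPf ij) scale0r.
  by rewrite mxE eqxx scale1r addr0 /kronheimer_cplx b0.
Unshelve. all: by end_near. Qed.

End isomorphism.

(** * The closure of the open leaf and of its tangent bundle *)

Section extension.
Context {R : realType}.

Lemma cvg_pair_point (I : Type) (F : set_system I) (FF : Filter F)
    (V W : topologicalType) (f : I -> V) (g : I -> W) (v : V) (w : W) :
  f s @[s --> F] --> v -> g s @[s --> F] --> w ->
  (f s, g s) @[s --> F] --> (v, w).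
Proof. by move=> fv gw; exact: (cvg_pair (G := nbhs v) (H := nbhs w)). Qed.

Lemma closure_cvg (T : topologicalType) (I : Type) (F : set_system I)
    (FF : ProperFilter F) (z : I -> T) (A : set T) p :
  z s @[s --> F] --> p -> (\forall s \near F, A (z s)) -> closure A p.
Proof.
move=> zp zA B Bp; have zB : \forall s \near F, B (z s) by exact: zp.
have [s [zAs zBs]] := filter_ex (filterI zA zB).
by exists (z s).
Qed.

Lemma closure_eq (T : topologicalType) (A : set T) (g : T -> R) c p :
  {for p, continuous g} -> (forall y, A y -> g y = c) -> closure A p -> g p = c.
Proof.
move=> gp gA Ap; have PF := within_nbhs_proper Ap.
have gl : g y @[y --> within A (nbhs p)] --> g p by exact: cvg_within_filter.
have gc : g y @[y --> within A (nbhs p)] --> c.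
  by apply: cvg_near_cst; rewrite near_withinE; apply: nearW => y /gA.
exact: (cvg_unique _ gl gc).
Qed.

Lemma closure_le (T : topologicalType) (A : set T) (g : T -> R) c p :
  {for p, continuous g} -> (forall y, A y -> g y <= c) -> closure A p -> g p <= c.
Proof.
move=> gp gA Ap; have PF := within_nbhs_proper Ap.
have gl : g y @[y --> within A (nbhs p)] --> g p by exact: cvg_within_filter.
by apply: cvgr_to_le gl _; rewrite near_withinE; apply: nearW => y /gA.
Qed.

Let Ck_inner_row i j k : Ck k setT (fun a : 'M[R]_3 => inner (row i a) (row j a) : R^o).
Proof.
have oT : open (@setT 'M[R]_3) by exact: openT.
by apply: Ck_inner => //; apply: Ck_row => //; exact: Ck_id.
Qed.

Let Ck_Phi k : Ck k setT (Phi : 'M[R]_3 -> R^o).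
Proof.
have oT : open (@setT 'M[R]_3) by exact: openT.
by apply: Ck_inner => //; last apply: Ck_bracket => //; apply: Ck_row => //; exact: Ck_id.
Qed.

Context (q : R) (q0 : 0 < q).

Lemma closure_leaf_subset (a : 'M[R]_3) : closure (leaf (q ^+ 2) 0) a -> closed_leaf q a.
Proof.
move=> La.
have ci i j : {for a, continuous (fun a => inner (row i a) (row j a))}.
  exact: (@Ck_inner_row i j 0%N).
have cd i j : {for a, continuous (fun a =>
    inner (row i a) (row i a) - inner (row j a) (row j a))}.
  have oT : open (@setT 'M[R]_3) by exact: openT.
  by apply: (@Ck_add _ _ _ _ _ _ 0%N oT (Ck_inner_row i i 0%N)
    (Ck_opp oT (Ck_inner_row j j 0%N))).
have n01 : inner (row 0 a) (row 0 a) - inner (row 1 a) (row 1 a) = q ^+ 2.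
  apply: (closure_eq (g := fun a => inner (row 0 a) (row 0 a) - inner (row 1 a) (row 1 a)) _ _ La).
    exact: cd.
  by move=> y [].
apply/closed_leafP; split=> //.
- move=> i j ij; apply: (closure_eq (ci i j) _ La) => y [orth _ _ _].
  exact: orth.
- apply: (closure_eq (g := fun a => inner (row 1 a) (row 1 a) - inner (row 2 a) (row 2 a)) _ _ La).
    exact: cd.
  by move=> y [].
- apply: (closure_le _ _ La); first exact: (@Ck_Phi 0%N).
  by move=> y [_ _ _ /ltW].
- apply: contraTneq q0 => a0; move: n01; rewrite a0 inner0l => n01.
  have := inner_ge0 (row 1 a); have q2 := sqr_ge0 q => h.
  have /eqP : q ^+ 2 = 0 by lra.
  by rewrite sqrf_eq0 => /eqP ->; rewrite ltxx.
Qed.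

Section at_point.
Context (A f : R) (p0 p1 p2 : su2 R) (F : antiframe p0 p1 p2) (A0 : 0 < A).
Context (Aq : A ^+ 2 = q ^+ 2 + f ^+ 2).

(* The points and tangent vectors obtained by replacing f by f + s. *)
Let B s : R := Num.sqrt (q ^+ 2 + (f + s) ^+ 2).
Let pt s := leaf_point (B s) (f + s) p0 p1 p2.
Let vec x s := leaf_tangent (qtuple (B s) (f + s) p0 p1 p2 x).

Let rad_gt0 s : 0 < q ^+ 2 + (f + s) ^+ 2.
Proof. by rewrite ltr_pwDl ?exprn_gt0// sqr_ge0. Qed.

Let B_gt0 s : 0 < B s. Proof. by rewrite sqrtr_gt0. Qed.

Let B2 s : B s ^+ 2 = q ^+ 2 + (f + s) ^+ 2.
Proof. by rewrite sqr_sqrtr// ltW. Qed.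

Let B_0 : B 0 = A.
Proof. by rewrite /B addr0 -Aq sqrtr_sqr gtr0_norm. Qed.

Let near_ne0 : \forall s \near (0 : R)^', f + s != 0.
Proof.
have [->|f0] := eqVneq f 0.
  by near=> s; rewrite add0r; near: s; exact: nbhs_dnbhs_neq.
near=> s; rewrite addrC addr_eq0; apply/eqP => sf.
have : `|s| < `|f| by near: s; apply: dnbhs0_lt; rewrite normr_gt0.
by rewrite sf normrN ltxx.
Unshelve. all: by end_near. Qed.

Let Cf k : Ck k setT (fun s : R^o => f + s : R^o).
Proof. by apply: Ck_add; [exact: openT|exact: Ck_cst openT|exact: Ck_id openT]. Qed.

Let CB k : Ck k setT (B : R^o -> R^o).
Proof.
have oT : open (@setT R^o) by exact: openT.
apply: (Ck_sqrt oT (fun s _ => rad_gt0 s)).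
apply: (Ck_add oT (Ck_cst (q ^+ 2 : R^o) k oT)).
exact: (Ck_ext oT (fun s _ => erefl) (Ck_mul oT (@Cf k) (@Cf k))).
Qed.

Let pt_cvg : pt s @[s --> (0 : R)^'] --> leaf_point A f p0 p1 p2.
Proof.
have oT : open (@setT R^o) by exact: openT.
have Cp (p : su2 R) := Ck_cst p 0 oT.
have C0 := Ck_scale oT (@CB 0) (Cp p0).
have C1 := Ck_scale oT (@Cf 0) (Cp p1).
have C2 := Ck_scale oT (@Cf 0) (Cp p2).
have h := Ck_tup3 oT C0 C1 C2.
have {}h : pt s @[s --> (0 : R)] --> pt 0 by exact: (h 0 I).
by move: h; rewrite {2}/pt B_0 addr0; exact: cvg_within_filter.
Qed.

Let vec_cvg x : vec x s @[s --> (0 : R)^'] --> leaf_tangent (qtuple A f p0 p1 p2 x).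
Proof.
have oT : open (@setT R^o) by exact: openT.
have Cp (p : su2 R) := Ck_cst p 0 oT.
have CM (c : R) g (p : su2 R) (Cg : Ck 0 setT (g : R^o -> R^o)) :=
  Ck_scale oT (Ck_mul oT (Ck_cst (c : R^o) 0 oT) Cg) (Cp p).
have CN (c : R) g (p : su2 R) (Cg : Ck 0 setT (g : R^o -> R^o)) :=
  Ck_scale oT (Ck_opp oT (Ck_mul oT (Ck_cst (c : R^o) 0 oT) Cg)) (Cp p).
have C3 g1 g2 g3 (h1 : Ck 0 setT (g1 : R^o -> su2 R)) (h2 : Ck 0 setT g2)
  (h3 : Ck 0 setT g3) := Ck_add oT (Ck_add oT h1 h2) h3.
have h := Ck_tup3 oT
  (C3 _ _ _ (CM (x 3) _ p0 (@Cf 0)) (CM (x 0) _ p1 (@CB 0)) (CN (x 1) _ p2 (@CB 0)))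
  (C3 _ _ _ (CN (x 0) _ p0 (@Cf 0)) (CM (x 3) _ p1 (@CB 0)) (CM (x 2) _ p2 (@CB 0)))
  (C3 _ _ _ (CM (x 1) _ p0 (@Cf 0)) (CN (x 2) _ p1 (@CB 0)) (CM (x 3) _ p2 (@CB 0))).
have vecE s : vec x s = _ := leaf_tangentE _ _ _ _ _ _.
have {}h : vec x s @[s --> (0 : R)] --> vec x 0.
  rewrite vecE; under eq_fun do rewrite vecE; exact: (h 0 I).
by move: h; rewrite {2}/vec B_0 addr0; exact: cvg_within_filter.
Qed.

Lemma closure_leaf_point : closure (leaf (q ^+ 2) 0) (leaf_point A f p0 p1 p2).
Proof.
apply: (closure_cvg _ pt_cvg); near=> s; apply: leaf_point_leaf => //.
by near: s; exact: near_ne0.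
Unshelve. all: by end_near. Qed.

Let vec_tangent x : \forall s \near (0 : R)^',
  tangent_sub (leaf (q ^+ 2) 0) (pt s) (vec x s).
Proof.
near=> s; have fs0 : f + s != 0 by near: s; exact: near_ne0.
have [U [g [[oU U0 gL gS] [g0 gv]]]] := tangent_curve x F (B_gt0 s) (B2 s).
exists U, g; split=> //; split=> // t Ut.
by apply/leafE; have [Lt Pt] := gL t Ut; split=> //; exact: Pt.
Unshelve. all: by end_near. Qed.

Let pt_leaf : \forall s \near (0 : R)^', leaf (q ^+ 2) 0 (pt s).
Proof.
near=> s; apply: leaf_point_leaf => //; near: s; exact: near_ne0.
Unshelve. all: by end_near. Qed.

Lemma closure_tangent1 x : closure
  [set z : 'M[R]_3 * 'M[R]_3 |
     leaf (q ^+ 2) 0 z.1 /\ tangent_sub (leaf (q ^+ 2) 0) z.1 z.2]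
  (leaf_point A f p0 p1 p2, leaf_tangent (qtuple A f p0 p1 p2 x)).
Proof.
apply: (closure_cvg _ (cvg_pair_point _ pt_cvg (@vec_cvg x))).
near=> s; split=> /=; near: s; [exact: pt_leaf|exact: vec_tangent].
Unshelve. all: by end_near. Qed.

(** On the zero section, keep the basis p and the coordinates x, and move f away
from 0. *)
Lemma closure_tangent2 x y : closure
  [set z : 'M[R]_3 * 'M[R]_3 * 'M[R]_3 |
     [/\ leaf (q ^+ 2) 0 z.1.1, tangent_sub (leaf (q ^+ 2) 0) z.1.1 z.1.2 &
         tangent_sub (leaf (q ^+ 2) 0) z.1.1 z.2]]
  (leaf_point A f p0 p1 p2, leaf_tangent (qtuple A f p0 p1 p2 x), leaf_tangent (qtuple A f p0 p1 p2 y)).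
Proof.
apply: (closure_cvg _ (cvg_pair_point _
  (cvg_pair_point _ pt_cvg (@vec_cvg x)) (@vec_cvg y))).
near=> s; split=> /=; near: s; [exact: pt_leaf|exact: vec_tangent|exact: vec_tangent].
Unshelve. all: by end_near. Qed.

End at_point.

Lemma closure_leaf : closure (leaf (q ^+ 2) 0) = closed_leaf q.
Proof.
apply/seteqP; split=> [a /closure_leaf_subset//|a [A [f [p0 [p1 [p2 [F A0 Aq ->]]]]]]].
exact: closure_leaf_point.
Qed.

End extension.

(** * Continuous extension of the tensors *)

Section lift_continuity.
Context {R : realType} (V : normedModType R) (U : set V) (oU : open U) (k : nat).

Lemma Ck_tup4 (f0 f1 f2 f3 : V -> su2 R) :
  Ck k U f0 -> Ck k U f1 -> Ck k U f2 -> Ck k U f3 ->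
  Ck k U (fun x => tup [:: f0 x; f1 x; f2 x; f3 x] : 'M[R]_(4, 3)).
Proof.
move=> h0 h1 h2 h3; apply: Ck_mx => // i j.
apply: (Ck_ext (f := fun x => nth 0 [:: f0 x; f1 x; f2 x; f3 x] i 0 j : R^o)) => //.
  by move=> x _; rewrite tupE.
by move: i; elim/ord4P => /=; exact: Ck_entry.
Qed.

Context (a : V -> 'M[R]_3) (Ca : Ck k U a).
Context (a0 : forall x, U x -> 0 < inner (row 0 (a x)) (row 0 (a x))).

Lemma Ck_lift4 (u : V -> 'M[R]_3) : Ck k U u -> Ck k U (fun x => lift4 (a x) (u x)).
Proof.
move=> Cu; apply: Ck_tup4; try exact: Ck_row.
apply: Ck_add => //; last (apply: Ck_vopp => //); apply: Ck_scale => //.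
- apply: Ck_mul => //; first by apply: Ck_inner => //; exact: Ck_row.
  apply: Ck_inv => //; first by move=> x /a0 h; rewrite gt_eqF.
  by apply: Ck_inner => //; exact: Ck_row.
- exact: Ck_row.
- apply: Ck_inv => //; first by move=> x /a0 h; rewrite gt_eqF// sqrtr_gt0.
  by apply: Ck_sqrt => //; apply: Ck_inner => //; exact: Ck_row.
- by apply: Ck_bracket => //; exact: Ck_row.
Qed.

Lemma Ck_lift_metric (u v : V -> 'M[R]_3) : Ck k U u -> Ck k U v ->
  Ck k U (fun x => lift_metric (a x) (u x) (v x) : R^o).
Proof.
move=> Cu Cv; have Lu := Ck_lift4 Cu; have Lv := Ck_lift4 Cv.
have Cr i : Ck k U (fun x => inner (row i (a x)) (row i (a x)) : R^o).
  by apply: Ck_inner => //; exact: Ck_row.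
apply: Ck_mul => //; first apply: Ck_mul => //.
- by apply: Ck_sqrt.
- by apply: Ck_sum => // j; apply: Ck_inner => //; exact: Ck_row.
- apply: Ck_inv => //.
    by move=> x /a0 h; rewrite gt_eqF// ltr_pwDl ?mulr_gt0// inner_ge0.
  by apply: Ck_add => //; apply: Ck_mul => //; exact: Ck_cst.
Qed.

Lemma Ck_lift_cplx (u : V -> 'M[R]_3) j : Ck k U u ->
  Ck k U (fun x => lift_cplx j (a x) (u x)).
Proof.
move=> Cu; have Lu := Ck_lift4 Cu.
have Lr i := Ck_row oU i Lu; have Ln i := Ck_vopp oU (Lr i).
suff Cj (i : 'I_3) : Ck k U (fun x => kronheimer_cplx i (fun=> lift4 (a x) (u x)) 0).
  by apply: Ck_tup3 => //; exact: (Ck_row oU _ (Cj _)).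
by move: i; elim/ord3P; exact: Ck_tup4.
Qed.

End lift_continuity.

(** A limit along S of a function which coincides on S with a function G
continuous at p is G p, provided that p adheres to S. *)
Lemma lim_within_eq (R : realType) (T : topologicalType) (W : normedModType R)
    (S : set T) (g G : T -> W) p : closure S p -> G z @[z --> p] --> G p ->
  (forall z, S z -> g z = G z) -> lim (g z @[z --> within S (nbhs p)]) = G p.
Proof.
move=> Sp GG gG; have PF := within_nbhs_proper Sp.
apply: cvg_lim; first exact: norm_hausdorff.
have : G z @[z --> within S (nbhs p)] --> G p by exact: cvg_within_filter.
apply: cvg_trans; apply: near_eq_cvg.
by rewrite near_withinE; apply: nearW => z /gG.
Qed.

Section extended_tensors.
Context {R : realType} (q : R) (q0 : 0 < q).
Context (A f : R) (p0 p1 p2 : su2 R) (F : antiframe p0 p1 p2) (A0 : 0 < A).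
Context (Aq : A ^+ 2 = q ^+ 2 + f ^+ 2).
Let a := leaf_point A f p0 p1 p2.

Let a_gt0 : 0 < inner (row 0 a) (row 0 a).
Proof.
by rewrite row_tup /= innerZl innerZr (antiframe_tables F) mulr1 mulr_gt0.
Qed.

Let open_domain (V : normedModType R) (g : V -> 'M[R]_3) : continuous g ->
  open [set z | 0 < inner (row 0 (g z)) (row 0 (g z))].
Proof.
move=> cg; have oT : open (@setT V) by exact: openT.
have Cg : Ck 0 setT g by move=> z _; exact: cg.
have h := Ck_inner oT (Ck_row oT 0 Cg) (Ck_row oT 0 Cg).
have gt0 : open [set r : R | 0 < r] by exact: open_gt.
have := @open_comp V R (fun z => inner (row 0 (g z)) (row 0 (g z))) _ _ gt0.
by apply => z _; exact: (h z I).
Qed.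

(** [leaf_metric] and [lift_metric] coincide along the tangent bundle of the open
leaf, to which (a, u, v) adheres. *)
Lemma ext_leaf_metricE x y (u := leaf_tangent (qtuple A f p0 p1 p2 x))
    (v := leaf_tangent (qtuple A f p0 p1 p2 y)) :
  ext_leaf_metric (q ^+ 2) a u v = lift_metric a u v.
Proof.
set V := ('M[R]_3 * 'M[R]_3 * 'M[R]_3)%type.
pose U : set V := [set z | 0 < inner (row 0 z.1.1) (row 0 z.1.1)].
have c11 : continuous (fun z : V => z.1.1).
  by move=> z; apply: continuous_comp; exact: cvg_fst.
have c12 : continuous (fun z : V => z.1.2).
  by move=> z; apply: continuous_comp; [exact: cvg_fst|exact: cvg_snd].
have c2 : continuous (fun z : V => z.2) by move=> z; exact: cvg_snd.
have oU : open U by exact: open_domain c11.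
have C11 : Ck 0 U (fun z : V => z.1.1) by move=> z _; exact: c11.
have C12 : Ck 0 U (fun z : V => z.1.2) by move=> z _; exact: c12.
have C2 : Ck 0 U (fun z : V => z.2) by move=> z _; exact: c2.
have CG := Ck_lift_metric oU C11 (fun _ h => h) C12 C2.
have cG := CG (a, u, v) a_gt0.
have := @lim_within_eq _ _ R^o _ (fun z => leaf_metric z.1.1 z.1.2 z.2) _ _
  (@closure_tangent2 _ _ q0 _ _ _ _ _ F A0 Aq x y) cG.
apply => -[[b u'] v'] /= [Lb Tu Tv].
have [A' [f' [r0 [r1 [r2 [F' A0' Aq' f0' bE]]]]]] := leaf_pointP Lb.
move: Tu Tv; rewrite bE => Tu Tv.
have [x' ->] := tangent_leaf F' A0' Aq' f0' Tu.
have [y' ->] := tangent_leaf F' A0' Aq' f0' Tv.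
by rewrite leaf_metric_leaf_tangent.
Qed.

Lemma ext_leaf_cplxE x (u := leaf_tangent (qtuple A f p0 p1 p2 x)) j :
  ext_leaf_cplx (q ^+ 2) j a u = lift_cplx j a u.
Proof.
set V := ('M[R]_3 * 'M[R]_3)%type.
pose U : set V := [set z | 0 < inner (row 0 z.1) (row 0 z.1)].
have c1 : continuous (fun z : V => z.1) by move=> z; exact: cvg_fst.
have c2 : continuous (fun z : V => z.2) by move=> z; exact: cvg_snd.
have oU : open U by exact: open_domain c1.
have C1 : Ck 0 U (fun z : V => z.1) by move=> z _; exact: c1.
have C2 : Ck 0 U (fun z : V => z.2) by move=> z _; exact: c2.
have CG := Ck_lift_cplx oU C1 (fun _ h => h) j C2.
have cG := CG (a, u) a_gt0.
have := @lim_within_eq _ _ _ _ (fun z => leaf_cplx j z.1 z.2) _ _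
  (@closure_tangent1 _ _ q0 _ _ _ _ _ F A0 Aq x) cG.
apply => -[b u'] /= [Lb Tu].
have [A' [f' [r0 [r1 [r2 [F' A0' Aq' f0' bE]]]]]] := leaf_pointP Lb.
move: Tu; rewrite bE => Tu.
have [x' ->] := tangent_leaf F' A0' Aq' f0' Tu.
by rewrite leaf_cplx_leaf_tangent.
Qed.

End extended_tensors.

Theorem theorem5p14 (R : realType) (e1 : su2 R) (he1 : inner e1 e1 = 1)
    (q : R) (hq : 0 <= q) :
  hk_isomorphism (kronheimer_hk (tup [:: 0; q *: e1; 0]))
    (if q == 0 then leaf_hk 0 0 else ext_leaf_hk (q ^+ 2))
    h_map.
Proof.
have [q0|qn0] := eqVneq q 0.
  apply: kronheimer_iso => //=.
  - by rewrite leaf0E q0.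
  - by move=> V U f; rewrite leaf0E q0.
  move=> A f p0 p1 p2 x y F A0 Aq.
  have f0 : f != 0.
    apply: contraTneq A0 => f0; have : A ^+ 2 = 0.
      by rewrite Aq f0 q0 expr0n addr0.
    by move=> /eqP; rewrite sqrf_eq0 => /eqP ->; rewrite ltxx.
  by split=> [|k]; [exact: leaf_metric_leaf_tangent|exact: leaf_cplx_leaf_tangent].
have q0 : 0 < q by rewrite lt0r qn0.
apply: kronheimer_iso => //=.
- exact: closure_leaf.
- by move=> V U f; rewrite closure_leaf.
move=> A f p0 p1 p2 x y F A0 Aq.
by split=> [|k]; [exact: ext_leaf_metricE|exact: ext_leaf_cplxE].
Qed.
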